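(* The following conditions are equivalent for any weakly quasi-o-minimal theory $T$ with simple semiintervals. 1) $T$ satisfies condition (R): for all $A\subseteq\mathfrak C$ and all $p\in S_1(A)$, every equivalence relation $E\in\mathcal E_p$ is relatively $0$-definable; 2) For all $A\subset\mathfrak C^{eq}$ every real sort type $p\in S_1(A)$ is trivial; 3) $T$ is binary.
   Context: $T$ is a complete one-sorted first-order theory with monster model $\mathfrak C$; parameter sets are small. $T$ is weakly quasi-o-minimal if there is a $0$-definable linear order $<$ on $\mathfrak C$ such that every parametrically definable subset of $\mathfrak C$ is a finite Boolean combination of $0$-definable sets and $<$-convex sets. $T$ is binary if every formula is equivalent modulo $T$ to a Boolean combination of formulae with at most two free variables. For $p\in S(A)$, $p(\mathfrak C)$ is its set of realizations; $X\subseteq p(\mathfrak C)^n$ is relatively $B$-definable if $X=\phi(\mathfrak C)\cap p(\mathfrak C)^n$ for some $L_B$-formula $\phi$ (relatively $0$-definable if $B=\emptyset$), and relatively definable if it is so for some $B$. A weakly o-minimal pair over $A$ is $\mathbf p=(p,<)$ where $p\in S(A)$, $<$ is a relatively $A$-definable linear order on $p(\mathfrak C)$, and every relatively definable subset of $p(\mathfrak C)$ is a finite union of $<$-convex subsets of $p(\mathfrak C)$; then $p$ is called weakly o-minimal. In a weakly quasi-o-minimal theory all complete 1-types of the real sort, over any $A$, are weakly o-minimal. $\mathcal E_p$ is the set of all relatively $A$-definable equivalence relations on $p(\mathfrak C)$. Simple semiintervals: a $\mathbf p$-semiinterval is a convex subset $S$ of $(p(\mathfrak C),<)$ such that $a=\min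 S$ exists and $S$ is relatively $Aa$-definable within $p(\mathfrak C)$; it is $\mathcal E_p$-determined if $S=\{x\in[a]_E\mid a\leqslant x\}$ for some $E\in\mathcal E_p$. The type $p$ has simple semiintervals if for every weakly o-minimal pair $\mathbf p=(p,<_p)$ over $A$ every $\mathbf p$-semiinterval is $\mathcal E_p$-determined; it has hereditarily simple semiintervals if every complete type (over any $B\supseteq A$) extending $p$ has simple semiintervals. $T$ has simple semiintervals if all $p\in S_1(T)$ have hereditarily simple semiintervals. Triviality: for a weakly o-minimal pair $\mathbf p=(p,<)$ over $A$, $\mathbf p_r$ is the global ($A$-invariant) type consisting of all formulae $\phi(x)$ over $\mathfrak C$ such that $\phi(\mathfrak C)$ contains a final part of $(p(\mathfrak C),<)$. For $a,b\models p$ write $a\triangleleft^{\mathbf p}b$ if $b\models(\mathbf p_r)_{\restriction Aa}$. A sequence $(a_i\mid i\in\omega)$ is Morley in $\mathbf p_r$ over $A$ if $a_i\models(\mathbf p_r)_{\restriction Aa_{<i}}$ for all $i$. A weakly o-minimal type $p\in S(A)$ is trivial if for some (equivalently, every) weakly o-minimal pair $\mathbf p=(p,<)$ over $A$, every sequence $(a_i\mid i\in\omega)$ of realizations of $p$ with $a_i\triangleleft^{\mathbf p}a_j$ for all $i<j$ is a Morley sequence in $\mathbf p_r$ over $A$. *)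

(* Defs.v *)
From mathcomp Require Import all_boot.
From mathcomp Require Import boolp classical_sets functions cardinality.

Set Implicit Arguments.
Unset Strict Implicit.
Unset Printing Implicit Defensive.

Local Open Scope classical_set_scope.

(* Many-sortedness is only needed to speak about C^eq; a one-sorted language
   is a [signature unit]. *)

Record signature (S : Type) := Signature {
  fn : Type;
  fn_ar : fn -> nat;
  fn_dom : forall f : fn, 'I_(fn_ar f) -> S;
  fn_cod : fn -> S;
  rl : Type;
  rl_ar : rl -> nat;
  rl_dom : forall r : rl, 'I_(rl_ar r) -> S }.

Section Syntax.
Context {S : Type}.

(* The variable [(s, n)] is the [n]-th variable of sort [s]. *)
Definition var : Type := (S * nat)%type.

Inductive term (L : signature S) : S -> Type :=
| Var (z : var) : term L z.1
| App (f : fn L) (ts : forall i, term L (@fn_dom S L f i)) :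
    term L (fn_cod f).

Inductive formula (L : signature S) : Type :=
| Bot
| Equal (s : S) (t u : term L s)
| Rel (r : rl L) (ts : forall i, term L (@rl_dom S L r i))
| Imp (phi psi : formula L)
| All (z : var) (phi : formula L).

Fixpoint occurs (L : signature S) (z : var) (s : S) (t : term L s) : Prop :=
  match t with
  | Var z' => z' = z
  | App f ts => exists i, occurs z (ts i)
  end.

Fixpoint free (L : signature S) (z : var) (phi : formula L) : Prop :=
  match phi with
  | Bot => False
  | Equal _ t u => occurs z t \/ occurs z u
  | Rel r ts => exists i, occurs z (ts i)
  | Imp phi psi => free z phi \/ free z psi
  | All z' phi => z' <> z /\ free z phi
  end.

End Syntax.

Arguments Bot {S L}.

Section Semantics.
Context {S : Type}.

Definition Not (L : signature S) (phi : formula L) : formula L := Imp phi Bot.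

Definition sentence (L : signature S) (phi : formula L) : Prop :=
  forall z, ~ free z phi.

Record structure (L : signature S) := Structure {
  carrier :> S -> Type;
  carrier_inhabited : forall s, inhabited (carrier s);
  fn_int : forall f : fn L,
    (forall i, carrier (@fn_dom S L f i)) -> carrier (fn_cod f);
  rl_int : forall r : rl L, (forall i, carrier (@rl_dom S L r i)) -> Prop }.

Definition assignment (L : signature S) (M : structure L) : Type :=
  forall z : @var S, M z.1.

Fixpoint eval (L : signature S) (M : structure L) (v : assignment M)
    (s : S) (t : term L s) : M s :=
  match t in term _ s return M s with
  | Var z => v z
  | App f ts => @fn_int L M f (fun i => eval v (ts i))
  end.

Fixpoint sat (L : signature S) (M : structure L) (v : assignment M)
    (phi : formula L) : Prop :=
  match phi with
  | Bot => False
  | Equal _ t u => eval v t = eval v u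
  | Rel r ts => @rl_int L M r (fun i => eval v (ts i))
  | Imp phi psi => sat v phi -> sat v psi
  | All z phi =>
      forall w : assignment M, (forall z', z' <> z -> w z' = v z') -> sat w phi
  end.

Definition in_vars (L : signature S) (s : S) (n : nat) (phi : formula L) :
    Prop :=
  forall z, free z phi -> z.1 = s /\ (z.2 < n)%N.

(* Truth of [phi(x_0, ..., x_{n-1})] at the tuple [a]; only used when
   [in_vars s n phi], so that the rest of the assignment is irrelevant. *)
Definition holds (L : signature S) (M : structure L) (s : S) (n : nat)
    (phi : formula L) (a : 'I_n -> M s) : Prop :=
  forall v : assignment M, (forall i : 'I_n, v (s, val i) = a i) -> sat v phi.

Definition models (L : signature S) (N : structure L)
    (T : set (formula L)) : Prop :=
  forall phi, T phi -> forall v : assignment N, sat v phi.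

Definition entails (L : signature S) (T : set (formula L))
    (phi : formula L) : Prop :=
  forall N : structure L, models N T -> forall v : assignment N, sat v phi.

Definition complete_theory (L : signature S) (T : set (formula L)) : Prop :=
  [/\ forall phi, T phi -> sentence phi,
      exists N : structure L, models N T
    & forall phi, sentence phi -> entails T phi \/ entails T (Not phi)].

Definition equiv_mod (L : signature S) (T : set (formula L))
    (phi psi : formula L) : Prop :=
  entails T (Imp phi psi) /\ entails T (Imp psi phi).

(* [Bot] and [Imp] generate all Boolean connectives. *)
Inductive bool_comb_formula (L : signature S) (P : set (formula L)) :
    formula L -> Prop :=
| bcf_base phi : P phi -> bool_comb_formula P phi
| bcf_bot : bool_comb_formula P Bot
| bcf_imp phi psi : bool_comb_formula P phi -> bool_comb_formula P psi ->
    bool_comb_formula P (Imp phi psi).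

Definition at_most_two_free (L : signature S) (phi : formula L) : Prop :=
  exists x y, forall z, free z phi -> z = x \/ z = y.

Definition binary_theory (L : signature S) (T : set (formula L)) : Prop :=
  forall phi : formula L, exists psi : formula L,
    bool_comb_formula (@at_most_two_free L) psi /\ equiv_mod T phi psi.

(* [with_pars M] is the language L(M); a formula over a parameter set [B] is
   an L(M)-formula whose constants come from [B]. *)

Definition elt (L : signature S) (M : structure L) : Type := {s : S & M s}.

Definition to_elt (L : signature S) (M : structure L) (s : S) (a : M s) :
    elt M := existT _ s a.

Definition with_pars (L : signature S) (M : structure L) : signature S :=
  @Signature S (fn L + elt M)%type
    (fun f => match f with inl f => fn_ar f | inr _ => 0 end)
    (fun f => match f return
                'I_(match f with inl f => fn_ar f | inr _ => 0 end) -> S with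
              | inl f => @fn_dom S L f
              | inr c => fun _ => projT1 c
              end)
    (fun f => match f with inl f => fn_cod f | inr c => projT1 c end)
    (rl L) (@rl_ar S L) (@rl_dom S L).

Definition expanded (L : signature S) (M : structure L) :
    structure (with_pars M) :=
  @Structure (with_pars M) M (carrier_inhabited M)
    (fun f => match f return
                (forall i, M (@fn_dom S (with_pars M) f i)) ->
                M (@fn_cod S (with_pars M) f) with
              | inl f => @fn_int L M f
              | inr c => fun _ => projT2 c
              end)
    (@rl_int L M).

Definition pformula (L : signature S) (M : structure L) : Type :=
  formula (with_pars M).

Fixpoint term_over (L : signature S) (M : structure L) (B : set (elt M))
    (s : S) (t : term (with_pars M) s) : Prop :=
  match t with
  | Var _ => True
  | App f ts =>
      match f with inl _ => True | inr c => B c end /\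
      forall i, term_over B (ts i)
  end.

Fixpoint over (L : signature S) (M : structure L) (B : set (elt M))
    (phi : pformula M) : Prop :=
  match phi with
  | Bot => True
  | Equal _ t u => term_over B t /\ term_over B u
  | Rel r ts => forall i, term_over B (ts i)
  | Imp phi psi => over B phi /\ over B psi
  | All _ phi => over B phi
  end.

Definition pholds (L : signature S) (M : structure L) (s : S) (n : nat)
    (phi : pformula M) (a : 'I_n -> M s) : Prop :=
  @holds (with_pars M) (expanded M) s n phi a.

(* Truth of [phi(x)] at [a], for a single variable [x] of sort [s]. *)
Definition pholds1 (L : signature S) (M : structure L) (s : S)
    (phi : pformula M) (a : M s) : Prop :=
  pholds phi (fun _ : 'I_1 => a).

Definition definable (L : signature S) (M : structure L) (B : set (elt M))
    (s : S) (n : nat) (X : set ('I_n -> M s)) : Prop :=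
  exists phi : pformula M,
    [/\ over B phi, in_vars s n phi & X = [set a | pholds phi a]].

(* Relative definability within [P]; [P] will be [p(C)] for a type [p]. *)
Definition rel_definable (L : signature S) (M : structure L) (s : S)
    (P : set (M s)) (B : set (elt M)) (n : nat) (X : set ('I_n -> M s)) :
    Prop :=
  exists Y : set ('I_n -> M s),
    definable B Y /\ X = Y `&` [set a | forall i, P (a i)].

Definition unary (T : Type) (X : set T) : set ('I_1 -> T) :=
  [set a | X (a ord0)].

Definition binary (T : Type) (R : T -> T -> Prop) : set ('I_2 -> T) :=
  [set a | R (a ord0) (a ord_max)].

Definition complete_type (L : signature S) (M : structure L)
    (A : set (elt M)) (s : S) (p : set (pformula M)) : Prop :=
  [/\ forall phi, p phi -> over A phi /\ in_vars s 1 phi,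
      forall X, finite_set X -> X `<=` p ->
        exists a : M s, forall phi, X phi -> pholds1 phi a
    & forall phi, over A phi -> in_vars s 1 phi -> p phi \/ p (Not phi)].

Definition realizations (L : signature S) (M : structure L) (s : S)
    (p : set (pformula M)) : set (M s) :=
  [set a | forall phi, p phi -> pholds1 phi a].

(* [small kappa A] means |A| < |kappa|. *)

Definition small (kappa U : Type) (A : set U) : Prop :=
  ~ ([set: kappa] #<= A)%card.

Definition saturated (kappa : Type) (L : signature S) (M : structure L) :
    Prop :=
  forall (A : set (elt M)) (s : S) (p : set (pformula M)),
    small kappa A -> complete_type A s p ->
    exists a : M s, realizations p a.

Definition elementary_on (L : signature S) (M : structure L)
    (D : set (elt M)) (f : forall s, M s -> M s) : Prop :=
  forall (phi : formula L) (v w : assignment M),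
    (forall z, free z phi -> D (to_elt (v z)) /\ w z = f z.1 (v z)) ->
    (sat v phi <-> sat w phi).

Definition automorphism (L : signature S) (M : structure L)
    (g : forall s, M s -> M s) : Prop :=
  [/\ forall s, bijective (g s),
      forall (f : fn L) (a : forall i, M (@fn_dom S L f i)),
        g _ (fn_int a) = fn_int (fun i => g _ (a i))
    & forall (r : rl L) (a : forall i, M (@rl_dom S L r i)),
        rl_int a <-> rl_int (fun i => g _ (a i))].

Definition strongly_homogeneous (kappa : Type) (L : signature S)
    (M : structure L) : Prop :=
  forall (D : set (elt M)) (f : forall s, M s -> M s),
    small kappa D -> elementary_on D f ->
    exists g : forall s, M s -> M s,
      automorphism g /\ forall s (a : M s), D (to_elt a) -> g s a = f s a.

(* The first clause is kappa > |T|, |T| being the number of L-formulas. *)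
Definition monster (kappa : Type) (L : signature S) (M : structure L) : Prop :=
  [/\ small kappa [set: formula L], saturated kappa M
    & strongly_homogeneous kappa M].

Definition linear_order_on (U : Type) (P : set U) (lt : U -> U -> Prop) :
    Prop :=
  [/\ forall a b, lt a b -> P a /\ P b,
      forall a, ~ lt a a,
      forall a b c, lt a b -> lt b c -> lt a c
    & forall a b, P a -> P b -> [\/ lt a b, a = b | lt b a]].

Definition equivalence_on (U : Type) (P : set U) (E : U -> U -> Prop) : Prop :=
  [/\ forall a b, E a b -> P a /\ P b,
      forall a, P a -> E a a,
      forall a b, E a b -> E b a
    & forall a b c, E a b -> E b c -> E a c].

Definition convex (U : Type) (P : set U) (lt : U -> U -> Prop) (X : set U) :
    Prop :=
  X `<=` P /\
  forall a b c, X a -> X c -> P b -> lt a b -> lt b c -> X b.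

Definition final_part (U : Type) (P : set U) (lt : U -> U -> Prop)
    (F : set U) : Prop :=
  [/\ F `<=` P, F !=set0 & forall a b, F a -> lt a b -> F b].

Inductive bool_comb (U : Type) (G : set (set U)) : set U -> Prop :=
| bc_base X : G X -> bool_comb G X
| bc_compl X : bool_comb G X -> bool_comb G (~` X)
| bc_union X Y : bool_comb G X -> bool_comb G Y -> bool_comb G (X `|` Y).

Definition weakly_o_minimal_pair (L : signature S) (M : structure L)
    (A : set (elt M)) (s : S) (p : set (pformula M))
    (lt : M s -> M s -> Prop) : Prop :=
  let P := realizations p in
  [/\ complete_type A s p,
      linear_order_on P lt,
      rel_definable P A (binary lt)
    & forall (B : set (elt M)) (X : set (M s)), rel_definable P B (unary X) ->
        exists (n : nat) (C : 'I_n -> set (M s)),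
          (forall i, convex P lt (C i)) /\ X = [set a | exists i, C i a]].

Definition in_E (L : signature S) (M : structure L) (A : set (elt M)) (s : S)
    (p : set (pformula M)) (E : M s -> M s -> Prop) : Prop :=
  let P := realizations p in
  equivalence_on P E /\ rel_definable P A (binary E).

Definition semiinterval (L : signature S) (M : structure L)
    (A : set (elt M)) (s : S) (p : set (pformula M))
    (lt : M s -> M s -> Prop) (a : M s) (I : set (M s)) : Prop :=
  let P := realizations p in
  [/\ convex P lt I,
      I a,
      forall x, I x -> a = x \/ lt a x
    & rel_definable P (A `|` [set to_elt a]) (unary I)].

Definition E_determined (L : signature S) (M : structure L)
    (A : set (elt M)) (s : S) (p : set (pformula M))
    (lt : M s -> M s -> Prop) (a : M s) (I : set (M s)) : Prop :=
  exists E : M s -> M s -> Prop,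
    in_E A p E /\ I = [set x | E a x /\ (a = x \/ lt a x)].

Definition simple_semiintervals (L : signature S) (M : structure L)
    (A : set (elt M)) (s : S) (p : set (pformula M)) : Prop :=
  forall lt : M s -> M s -> Prop, weakly_o_minimal_pair A p lt ->
  forall (a : M s) (I : set (M s)),
    semiinterval A p lt a I -> E_determined A p lt a I.

Definition hereditarily_simple_semiintervals (kappa : Type)
    (L : signature S) (M : structure L)
    (A : set (elt M)) (s : S) (p : set (pformula M)) : Prop :=
  forall (B : set (elt M)) (q : set (pformula M)),
    A `<=` B -> small kappa B -> complete_type B s q -> p `<=` q ->
    simple_semiintervals B s q.

(* p_r, viewed as a set of L(M)-formulas. *)
Definition right_type (L : signature S) (M : structure L) (s : S)
    (p : set (pformula M)) (lt : M s -> M s -> Prop) : set (pformula M) :=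
  [set phi | in_vars s 1 phi /\
     exists F, final_part (realizations p) lt F /\
               F `<=` [set a | pholds1 phi a]].

Definition restriction (L : signature S) (M : structure L)
    (q : set (pformula M)) (B : set (elt M)) : set (pformula M) :=
  [set phi | q phi /\ over B phi].

(* For a, b realizing p, this is the relation written with a triangle. *)
Definition right_of (L : signature S) (M : structure L) (A : set (elt M))
    (s : S) (p : set (pformula M)) (lt : M s -> M s -> Prop) (a b : M s) :
    Prop :=
  realizations (restriction (right_type p lt) (A `|` [set to_elt a])) b.

Definition morley (L : signature S) (M : structure L) (A : set (elt M))
    (s : S) (q : set (pformula M)) (a : nat -> M s) : Prop :=
  forall i, realizations
    (restriction q (A `|` [set c | exists2 j, (j < i)%N & c = to_elt (a j)]))
    (a i).

Definition trivial_type (L : signature S) (M : structure L)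
    (A : set (elt M)) (s : S) (p : set (pformula M)) : Prop :=
  exists lt : M s -> M s -> Prop,
    weakly_o_minimal_pair A p lt /\
    forall a : nat -> M s,
      (forall i, realizations p (a i)) ->
      (forall i j, (i < j)%N -> right_of A p lt (a i) (a j)) ->
      morley A (right_type p lt) a.

End Semantics.

Arguments trivial_type {S L M} A s p.
Arguments hereditarily_simple_semiintervals {S} kappa {L M} A s p.
Arguments simple_semiintervals {S L M} A s p.
Arguments complete_type {S L M} A s p.

Section OneSorted.
Context {L : signature unit} (M : structure L).

Definition weakly_quasi_o_minimal : Prop :=
  exists lt : M tt -> M tt -> Prop,
    [/\ linear_order_on setT lt,
        definable set0 (binary lt)
      & forall (B : set (elt M)) (X : set (M tt)), definable B (unary X) ->
          bool_comb
            [set Y | definable set0 (unary Y) \/ convex setT lt Y] X].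

Definition theory_simple_semiintervals (kappa : Type) : Prop :=
  forall p : set (pformula M), complete_type set0 tt p ->
    hereditarily_simple_semiintervals kappa set0 tt p.

Definition condition_R (kappa : Type) : Prop :=
  forall (A : set (elt M)) (p : set (pformula M)),
    small kappa A -> complete_type A tt p ->
    forall E : M tt -> M tt -> Prop, in_E A p E ->
      rel_definable (realizations p) set0 (binary E).

Definition pair_tuple (U : Type) (n : nat) (a b : 'I_n -> U) : 'I_(n + n) -> U :=
  fun i => match fintype.split i with inl j => a j | inr j => b j end.

Definition formula_rel (n : nat) (phi : formula L) (a b : 'I_n -> M tt) : Prop :=
  holds phi (pair_tuple a b).

(* A 0-definable equivalence relation on n-tuples, given by a formula in the
   variables x_0, ..., x_{n-1}, y_0 = x_n, ..., y_{n-1} = x_{2n-1}. *)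
Record eq_def := EqDef {
  eqd_ar : nat;
  eqd_formula : formula L;
  eqd_vars : in_vars tt (eqd_ar + eqd_ar) eqd_formula;
  eqd_equiv : equivalence_on setT (@formula_rel eqd_ar eqd_formula) }.

Inductive eq_sort : Type :=
| Real (u : unit)
| Imag (d : eq_def).

(* The language of C^eq, whose real sort is [Real tt]: L with, for each [d],
   a function symbol for the projection onto the
   classes of [d]. *)
Definition eq_signature : signature eq_sort :=
  @Signature eq_sort (fn L + eq_def)%type
    (fun f => match f with inl f => fn_ar f | inr d => eqd_ar d end)
    (fun f => match f return
                'I_(match f with inl f => fn_ar f | inr d => eqd_ar d end) ->
                eq_sort with
              | inl f => fun i => Real (@fn_dom unit L f i)
              | inr d => fun _ => Real tt
              end)
    (fun f => match f with inl f => Real (fn_cod f) | inr d => Imag d end)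
    (rl L) (@rl_ar unit L) (fun r i => Real (@rl_dom unit L r i)).

Definition eq_class (d : eq_def) : Type :=
  {X : set ('I_(eqd_ar d) -> M tt) |
    exists a, X = [set b | formula_rel (eqd_formula d) a b]}.

Definition proj_class (d : eq_def) (a : 'I_(eqd_ar d) -> M tt) : eq_class d :=
  exist _ [set b | formula_rel (eqd_formula d) a b] (ex_intro _ a erefl).

Definition eq_carrier (s : eq_sort) : Type :=
  match s with Real u => M u | Imag d => eq_class d end.

Lemma eq_carrier_inhabited (s : eq_sort) : inhabited (eq_carrier s).
Proof.
case: s => [u|d]; first exact: carrier_inhabited.
by case: (carrier_inhabited M tt) => a; split; exact: (proj_class (fun=> a)).
Qed.

Definition eq_structure : structure eq_signature :=
  @Structure _ eq_signature eq_carrier eq_carrier_inhabited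
    (fun f => match f return
                (forall i, eq_carrier (@fn_dom _ eq_signature f i)) ->
                eq_carrier (@fn_cod _ eq_signature f) with
              | inl f => @fn_int _ L M f
              | inr d => @proj_class d
              end)
    (fun r => @rl_int _ L M r).

Definition all_real_types_trivial (kappa : Type) : Prop :=
  forall (A : set (elt eq_structure)) (p : set (pformula eq_structure)),
    small kappa A -> complete_type A (Real tt) p -> trivial_type A (Real tt) p.

End OneSorted.

(* Main.v *)
Require Import Defs.
From mathcomp Require Import all_boot.
From mathcomp Require Import boolp classical_sets functions cardinality filter.
From mathcomp Require Import zify.

(* Identify a complete 1-type over B with an orbit of Aut(C/B).  If two points
   of one type over the empty set are separated by a definable set, then they
   are separated by a definable final segment with the same parameters; so by
   simplicity two points above [a] in its orbit over B are either conjugate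
   over Ba or separated by a convex B-definable equivalence relation on the
   orbit.  The argument is applied to the order and to its reverse.

   Two implications rest on one count.  If a relation X(c, y) marks two places
   of a sequence whose increasing subsequences are all conjugate, then moving
   the sequence yields conjugates of c indexed by a grid in which each row and
   each column is cut out by a union of at most N convex sets; such a grid has at
   most 2N rows.

   (1) => (3): under (R), points conjugate over Ab and over Ac are conjugate over
   Abc, for otherwise c would mark two distinct places of an indiscernible
   sequence; hence types of tuples are determined by those of pairs.
   (3) => (1): the parameters enter a binary formula only through 1-types.
   (1) => (2): the failures of an instance of a formula above its last parameter
   bound a semiinterval, which by (R) depends on that parameter only.
   (2) => (1): it is enough to drop one parameter c.  If E, relatively definable
   over Bc on the orbit of [a], is not induced by a relation over B, adjoin to B
   the codes of the classes of [a] for all B-definable relations coarser than E.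
   In the resulting type call two points far when no B-definable relation not
   coarser than E identifies them.  By triviality, increasing sequences of
   pairwise far points are all conjugate over B, however they jump from one
   E-class to another; so c can mark any two jumps, against the count. *)

Set Implicit Arguments.
Unset Strict Implicit.
Unset Printing Implicit Defensive.

Local Open Scope classical_set_scope.
Local Notation over := Defs.over.

(** * Classes of definable relations *)

Section Assignments.
Context {S : Type} {L : signature S} (M : structure L).
Implicit Types (v w : assignment M) (phi : formula L).

(** Everything is reduced to relations on the real sort. Formulas serve to show that definable
    relations form a class closed under connectives, quantifiers and substitution. A relation
    definable in C^eq belongs to every such class that contains the 0-definable relations and those
    naming its parameters; passing to representatives, extracting real constants and proving
    invariance are three instances of this one induction.

    Two obstacles shape the rest. Weak quasi-o-minimality and simplicity speak of a single type, so
    an inclusion, a convexity statement or transitivity holds on an orbit only, and saturation has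
    to spread it to a formula of the type. And conjugacy is available over small sets of real
    elements only: in (1) => (2) imaginary parameters give way to representatives, while in (2) =>
    (1) automorphisms over B that map one core point into the core stand in for automorphisms fixing
    the codes. Moreover triviality supplies an unknown order on that core, and the far points must
    first be placed on one side of it. *)

Definition upd v (z : var) (x : M z.1) : assignment M :=
  fun z' => match pselect (z = z') with
            | left e => eq_rect z (fun z' => M z'.1) x z' e
            | right _ => v z'
            end.

Arguments upd v z x : clear implicits.

Lemma upd_eq v z x : upd v z x z = x.
Proof.
rewrite /upd; case: pselect => // e.
by rewrite (Prop_irrelevance e (erefl z)).
Qed.

Lemma upd_neq v z x z' : z' <> z -> upd v z x z' = v z'.
Proof. by rewrite /upd; case: pselect => // e ne; case: ne. Qed.

Lemma sat_All v z phi : sat v (All z phi) <-> forall x, sat (upd v z x) phi.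
Proof.
split=> [h x|h w wv]; first by apply: h => z'; exact: upd_neq.
suff -> : w = upd v z (w z) by exact: h.
apply: functional_extensionality_dep => z'.
have [->|ne] := pselect (z' = z); first by rewrite upd_eq.
by rewrite upd_neq// wv.
Qed.

Lemma eval_ext v w s (t : term L s) :
  (forall z, occurs z t -> v z = w z) -> eval v t = eval w t.
Proof.
elim: t => [z|f ts IH] /= h; first exact: h.
congr fn_int; apply: functional_extensionality_dep => i.
by apply: IH => z zi; apply: h; exists i.
Qed.

Lemma sat_ext v w phi :
  (forall z, free z phi -> v z = w z) -> (sat v phi <-> sat w phi).
Proof.
elim: phi v w => [|s t u|r ts|phi IH psi IH'|z phi IH] v w //= h.
- by rewrite (@eval_ext v w _ t) ?(@eval_ext v w _ u)// => z zt; apply: h; auto.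
- suff -> : (fun i => eval v (ts i)) = (fun i => eval w (ts i)) by [].
  apply: functional_extensionality_dep => i; apply: eval_ext => z zi.
  by apply: h; exists i.
- have e1 := IH v w (fun z zf => h z (or_introl zf)).
  have e2 := IH' v w (fun z zf => h z (or_intror zf)).
  by split=> hh /e1 /hh /e2.
- have e x : sat (upd v z x) phi <-> sat (upd w z x) phi.
    apply: IH => z' z'f; have [->|ne] := pselect (z' = z).
      by rewrite !upd_eq.
    by rewrite !upd_neq//; apply: h; split=> // zz; exact: ne.
  by split=> /sat_All hh; apply/sat_All => x; apply/e.
Qed.

Lemma occurs_bound s (t : term L s) :
  exists N, forall z, occurs z t -> (z.2 < N)%N.
Proof.
elim: t => [z|f ts IH] /=; first by exists z.2.+1 => z' <-.
have [N hN] := choice IH.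
exists (\max_i N i) => z [i zi].
by apply: leq_trans (hN i z zi) _; exact: leq_bigmax.
Qed.

Lemma free_bound phi : exists N, forall z, free z phi -> (z.2 < N)%N.
Proof.
elim: phi => [|s t u|r ts|phi [n hn] psi [m hm]|z phi [n hn]] /=.
- by exists 0.
- have [n hn] := occurs_bound t; have [m hm] := occurs_bound u.
  exists (maxn n m) => z; rewrite leq_max.
  by move=> [/hn ->//|/hm ->]; rewrite orbT.
- have [N hN] := choice (fun i => occurs_bound (ts i)).
  exists (\max_i N i) => z [i zi].
  by apply: leq_trans (hN i z zi) _; exact: leq_bigmax.
- exists (maxn n m) => z; rewrite leq_max.
  by move=> [/hn ->//|/hm ->]; rewrite orbT.
- by exists n => z' [_ /hn].
Qed.

End Assignments.
Arguments upd {S L M} v z x.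

Section Definable_classes.
Context {U : Type}.
Implicit Types (v w y : nat -> U) (s : nat -> nat).

Definition upn v n u : nat -> U := fun i => if i == n then u else v i.
Definition scons u v : nat -> U := fun i => if i is i'.+1 then v i' else u.
Definition shift n v : nat -> U := fun i => v (n + i)%N.
Definition scat n y v : nat -> U := fun i => if (i < n)%N then y i else v (i - n)%N.

(* Relations are sets of infinite assignments; [dc_supp] replaces arities. *)
Record defclass (D : ((nat -> U) -> Prop) -> Prop) : Prop := Defclass {
  dc_bot : D (fun _ => False);
  dc_imp : forall X Y, D X -> D Y -> D (fun v => X v -> Y v);
  dc_all : forall n X, D X -> D (fun v => forall u, X (upn v n u));
  dc_eq : forall i j, D (fun v => v i = v j);
  dc_supp : forall X, D X -> exists N, forall v w,
    (forall i, (i < N)%N -> v i = w i) -> X v -> X w }.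

Section Closure.
Context {D : ((nat -> U) -> Prop) -> Prop} (HD : defclass D).
Implicit Types (X Y : (nat -> U) -> Prop).

Lemma d_ext X Y : (forall v, X v <-> Y v) -> D X -> D Y.
Proof.
move=> h; suff -> : X = Y by [].
by apply: funext => v; apply: propext.
Qed.

Lemma d_not X : D X -> D (fun v => ~ X v).
Proof. by move=> h; exact: (dc_imp HD h (dc_bot HD)). Qed.

Lemma d_True : D (fun _ => True).
Proof. by apply: d_ext (d_not (dc_bot HD)) => v; split=> // _ []. Qed.

Lemma d_or X Y : D X -> D Y -> D (fun v => X v \/ Y v).
Proof.
move=> /d_not hX hY; apply: d_ext (dc_imp HD hX hY) => v.
split; last by move=> [].
by move=> h; have [?|/h ?] := pselect (X v); [left|right].
Qed.

Lemma d_and X Y : D X -> D Y -> D (fun v => X v /\ Y v).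
Proof.
move=> /d_not hX /d_not hY; apply: d_ext (d_not (d_or hX hY)) => v.
by split=> [|[? ?] []//]; move=> /not_orP[/contrapT ? /contrapT ?].
Qed.

Lemma d_iff X Y : D X -> D Y -> D (fun v => X v <-> Y v).
Proof. by move=> hX hY; apply: d_and; apply: (dc_imp HD). Qed.

Lemma d_exn n X : D X -> D (fun v => exists u, X (upn v n u)).
Proof.
move=> /d_not /(dc_all HD n) /d_not; apply: d_ext => v.
split; last by move=> [u Xu] /(_ u).
by move=> /existsNP[u /contrapT Xu]; exists u.
Qed.

(** Classically such a proposition is true or false, whatever parameters it mentions; so a fact that
    is constant on an orbit may enter a 0-definable relation. *)
Lemma d_const (P : Prop) : D (fun _ => P).
Proof.
have [p|np] := pselect P; first by apply: d_ext d_True => v; split.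
by apply: d_ext (dc_bot HD) => v; split.
Qed.

Lemma d_bigand (I : finType) (X : I -> (nat -> U) -> Prop) :
  (forall i, D (X i)) -> D (fun v => forall i, X i v).
Proof.
move=> hX.
suff h (r : seq I) : D (fun v => forall i, i \in r -> X i v).
  apply: d_ext (h (enum I)) => v; split=> hh i; last by move=> _; exact: hh.
  by apply: hh; rewrite mem_enum.
elim: r => [|i r IH]; first by apply: d_ext d_True.
apply: d_ext (d_and (hX i) IH) => v; split.
  by move=> [xi xr] j; rewrite inE => /orP[/eqP->//|/xr].
by move=> h; split=> [|j jr]; apply: h; rewrite inE ?eqxx// jr orbT.
Qed.

Lemma supp_le X N : (forall v w, (forall i, (i < N)%N -> v i = w i) -> X v -> X w) ->
  forall v w, (forall i, (i < N)%N -> v i = w i) -> (X v <-> X w).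
Proof.
by move=> h v w vw; split; apply: h => // i /vw.
Qed.

(* Captures cannot occur here: the variables of the block are eliminated one
   at a time by quantifiers, and [t] points outside the block. *)
Lemma d_block X b k (t : nat -> nat) : D X ->
  (forall i, (i < k)%N -> (t i < b)%N \/ (b + k <= t i)%N) ->
  D (fun v => X (fun j => if (b <= j < b + k)%N then v (t (j - b)%N) else v j)).
Proof.
move=> DX; elim: k => [|k IH] ht.
  apply: d_ext DX => v.
  suff -> : (fun j => if (b <= j < b + 0)%N then v (t (j - b)%N) else v j) = v by [].
  by apply: funext => j; rewrite addn0; case: ifP => //; lia.
pose tk := t k.
have /ht htk : (k < k.+1)%N by [].
have {}IH := IH (fun i ik => match ht i (ltnW ik) with
  | or_introl h => or_introl h
  | or_intror h => or_intror (leq_trans (leq_add (leqnn b) (leqnSn k)) h) end).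
apply: d_ext (d_exn (b + k) (d_and (dc_eq HD (b + k)%N (t k)) IH)) => v.
have ntk : (t k == b + k)%N = false by lia.
set w := (fun j => if (b <= j < b + k.+1)%N then v (t (j - b)%N) else v j).
have e u : u = v (t k) -> (fun j => if (b <= j < b + k)%N then upn v (b + k) u (t (j - b)%N) else upn v (b + k) u j) = w.
  move=> eu; apply: funext => j; rewrite /w /upn.
  have [jb|jb] := boolP (b <= j < b + k)%N.
    have -> : (b <= j < b + k.+1)%N by lia.
    case: eqP => // tj.
    have hj : (j - b < k.+1)%N by lia.
    by have := ht _ hj; lia.
  case: eqP => [->|jbk].
    have -> : (b <= b + k < b + k.+1)%N by lia.
    by rewrite addKn.
  by have -> : (b <= j < b + k.+1)%N = false by lia.
split=> [[u [eu]]|h].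
  rewrite e//; by move: eu; rewrite /upn eqxx ntk.
exists (v (t k)); rewrite e//; split=> //; by rewrite /upn eqxx ntk.
Qed.

Lemma d_reindex X s : D X -> D (fun v => X (fun i => v (s i))).
Proof.
move=> DX; have [N hN] := dc_supp HD DX.
pose K := (maxn N (\max_(i < N) s i)).+1.
have hs i : (i < N)%N -> (s i < K)%N.
  move=> iN; rewrite /K ltnS leq_max; apply/orP; right.
  exact: (leq_bigmax (Ordinal iN)).
have NK : (N < K)%N by rewrite /K ltnS leq_maxl.
(* The renaming passes through the fresh block [K, 2K): [d_block] wants its targets outside the
   block, and [s] may permute variables. *)
have h1 := @d_block X 0 K (fun i => i + K)%N DX (fun i _ => or_intror (leq_addl i K)).
pose s' i := if (i < N)%N then s i else 0.
have h2 := @d_block _ K K s' h1.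
apply: d_ext (h2 _); last first.
  by move=> i iK; left; rewrite /s'; case: ifP => [/hs//|_]; lia.
move=> v; apply: (supp_le hN) => i iN /=.
rewrite add0n; have -> : (i < K)%N by lia.
have -> : (K <= i - 0 + K < K + K)%N by lia.
by rewrite subn0 addnK /s' iN.
Qed.

Lemma d_all (G : U -> (nat -> U) -> Prop) :
  D (fun v => G (v 0) (shift 1 v)) -> D (fun v => forall u, G u v).
Proof.
move=> DX; have [N hN] := dc_supp HD DX.
pose s i := if i is i'.+1 then i' else N.
apply: d_ext (dc_all HD N (d_reindex s DX)) => v.
split=> h u; have := h u.
- apply: (@hN (fun i => upn v N u (s i)) (scons u v)).
  by case=> [|i] iN /=; rewrite /upn /= ?eqxx//; case: eqP => //; lia.
- apply: (@hN (scons u v) (fun i => upn v N u (s i))).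
  by case=> [|i] iN /=; rewrite /upn /= ?eqxx//; case: eqP => //; lia.
Qed.

Lemma d_ex (G : U -> (nat -> U) -> Prop) :
  D (fun v => G (v 0) (shift 1 v)) -> D (fun v => exists u, G u v).
Proof.
move=> /d_not /(@d_all (fun u v => ~ G u v)) /d_not; apply: d_ext => v.
split; last by move=> [u Gu] /(_ u).
by move=> /existsNP[u /contrapT Gu]; exists u.
Qed.

Lemma d_ex_many n X : D X -> D (fun v => exists y : nat -> U, X (scat n y v)).
Proof.
elim: n X => [|n IH] X DX.
  apply: d_ext DX => v.
  have e y : scat 0 y v = v by apply: funext => i; rewrite /scat subn0.
  by split=> [h|[y]]; [exists v|]; rewrite e.
pose G u v := exists y : nat -> U, X (scat n.+1 (upn y n u) v).
have h : D (fun v => G (v 0) (shift 1 v)).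
  have sub := IH (fun v => X v) DX.
  apply: d_ext sub => v; rewrite /G.
  have e y : scat n.+1 (upn y n (v 0)) (shift 1 v) = scat n y v.
    apply: funext => i; rewrite /scat /upn /shift.
    case: (ltngtP i n) => [ni|ni|->].
    - by rewrite ltnS (ltnW ni).
    - by rewrite ltnS leqNgt ni/=; congr v; lia.
    - by rewrite ltnSn subnn.
  by split=> -[y h]; exists y; move: h; rewrite e.
apply: d_ext (d_ex h) => v; split=> [[u [y h']]|[y h']].
  by exists (upn y n u).
exists (y n), y; suff -> : upn y n (y n) = y by [].
by apply: funext => i; rewrite /upn; case: eqP => // ->.
Qed.

Lemma d_all_many n X : D X -> D (fun v => forall y : nat -> U, X (scat n y v)).
Proof.
move=> /d_not /(d_ex_many n) /d_not; apply: d_ext => v.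
split=> [h y|h [y]]; last by apply; exact: h.
by have [//|nX] := pselect (X (scat n y v)); case: h; exists y.
Qed.

Definition dterm (t : (nat -> U) -> U) := D (fun v => v 0 = t (shift 1 v)).

Lemma dterm_var i : dterm (fun v => v i).
Proof. exact: (dc_eq HD). Qed.

Lemma d_subst X (t : nat -> (nat -> U) -> U) :
  D X -> (forall i, dterm (t i)) -> D (fun v => X (fun i => t i v)).
Proof.
move=> DX dt; have [N hN] := dc_supp HD DX.
(* The context is stored from place N on, beyond the support of X, so that binding the places below
   N one by one cannot capture it; [r] brings it back at the end. *)
pose F k v := X (fun i => if (i < k)%N then t i (shift N v) else v i).
have h k : (k <= N)%N -> D (F k).
  elim: k => [|k IH] kN.
    by apply: d_ext DX => v; rewrite /F.
  pose s i := if i is i'.+1 then (N + i')%N else k.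
  apply: d_ext (d_exn k (d_and (d_reindex s (dt k)) (IH (ltnW kN)))) => v.
  have e u : shift N (upn v k u) = shift N v.
    by apply: funext => i; rewrite /shift /upn; case: eqP => //; lia.
  have e2 u : shift 1 (fun i => upn v k u (s i)) = shift N v.
    rewrite -(e u); apply: funext => i; by rewrite /shift.
  rewrite /F; split=> [[u]|hX].
    rewrite e2 e {1}/upn /= eqxx => -[-> hX].
    apply: hN hX => i _; rewrite /upn ltnS.
    by case: (ltngtP i k) => // ->.
  exists (t k (shift N v)); rewrite e2 e {1}/upn /= eqxx; split=> //.
  apply: hN hX => i _; rewrite /upn ltnS.
  by case: (ltngtP i k) => // ->.
pose r i := (i - N)%N.
apply: d_ext (d_reindex r (h N (leqnn N))) => v; rewrite /F.
apply: (supp_le hN) => i ->; congr (t i); apply: funext => j.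
by rewrite /shift /r addKn.
Qed.

Lemma d1 (R : U -> Prop) t : D (fun v => R (v 0)) -> dterm t -> D (fun v => R (t v)).
Proof. by move=> DR dt; exact: (d_subst (t := fun _ => t) DR). Qed.

Lemma d2 (R : U -> U -> Prop) t u : D (fun v => R (v 0) (v 1)) ->
  dterm t -> dterm u -> D (fun v => R (t v) (u v)).
Proof.
move=> DR dt du.
by apply: (d_subst (t := fun i => if i is 0 then t else u) DR); case.
Qed.

Lemma d3 (R : U -> U -> U -> Prop) t u r : D (fun v => R (v 0) (v 1) (v 2)) ->
  dterm t -> dterm u -> dterm r -> D (fun v => R (t v) (u v) (r v)).
Proof.
move=> DR dt du dr.
by apply: (d_subst (t := fun i => if i is 0 then t else if i is 1 then u else r) DR) => -[|[|]].
Qed.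

Lemma d_eq t u : dterm t -> dterm u -> D (fun v => t v = u v).
Proof. by move=> dt du; exact: (d2 (R := fun a b => a = b) (dc_eq HD 0 1) dt du). Qed.

End Closure.
End Definable_classes.

(** * Definable relations of a structure and of its imaginary sorts *)

Section Formula_classes.
Context {S : Type} {L : signature S} (N : structure L) (s0 : S).
Implicit Types (phi psi : formula L) (v : nat -> N s0) (w : assignment N).

Definition mkasg v : assignment N := fun z =>
  match pselect (s0 = z.1) with
  | left e => eq_rect s0 N (v z.2) z.1 e
  | right _ => projT1 (cid (let: inhabits x := carrier_inhabited N z.1 in
                            ex_intro (fun=> True) x I))
  end.

Lemma mkasgE v n : mkasg v (s0, n) = v n.
Proof.
rewrite /mkasg; case: pselect => //= e.
by rewrite (Prop_irrelevance e erefl).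
Qed.

Definition fclass (ok : formula L -> Prop) (X : (nat -> N s0) -> Prop) :=
  exists phi, ok phi /\ forall w, X (fun n => w (s0, n)) <-> sat w phi.

Definition ok_closed (ok : formula L -> Prop) := [/\ ok Bot,
  forall phi psi, ok phi -> ok psi -> ok (Imp phi psi),
  forall z phi, ok phi -> ok (All z phi)
  & forall s (t u : term L s), (exists z z', t = Var L (s, z) /\ u = Var L (s, z')) -> ok (Equal t u)].

Lemma fclass_defclass ok : ok_closed ok -> defclass (fclass ok).
Proof.
move=> [okb oki oka oke]; split.
- by exists Bot.
- move=> X Y [phi [ophi hphi]] [psi [opsi hpsi]].
  exists (Imp phi psi); split; first exact: oki.
  by move=> w; split=> /= h /hphi/h/hpsi.
- move=> n X [phi [ophi hphi]]; exists (All (s0, n) phi); split; first exact: oka.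
  move=> w; rewrite sat_All.
  have e (x : N s0) : (fun m => upd w (s0, n) x (s0, m) : N s0) = upn (fun m => w (s0, m) : N s0) n x.
    apply: funext => m; rewrite /upn; case: eqP => [->|ne]; first by rewrite upd_eq.
    by rewrite upd_neq// => -[].
  by split=> h x; have := h x; rewrite -hphi /= e.
- move=> i j; exists (Equal (Var L (s0, i)) (Var L (s0, j))); split=> //.
  by apply: oke; exists i, j.
- move=> X [phi [ophi hphi]]; have [n hn] := free_bound phi.
  exists n => v v' vv'.
  have e u : X u <-> sat (mkasg u) phi.
    by rewrite -hphi; suff -> : (fun m => mkasg u (s0, m) : N s0) = u by []; apply: funext => m; rewrite mkasgE.
  rewrite !e (@sat_ext _ _ _ (mkasg v) (mkasg v'))// => z /hn zn.
  by rewrite /mkasg; case: pselect => // e'; rewrite vv'.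
Qed.

Lemma holdsE n phi (a : 'I_n -> N s0) w : in_vars s0 n phi ->
  (forall i : 'I_n, w (s0, val i) = a i) -> (holds phi a <-> sat w phi).
Proof.
move=> iv wa; split; first exact.
move=> h v va; move: h; rewrite (@sat_ext _ _ _ w v)// => -[s m] /iv /= [-> mn].
by have := wa (Ordinal mn); have := va (Ordinal mn) => /= -> ->.
Qed.

Lemma occurs_list s (t : term L s) :
  exists l : seq {classic @var S}, forall z : {classic @var S}, occurs z t -> z \in l.
Proof.
elim: t => [z|f ts IH] /=; first by exists [:: z] => z' <-; rewrite mem_head.
have [l hl] := choice IH.
exists (flatten [seq l i | i <- enum 'I_(fn_ar f)]) => z [i zi].
by apply/flatten_mapP; exists i; [rewrite mem_enum|exact: hl].
Qed.

Lemma free_list phi :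
  exists l : seq {classic @var S}, forall z : {classic @var S}, free z phi -> z \in l.
Proof.
elim: phi => [|s t u|r ts|phi [l hl] psi [l' hl']|z phi [l hl]] /=.
- by exists [::].
- have [l hl] := occurs_list t; have [l' hl'] := occurs_list u.
  by exists (l ++ l') => z; rewrite mem_cat => -[/hl ->|/hl' ->]//; rewrite orbT.
- have [l hl] := choice (fun i => occurs_list (ts i)).
  exists (flatten [seq l i | i <- enum 'I_(rl_ar r)]) => z [i zi].
  by apply/flatten_mapP; exists i; [rewrite mem_enum|exact: hl].
- by exists (l ++ l') => z; rewrite mem_cat => -[/hl ->|/hl' ->]//; rewrite orbT.
- by exists l => z' [_ /hl].
Qed.

Lemma fclass_free ok X (K : nat -> Prop) : ok_closed ok -> fclass ok X ->
  (forall v w : nat -> N s0, (forall i, K i -> v i = w i) -> X v -> X w) ->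
  exists phi, [/\ ok phi, forall z, free z phi -> z.1 = s0 /\ K z.2 &
    forall w, X (fun n => w (s0, n)) <-> sat w phi].
Proof.
move=> [okb oki oka oke] [phi [ophi hphi]] hX; have [l hl] := free_list phi.
pose good (z : {classic @var S}) := z.1 = s0 /\ K z.2.
suff [psi [opsi fpsi hpsi]] : exists psi, [/\ ok psi,
    forall z, free z psi -> good z \/ free z phi /\ (z : {classic _}) \notin l &
    forall w, X (fun n => w (s0, n)) <-> sat w psi].
  exists psi; split=> // z /fpsi [//|[/hl zl]].
  by rewrite zl.
have {hl} : forall z, free z phi -> good z \/ free z phi by right.
elim: l phi ophi hphi => [|x l IH] phi ophi hphi h.
  by exists phi; split=> // z zf; right.
have [gx|ngx] := pselect (good x).
  have [psi [? fpsi ?]] := IH phi ophi hphi h.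
  exists psi; split=> // z /fpsi [|[zf zl]]; first by left.
  have [->|zx] := pselect (z = x); first by left.
  right; split=> //; rewrite inE negb_or zl andbT.
  by apply/eqP.
have [||//|psi [opsi fpsi hpsi]] := IH (All x phi).
- exact: oka.
- move=> w; rewrite sat_All; split=> [hw y|hw].
    apply/hphi; apply: hX hw => i ni; rewrite upd_neq// => e.
    by apply: ngx; rewrite -e.
  apply: (hX (fun n => upd w x (w x) (s0, n) : N s0)); last exact/hphi.
    move=> i ni; rewrite upd_neq// => e.
    by apply: ngx; rewrite -e.
- by move=> z zf; right.
exists psi; split=> // z /fpsi [|[/= [xz zf] zl]]; first by left.
right; split=> //; rewrite inE negb_or zl andbT.
by apply/eqP => zx; apply: xz.
Qed.

Lemma fclass_in_vars ok X n : ok_closed ok -> fclass ok X ->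
  (forall v w : nat -> N s0, (forall i, (i < n)%N -> v i = w i) -> X v -> X w) ->
  exists phi, [/\ ok phi, in_vars s0 n phi &
    forall w, X (fun n => w (s0, n)) <-> sat w phi].
Proof. exact: fclass_free. Qed.

End Formula_classes.

(** * Translation of C^eq into the real sort *)

Section Translations.
Context {L : signature unit} (M : structure L).
Local Notation U := (M tt).
Local Notation Meq := (eq_structure M).
Implicit Types (v : nat -> U).

(** A sort of a one-sorted language may be a variable of type [unit], not convertible to [tt]; this
    is the transport between the two. *)
Definition cst (u : unit) : U -> M u := match u with tt => id end.

Lemma cstE (w : assignment M) (u : unit) n : w (u, n) = cst u (w (tt, n)).
Proof. by case: u. Qed.

Lemma cst_inj u : injective (@cst u).
Proof. by case: u. Qed.

Definition dfn0 : (((nat -> U) -> Prop) -> Prop) := @fclass _ L M tt (fun=> True).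

Lemma dfn0_defclass : defclass dfn0.
Proof. by apply: fclass_defclass; split. Qed.

(** Every element of C^eq is named by a sequence of real elements, of which the first [width s]
    entries count; a formula of C^eq thus becomes a relation between names. *)
Definition abs (s : @eq_sort L M) (t : nat -> U) : Meq s :=
  match s return Meq s with
  | Real u => cst u (t 0)
  | Imag d => @proj_class L M d (fun i : 'I_(eqd_ar d) => t i)
  end.

Definition width (s : @eq_sort L M) : nat :=
  match s with Real _ => 1 | Imag d => eqd_ar d end.

Definition untuple n (a : 'I_n -> U) : nat -> U := fun i =>
  match insub i with
  | Some j => a j
  | None => projT1 (cid (let: inhabits x := carrier_inhabited M tt in
                            ex_intro (fun=> True) x I))
  end.

Lemma untupleE n (a : 'I_n -> U) (i : 'I_n) : untuple a i = a i.
Proof. by rewrite /untuple valK. Qed.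

Lemma abs_surj s (x : Meq s) : exists t, abs s t = x.
Proof.
case: s x => [[]|d] x; first by exists (fun=> x).
case: x => X [a Xa]; exists (untuple a); rewrite /= /proj_class.
apply: eq_exist => /=; rewrite Xa.
by rewrite (_ : (fun i : 'I__ => untuple a i) = a)//; apply: funext => i; rewrite untupleE.
Qed.

Lemma abs_ext s (t t' : nat -> U) : (forall i, (i < width s)%N -> t i = t' i) ->
  abs s t = abs s t'.
Proof.
case: s => [u|d] h /=; first by rewrite h.
by congr proj_class; apply: funext => i; rewrite h.
Qed.

Lemma proj_class_eq (d : eq_def M) a b :
  proj_class a = proj_class b :> eq_class d <-> formula_rel (M := M) (eqd_formula d) a b.
Proof.
have [_ rfl sym trs] := eqd_equiv d.
split=> [/(congr1 (fun X => proj1_sig X b)) /= h|ab].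
  by move: h => -> ; exact: rfl.
apply: eq_exist; apply/seteqP; split=> x; last exact: trs.
by apply: trs; exact: sym.
Qed.

Lemma dfn0_formula_rel (d : eq_def M) :
  dfn0 (fun v => formula_rel (M := M) (eqd_formula d)
    (fun i : 'I_(eqd_ar d) => v i) (fun i : 'I_(eqd_ar d) => v (eqd_ar d + i)%N)).
Proof.
exists (eqd_formula d); split=> // w; apply: holdsE; first exact: eqd_vars.
move=> i; rewrite /pair_tuple; by case: fintype.splitP => j /= ->.
Qed.

Section Into_class.
Context (D : ((nat -> U) -> Prop) -> Prop) (HD : defclass D).
Hypothesis D0 : forall X, dfn0 X -> D X.

Lemma d_abs_eq s (f g : nat -> nat) :
  D (fun v => abs s (fun i => v (f i)) = abs s (fun i => v (g i))).
Proof.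
case: s => [u|d] /=.
  by apply: d_ext (dc_eq HD (f 0) (g 0)) => v; split=> [->//|/cst_inj].
pose h i := if (i < eqd_ar d)%N then f i else g (i - eqd_ar d)%N.
apply: d_ext (d_reindex HD h (D0 (dfn0_formula_rel d))) => v.
rewrite proj_class_eq /h.
rewrite (_ : (fun i : 'I_(eqd_ar d) => _) = (fun i : 'I_(eqd_ar d) => v (f i))); last first.
  by apply: funext => i; rewrite ltn_ord.
rewrite (_ : (fun i : 'I_(eqd_ar d) => v (if _ then _ else _)) = (fun i : 'I_(eqd_ar d) => v (g i)))//.
by apply: funext => i; rewrite ltnNge leq_addr /= addKn.
Qed.

Lemma d_fn (f : fn L) (g : nat -> nat) (k : nat) :
  D (fun v => @fn_int _ L M f (fun i : 'I_(fn_ar f) => cst (fn_dom i) (v (g i))) = cst (fn_cod f) (v k)).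
Proof.
have h : dfn0 (fun v => @fn_int _ L M f (fun i : 'I_(fn_ar f) => cst (fn_dom i) (v i.+1)) = cst (fn_cod f) (v 0)).
  exists (Equal (App (fun i : 'I_(fn_ar f) => Var L (fn_dom i, i.+1))) (Var L (fn_cod f, 0))).
  split=> // w /=; rewrite -cstE.
  suff -> : (fun i : 'I_(fn_ar f) => cst (fn_dom i) (w (tt, i.+1))) = (fun i => w (fn_dom i, i.+1)) by [].
  by apply: functional_extensionality_dep => i; rewrite -cstE.
exact: (d_reindex HD (fun i => if i is i'.+1 then g i' else k) (D0 h)).
Qed.

Lemma d_rl (r : rl L) (g : nat -> nat) :
  D (fun v => @rl_int _ L M r (fun i : 'I_(rl_ar r) => cst (rl_dom i) (v (g i)))).
Proof.
have h : dfn0 (fun v => @rl_int _ L M r (fun i : 'I_(rl_ar r) => cst (rl_dom i) (v i))).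
  exists (Rel (fun i : 'I_(rl_ar r) => Var L (rl_dom i, val i))).
  split=> // w /=.
  suff -> : (fun i : 'I_(rl_ar r) => cst (rl_dom i) (w (tt, val i))) = (fun i => w (rl_dom i, val i)) by [].
  by apply: functional_extensionality_dep => i; rewrite -cstE.
exact: (d_reindex HD g (D0 h)).
Qed.

Context (A : set (elt Meq)).
Hypothesis DA : forall c, A c ->
  forall g : nat -> nat, D (fun v => projT2 c = abs (projT1 c) (fun i => v (g i))).

Definition asgn (sg : @var (@eq_sort L M) -> nat -> nat) v :
  assignment (expanded Meq) := fun z => abs z.1 (fun i => v (sg z i)).

Lemma d_term s (t : term (with_pars Meq) s) : term_over A t ->
  forall sg g, D (fun v => eval (asgn sg v) t = abs s (fun i => v (g i))).
Proof.
elim: t => [z|f ts IH] /=.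
  by move=> _ sg g; exact: d_abs_eq.
case: f ts IH => [[f|d]|c] ts IH [Af ots] sg g /=.
(* The arguments are named by a block of [fn_ar f] new variables placed in front; the old variables
   move up by as much, hence the shifted [sg]. *)
- pose X v := (forall i : 'I_(fn_ar f), eval (asgn (fun z k => fn_ar f + sg z k)%N v) (ts i) =
      abs (Real M (fn_dom i)) (fun=> v i)) /\ @fn_int _ L M f (fun i : 'I_(fn_ar f) => cst (fn_dom i) (v i)) = cst (fn_cod f) (v (fn_ar f + g 0)%N).
  have DX : D X.
    apply: (d_and HD) (d_fn f id (fn_ar f + g 0)%N).
    by apply: (d_bigand HD) => i; exact: (IH i (ots i) _ (fun=> val i)).
  apply: d_ext (d_ex_many HD (fn_ar f) DX) => v.
  have shE y k : scat (fn_ar f) y v (fn_ar f + k)%N = v k by rewrite /scat ltnNge leq_addr /= addKn.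
  have atE y (i : 'I_(fn_ar f)) : scat (fn_ar f) y v i = y i by rewrite /scat ltn_ord.
  have asE y : asgn (fun z k => fn_ar f + sg z k)%N (scat (fn_ar f) y v) = asgn sg v.
    by apply: functional_extensionality_dep => z; rewrite /asgn; congr abs; apply: funext => k; exact: shE.
  have argE y : (fun i : 'I_(fn_ar f) => cst (fn_dom i) (scat (fn_ar f) y v i)) = (fun i : 'I_(fn_ar f) => cst (fn_dom i) (y i)).
    by apply: functional_extensionality_dep => i; rewrite atE.
  split=> [[y]|h].
    rewrite /X asE argE shE => -[h <-]; congr fn_int.
    by apply: functional_extensionality_dep => i; rewrite h /= atE.
  have [y hy] := choice (fun i => abs_surj (eval (asgn sg v) (ts i))).
  exists (untuple (fun i => y i 0)); rewrite /X asE argE shE; split=> [i|].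
    by rewrite atE untupleE -hy.
  rewrite -h; congr fn_int; apply: functional_extensionality_dep => i.
  by rewrite untupleE -hy.
- pose n := eqd_ar d.
  pose X v := (forall i : 'I_n, eval (asgn (fun z k => n + sg z k)%N v) (ts i) = v i) /\ proj_class (d := d) (fun i : 'I_n => v i) = proj_class (d := d) (fun i : 'I_n => v (n + g i)%N).
  have DX : D X.
    apply: (d_and HD) (d_abs_eq (Imag d) id (fun i => n + g i)%N).
    by apply: (d_bigand HD) => i; exact: (IH i (ots i) _ (fun=> val i)).
  apply: d_ext (d_ex_many HD n DX) => v.
  have shE y k : scat n y v (n + k)%N = v k by rewrite /scat ltnNge leq_addr /= addKn.
  have atE y (i : 'I_n) : scat n y v i = y i by rewrite /scat ltn_ord.
  have asE y : asgn (fun z k => n + sg z k)%N (scat n y v) = asgn sg v.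
    by apply: functional_extensionality_dep => z; rewrite /asgn; congr abs; apply: funext => k; exact: shE.
  have argE y : (fun i : 'I_n => scat n y v i) = (fun i : 'I_n => y i).
    by apply: funext => i; rewrite atE.
  have argE' y : (fun i : 'I_n => scat n y v (n + g i)%N) = (fun i : 'I_n => v (g i)).
    by apply: funext => i; rewrite shE.
  split=> [[y]|h].
    rewrite /X asE argE argE' => -[h <-]; congr proj_class.
    by apply: funext => i; rewrite h atE.
  exists (untuple (fun i => eval (asgn sg v) (ts i))); rewrite /X asE argE argE'; split=> [i|].
    by rewrite atE untupleE.
  rewrite -h; congr proj_class; apply: funext => i.
  by rewrite untupleE.
- exact: DA.
Qed.

Lemma d_formula (phi : pformula Meq) : over A phi ->
  forall sg, D (fun v => sat (asgn sg v) phi).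
Proof.
elim: phi => [|s t u|r ts|phi IH psi IH'|z phi IH] /=.
- by move=> _ _; exact: (dc_bot HD).
- move=> [ot ou] sg; pose n := width s.
  pose X v := eval (asgn (fun z k => n + sg z k)%N v) t = abs s v /\ eval (asgn (fun z k => n + sg z k)%N v) u = abs s v.
  have DX : D X by apply: (d_and HD); exact: d_term _ (fun k => k).
  apply: d_ext (d_ex_many HD n DX) => v.
  have asE y : asgn (fun z k => n + sg z k)%N (scat n y v) = asgn sg v.
    apply: functional_extensionality_dep => z; rewrite /asgn; congr abs; apply: funext => k.
    by rewrite /scat ltnNge leq_addr /= addKn.
  rewrite /X; split=> [[y]|h]; first by rewrite asE => -[-> ->].
  have [y hy] := abs_surj (eval (asgn sg v) t).
  exists y; rewrite asE -h -hy; split; apply: abs_ext => i ni; by rewrite /scat ni.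
- move=> ots sg; pose n := rl_ar r.
  pose X v := (forall i : 'I_n, eval (asgn (fun z k => n + sg z k)%N v) (ts i) =
      abs (Real M (@rl_dom _ L r i)) (fun=> v i)) /\ @rl_int _ L M r (fun i : 'I_n => cst (@rl_dom _ L r i) (v i)).
  have DX : D X.
    apply: (d_and HD) (@d_rl r id).
    by apply: (d_bigand HD) => i; exact: (d_term (ots i) _ (fun=> val i)).
  apply: d_ext (d_ex_many HD n DX) => v.
  have shE y k : scat n y v (n + k)%N = v k by rewrite /scat ltnNge leq_addr /= addKn.
  have atE y (i : 'I_n) : scat n y v i = y i by rewrite /scat ltn_ord.
  have asE y : asgn (fun z k => n + sg z k)%N (scat n y v) = asgn sg v.
    by apply: functional_extensionality_dep => z; rewrite /asgn; congr abs; apply: funext => k; exact: shE.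
  have argE y : (fun i : 'I_n => cst (@rl_dom _ L r i) (scat n y v i)) = (fun i : 'I_n => cst (@rl_dom _ L r i) (y i)).
    by apply: functional_extensionality_dep => i; rewrite atE.
  split=> [[y]|h].
    rewrite /X asE argE => -[h].
    suff -> : (fun i => cst (@rl_dom _ L r i) (y i)) = (fun i => eval (asgn sg v) (ts i)) by [].
    by apply: functional_extensionality_dep => i; rewrite h /= atE.
  have [y hy] := choice (fun i => abs_surj (eval (asgn sg v) (ts i))).
  exists (untuple (fun i => y i 0)); rewrite /X asE argE; split=> [i|].
    by rewrite atE untupleE -hy.
  suff -> : (fun i : 'I_n => cst (@rl_dom _ L r i) (untuple (fun i => y i 0) i)) = (fun i => eval (asgn sg v) (ts i)) by [].
  by apply: functional_extensionality_dep => i; rewrite untupleE -hy.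
- by move=> [o1 o2] sg; apply: (dc_imp HD); [exact: IH|exact: IH'].
- move=> op sg; pose n := width z.1.
  pose sg' z' k := if pselect (z' = z) then k else (n + sg z' k)%N.
  apply: d_ext (d_all_many HD n (IH op sg')) => v.
  have asE y : asgn sg' (scat n y v) = upd (asgn sg v) z (abs z.1 y).
    apply: functional_extensionality_dep => z'; rewrite /asgn /sg'.
    case: pselect => [e|ne].
      subst z'; by rewrite upd_eq; apply: abs_ext => i ni; rewrite /scat ni.
    rewrite upd_neq//; congr abs; apply: funext => k.
    by rewrite /scat ltnNge leq_addr /= addKn.
  apply: iff_trans (iff_sym (@sat_All _ _ (expanded Meq) (asgn sg v) z phi)).
  split=> h x; last by rewrite asE; exact: h.
  by have [y <-] := abs_surj x; rewrite -asE; exact: h.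
Qed.

(** [D] is kept arbitrary because it will be the class of real relations definable over a set, then
    that of A-definable relations with real constants, then that of relations preserved by an
    automorphism. *)
Lemma d_eqclass X : @fclass _ _ (expanded Meq) (Real M tt) (over A) X -> D X.
Proof.
move=> [phi [ophi hphi]]; apply: d_ext (d_formula ophi (fun z k => z.2)) => v.
by rewrite -hphi.
Qed.

End Into_class.

Fixpoint emb_term (s : unit) (t : term (with_pars M) s) : term (with_pars Meq) (Real M s) :=
  match t in term _ s return term (with_pars Meq) (Real M s) with
  | Var z => Var (with_pars Meq) (Real M z.1, z.2)
  | App f ts =>
      match f return (forall i, term (with_pars Meq) (Real M (@fn_dom _ (with_pars M) f i))) ->
        term (with_pars Meq) (Real M (@fn_cod _ (with_pars M) f)) with
      | inl f => fun us => @App _ (with_pars Meq) (inl (inl f)) us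
      | inr c => fun us => @App _ (with_pars Meq) (inr (@to_elt _ _ Meq (Real M (projT1 c)) (projT2 c))) us
      end (fun i => emb_term (ts i))
  end.

Fixpoint emb (phi : pformula M) : pformula Meq :=
  match phi with
  | Bot => Bot
  | Equal _ t u => Equal (emb_term t) (emb_term u)
  | Rel r ts => @Rel _ (with_pars Meq) r (fun i => emb_term (ts i))
  | Imp phi psi => Imp (emb phi) (emb psi)
  | All z phi => All (Real M z.1, z.2) (emb phi)
  end.

Definition real_part (w : assignment (expanded Meq)) : assignment (expanded M) :=
  fun z => w (Real M z.1, z.2).

Lemma emb_termE s (t : term (with_pars M) s) w : eval w (emb_term t) = eval (real_part w) t.
Proof.
elim: t => [z|[f|c] ts IH] //=.
congr fn_int; apply: functional_extensionality_dep => i; exact: IH.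
Qed.

Lemma embE (phi : pformula M) w : sat w (emb phi) <-> sat (real_part w) phi.
Proof.
elim: phi w => [|s t u|r ts|phi IH psi IH'|z phi IH] w //=.
- by rewrite !emb_termE.
- suff -> : (fun i => eval w (emb_term (ts i))) = (fun i => eval (real_part w) (ts i)) by [].
  by apply: functional_extensionality_dep => i; rewrite emb_termE.
- by split=> h /IH /h /IH'.
- have e x : real_part (upd w (Real M z.1, z.2) x) = upd (real_part w) z x.
    apply: functional_extensionality_dep => z'; rewrite /real_part.
    have [->|ne] := pselect (z' = z).
      by rewrite [RHS]upd_eq; exact: (@upd_eq _ _ (expanded Meq) w (Real M z.1, z.2)).
    by rewrite !upd_neq//; case: z z' {x} ne => [? ?] [? ?] ne [e1 e2]; apply: ne; rewrite e1 e2.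
  split=> /sat_All h; apply/sat_All => x; have := h x; rewrite ?IH ?e//.
Qed.

Definition emb_elt (c : elt M) : elt Meq := @to_elt _ _ Meq (Real M (projT1 c)) (projT2 c).

Lemma emb_term_over B s (t : term (with_pars M) s) :
  term_over B t -> term_over (emb_elt @` B) (emb_term t).
Proof.
elim: t => [z|[f|c] ts IH] //= [Bf ots]; split=> //.
- by move=> i; exact: (IH i (ots i)).
- exact: (imageP emb_elt Bf).
- by move=> i; exact: (IH i (ots i)).
Qed.

Lemma emb_over B (phi : pformula M) : over B phi -> over (emb_elt @` B) (emb phi).
Proof.
elim: phi => [|s t u|r ts|phi IH psi IH'|z phi IH] //=.
- by move=> [? ?]; split; exact: emb_term_over.
- by move=> h i; exact: emb_term_over.
- by move=> [? ?]; split; [exact: IH|exact: IH'].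
Qed.

Lemma fclass_emb B X : @fclass _ _ (expanded M) tt (over B) X ->
  @fclass _ _ (expanded Meq) (Real M tt) (over (emb_elt @` B)) X.
Proof.
move=> [phi [ophi hphi]]; exists (emb phi); split; first exact: emb_over.
by move=> w; rewrite embE -hphi.
Qed.

Fixpoint par_term (s : unit) (t : term L s) : term (with_pars M) s :=
  match t with
  | Var z => Var (with_pars M) z
  | App f ts => @App _ (with_pars M) (inl f) (fun i => par_term (ts i))
  end.

Fixpoint par (phi : formula L) : pformula M :=
  match phi with
  | Bot => Bot
  | Equal _ t u => Equal (par_term t) (par_term u)
  | Rel r ts => @Rel _ (with_pars M) r (fun i => par_term (ts i))
  | Imp phi psi => Imp (par phi) (par psi)
  | All z phi => All z (par phi)
  end.

Lemma par_termE s (t : term L s) (w : assignment (expanded M)) :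
  eval w (par_term t) = @eval _ _ M w _ t.
Proof.
elim: t => [z|f ts IH] //=.
congr fn_int; apply: functional_extensionality_dep => i; exact: IH.
Qed.

Lemma parE (phi : formula L) (w : assignment (expanded M)) :
  sat w (par phi) <-> @sat _ _ M w phi.
Proof.
elim: phi w => [|s t u|r ts|phi IH psi IH'|z phi IH] w //=.
- by rewrite !par_termE.
- suff -> : (fun i => eval w (par_term (ts i))) = (fun i => @eval _ _ M w _ (ts i)) by [].
  by apply: functional_extensionality_dep => i; rewrite par_termE.
- by split=> h /IH /h /IH'.
- by split=> h w' hw'; apply/IH; exact: h.
Qed.

Lemma par_term_over B s (t : term L s) : term_over (M := M) B (par_term t).
Proof. by elim: t => [z|f ts IH] //=. Qed.

Lemma par_over B (phi : formula L) : over (M := M) B (par phi).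
Proof.
elim: phi => [|s t u|r ts|phi IH psi IH'|z phi IH] //=.
- by split; exact: par_term_over.
- by move=> i; exact: par_term_over.
Qed.

Lemma dfn0_fclass B X : dfn0 X -> @fclass _ _ (expanded M) tt (over B) X.
Proof.
move=> [phi [_ hphi]]; exists (par phi); split; first exact: par_over.
by move=> w; rewrite parE -hphi.
Qed.

End Translations.

(** * Small sets *)

Section Cardinals.
Local Open Scope card_scope.

Lemma card_le_of_inj (T U : Type) (A : set T) (B : set U) (f : T -> U) :
  (forall x, A x -> B (f x)) -> (forall x y, A x -> A y -> f x = f y -> x = y) ->
  A #<= B.
Proof.
move=> fAB finj.
have [g] : $|{injfun A >-> B}|.
  by apply/injfunPex; exists f => // x y /set_mem Ax /set_mem Ay; exact: finj.
exact: inj_card_le.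
Qed.

Lemma inj_of_card_le (T U : Type) (A : set T) (B : set U) (u0 : U) : A #<= B ->
  exists f : T -> U, (forall x, A x -> B (f x)) /\
    (forall x y, A x -> A y -> f x = f y -> x = y).
Proof.
move=> /card_leP[g].
exists (fun x => match pselect (A x) with
  | left ax => val (g (SigSub (mem_set ax))) | right _ => u0 end).
split=> [x Ax|x y Ax Ay]; first by case: pselect => // ax; exact: set_valP.
case: pselect => // ax; case: pselect => // ay /val_inj gxy.
have : SigSub (mem_set ax) = SigSub (mem_set ay) :> A.
  by apply: (inj (f := g)) => //; rewrite ?inE.
by move=> /(congr1 val).
Qed.

(* An infinite set [A] splits into countably infinite pieces and a finite
   remainder, which gives [A * nat <= A]. *)
Lemma card_le_times_nat (T : Type) (A : set T) : infinite_set A ->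
  exists h : T -> nat -> T, (forall x n, A x -> A (h x n)) /\
    (forall x n y m, A x -> A y -> h x n = h y m -> x = y /\ n = m).
Proof.
move=> Ainf.
have embnat (C : set T) : infinite_set C -> exists g : nat -> T,
    (forall n, C (g n)) /\ injective g.
  move=> Cinf; have [t0 _] := infinite_setN0 Cinf.
  have [g [gC ginj]] := inj_of_card_le t0 ((infiniteP _).1 Cinf).
  by exists g; split=> [n|n m]; [exact: gC|exact: ginj].
pose ok (F : set (nat -> T)) := (forall g, F g -> injective g /\ forall n, A (g n)) /\
  forall g g' n m, F g -> F g' -> g n = g' m -> g = g'.
have [F [[Fok Fdisj] Fmax]] : exists F, ok F /\ forall G, F `<` G -> ~ ok G.
  apply: Zorn_bigcup => C Cok Ctot; split=> [g [G CG Gg]|g g' n m [G CG Gg] [G' CG' Gg']].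
    exact: (Cok G CG).1.
  have [GG'|G'G] := Ctot G G' CG CG'.
    by apply: (Cok G' CG').2 => //; exact: GG'.
  by apply: (Cok G CG).2 => //; exact: G'G.
pose R := A `\` [set x | exists2 g, F g & exists n, x = g n].
have Rfin : finite_set R.
  apply: contrapT => /embnat[g [gR ginj]].
  have nFg : ~ F g.
    by move=> Fg; have [_] := gR 0; apply; exists g => //; exists 0.
  apply: (Fmax (F `|` [set g])).
    by split=> [x|/(_ g (or_intror erefl))//]; left.
  split=> [h [/Fok//|->]|h h' n m]; first by split=> // n; exact: (gR n).1.
  move=> [Fh|->] [Fh'|->] //; first exact: Fdisj.
    by move=> e; have [_] := gR m; case; exists h => //; exists n.
  by move=> e; have [_] := gR n; case; exists h' => //; exists m.
have [g0 Fg0] : exists g, F g.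
  apply: contrapT => nF; apply: Ainf; apply: sub_finite_set Rfin => x Ax.
  by split=> // -[g Fg]; case: nF; exists g.
have [idx idxinj] : exists idx : T -> nat, forall x y, R x -> R y -> idx x = idx y -> x = y.
  have [f [_ finj]] := inj_of_card_le 0 (finite_set_countable Rfin).
  by exists f.
have dec x : A x -> ~ R x -> exists p : (nat -> T) * nat, F p.1 /\ x = p.1 p.2.
  move=> Ax nRx; apply: contrapT => h; apply: nRx; split=> // -[g Fg [n xgn]].
  by apply: h; exists (g, n).
pose code (p : nat * nat) := choice.pickle p.
have codeinj : injective code by exact: (pcan_inj (@choice.pickleK _)).
have dec' x : exists p : (nat -> T) * nat, A x -> ~ R x -> F p.1 /\ x = p.1 p.2.
  have [Ax|nAx] := pselect (A x); last by exists (g0, 0).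
  have [Rx|nRx] := pselect (R x); first by exists (g0, 0).
  by have [p hp] := dec x Ax nRx; exists p.
have [d hd] := choice dec'.
pose h x n := if pselect (R x) then g0 (code (idx x, n)).*2.+1 else (d x).1 (code ((d x).2, n)).*2.
exists h; split=> [x n Ax|x n y m Ax Ay].
  rewrite /h; case: pselect => [Rx|nRx]; first exact: (Fok g0 Fg0).2.
  exact: (Fok _ (hd x Ax nRx).1).2.
rewrite /h; case: pselect => [Rx|nRx]; case: pselect => [Ry|nRy] e.
- have := (Fok g0 Fg0).1 _ _ e; move=> [] /(can_inj doubleK) /codeinj [] e1 ->.
  by rewrite (idxinj x y).
- have [Fd yd] := hd y Ay nRy.
  have eg := Fdisj _ _ _ _ Fg0 Fd e; rewrite -eg in e.
  by have := (Fok g0 Fg0).1 _ _ e; lia.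
- have [Fd xd] := hd x Ax nRx.
  have eg := Fdisj _ _ _ _ Fg0 Fd (esym e); rewrite -eg in e.
  by have := (Fok g0 Fg0).1 _ _ e; lia.
- have [Fd xd] := hd x Ax nRx; have [Fd' yd] := hd y Ay nRy.
  have eg := Fdisj _ _ _ _ Fd Fd' e; rewrite -eg in e yd.
  have := (Fok _ Fd).1 _ _ e; move=> /(can_inj doubleK) /codeinj [] e1 ->.
  by rewrite xd yd e1.
Qed.

Context (kappa : Type) (S : Type) (L : signature S).
Hypothesis small_formulas : small kappa [set: formula L].
Context (s0 : S).

Lemma small_le (T U : Type) (A : set T) (B : set U) : A #<= B -> small kappa B -> small kappa A.
Proof. by move=> AB sB kA; apply: sB; exact: card_le_trans kA AB. Qed.

Lemma small_sub (T : Type) (A B : set T) : A `<=` B -> small kappa B -> small kappa A.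
Proof. by move=> /subset_card_le; exact: small_le. Qed.

Lemma nat_le_formulas : [set: nat] #<= [set: formula L].
Proof.
apply: (@card_le_of_inj _ _ _ _ (fun n => All (s0, n) Bot)) => // n m _ _.
by move=> [].
Qed.

Lemma kappa_infinite : infinite_set [set: kappa].
Proof.
move=> kfin; apply: small_formulas; apply: card_le_trans nat_le_formulas.
exact: finite_set_countable.
Qed.

Lemma small_countable (T : Type) (A : set T) : countable A -> small kappa A.
Proof. by move=> cA; apply: small_le cA _ => /card_le_trans/(_ nat_le_formulas). Qed.

(** Hilbert's hotel: if an injection [g] of kappa takes the value [c] at [k0], then [nxt] pushes
    [k0] and a sequence [j] of other points one step along, and [g \o nxt] avoids [c]. *)
Lemma small_setU1 (T : Type) (A : set T) (c : T) : small kappa A -> small kappa (A `|` [set c]).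
Proof.
move=> sA kA; have [g [gA ginj']] := inj_of_card_le c kA.
have ginj : injective g by move=> k k'; exact: ginj'.
apply: sA.
have [[k0 gk0]|ngc] := pselect (exists k, g k = c); last first.
  apply: (card_le_of_inj (f := g)) => [k _|k k' _ _]; last exact: ginj.
  by have [//|e] := gA k I; case: ngc; exists k.
have kinf : infinite_set ([set: kappa] `\` [set k0]).
  by apply: infinite_setD; [exact: kappa_infinite|exact: finite_set1].
have [j [jk jinj']] := inj_of_card_le k0 ((infiniteP _).1 kinf).
have jinj : injective j by move=> n m; exact: jinj'.
pose nxt k := if pselect (k = k0) then j 0 else
  match pselect (exists n, k = j n) with left e => j (projT1 (cid e)).+1 | right _ => k end.
have nxt_j n : nxt (j n) = j n.+1.
  rewrite /nxt; case: pselect => [e|ne0]; first by case: (jk n I).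
  case: pselect => [e|ne]; last by case: ne; exists n.
  by move: (cid e) => [m p] /=; rewrite (jinj _ _ p).
have nxt0 : nxt k0 = j 0 by rewrite /nxt; case: pselect.
have nxt_else k : k <> k0 -> ~ (exists n, k = j n) -> nxt k = k.
  by move=> k1 k2; rewrite /nxt; case: pselect => //; case: pselect.
apply: (card_le_of_inj (f := g \o nxt)) => [k _|k k' _ _ /= /ginj].
  have nk0 : nxt k <> k0.
    have [->|ne] := pselect (k = k0); first by rewrite nxt0; exact: (jk 0 I).2.
    have [[n ->]|nj] := pselect (exists n, k = j n); first by rewrite nxt_j; exact: (jk _ I).2.
    by rewrite nxt_else.
  have [//|e] := gA (nxt k) I; case: nk0; apply: ginj => //.
  by rewrite gk0.
have [->|ne] := pselect (k = k0); have [->|ne'] := pselect (k' = k0) => //.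
- rewrite nxt0; have [[n ->]|nj] := pselect (exists n, k' = j n).
    by rewrite nxt_j => /jinj.
  by rewrite nxt_else// => e; case: nj; exists 0.
- rewrite nxt0; have [[n ->]|nj] := pselect (exists n, k = j n).
    by rewrite nxt_j => /jinj.
  by rewrite nxt_else// => e; case: nj; exists 0.
- have [[n ->]|nj] := pselect (exists n, k = j n); have [[m ->]|nj'] := pselect (exists n, k' = j n).
  + by rewrite !nxt_j => /jinj [->].
  + by rewrite nxt_j (nxt_else k')// => e; case: nj'; exists n.+1.
  + by rewrite nxt_j (nxt_else k)// => e; case: nj; exists m.+1.
  + by rewrite !nxt_else.
Qed.

(** Serves to replace each imaginary parameter by a sequence of representatives. An infinite A
    absorbs the factor nat; a finite A gives a countable set, which is small because there are
    infinitely many formulas. *)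
Lemma small_seq_bigcup (T U : Type) (A : set T) (r : T -> nat -> U) : small kappa A ->
  small kappa [set u | exists2 x, A x & exists n, u = r x n].
Proof.
move=> sA; have [Afin|Ainf] := pselect (finite_set A).
  apply: small_countable.
  have [t0|nT] := pselect (inhabited T); last first.
    rewrite (_ : [set u | _] = set0); first by exact: finite_set_countable.
    by apply/seteqP; split=> // u [x Ax]; case: nT.
  have [u0|nU] := pselect (inhabited U); last first.
    rewrite (_ : [set u | _] = set0); first by exact: finite_set_countable.
    by apply/seteqP; split=> // u; case: nU.
  have [f [_ finj]] := inj_of_card_le 0 (finite_set_countable Afin).
  case: t0 => t0.
  have dec u : exists p : T * nat, (exists2 x, A x & exists n, u = r x n) -> A p.1 /\ u = r p.1 p.2.
    have [[x Ax [n un]]|h] := pselect (exists2 x, A x & exists n, u = r x n).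
      by exists (x, n).
    by exists (t0, 0).
  have [d hd] := choice dec.
  apply: (card_le_of_inj (f := fun u => choice.pickle (f (d u).1, (d u).2))) => // u u' hu hu'.
  move=> /(pcan_inj (@choice.pickleK _)) [e1 e2].
  have [A1 ->] := hd u hu; have [A2 ->] := hd u' hu'.
  by rewrite (finj _ _ A1 A2 e1) e2.
have [h [hA hinj]] := card_le_times_nat Ainf.
have [t0 _] := infinite_setN0 Ainf.
have dec u : exists p : T * nat, (exists2 x, A x & exists n, u = r x n) -> A p.1 /\ u = r p.1 p.2.
  have [[x Ax [n un]]|h'] := pselect (exists2 x, A x & exists n, u = r x n).
    by exists (x, n).
  by exists (t0, 0).
have [d hd] := choice dec.
apply: small_le sA; apply: (card_le_of_inj (f := fun u => h (d u).1 (d u).2)).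
  by move=> u /hd[A1 _]; exact: hA.
move=> u u' hu hu'; have [A1 e1] := hd u hu; have [A2 e2] := hd u' hu'.
by move=> /(hinj _ _ _ _ A1 A2)[e3 e4]; rewrite e1 e2 e3 e4.
Qed.

End Cardinals.

(** * Definability over parameters *)

Section Types.
Context {S : Type} {L : signature S} (N : structure L) (s0 : S).
Implicit Types (A B : set (elt N)) (phi : pformula N) (a b : N s0).

Definition dfc A : ((nat -> N s0) -> Prop) -> Prop :=
  @fclass _ _ (expanded N) s0 (over A).

Lemma ok_over A : ok_closed (over (M := N) A).
Proof. by split=> // s t u [z [z' [-> ->]]]. Qed.

Lemma dfc_defclass A : defclass (dfc A).
Proof. exact: (@fclass_defclass _ _ (expanded N) s0 _ (@ok_over A)). Qed.

Lemma over_sub A B phi : A `<=` B -> over A phi -> over B phi.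
Proof.
move=> AB.
have ht s (t : term (with_pars N) s) : term_over A t -> term_over B t.
  by elim: t => //= f ts IH [Af h]; split=> [|i]; [case: f Af {ts IH h} => // c /AB|exact: IH].
elim: phi => //= [s t u [/ht ? /ht ?]//|r ts h i|phi IH psi IH' [/IH ? /IH' ?]//].
exact: ht.
Qed.

Lemma dfc_sub A B X : A `<=` B -> dfc A X -> dfc B X.
Proof. by move=> AB [phi [o h]]; exists phi; split=> //; exact: over_sub o. Qed.

Lemma dfc_param A a : A (to_elt a) -> dterm (D := dfc A) (fun=> a).
Proof.
move=> Aa.
exists (Equal (Var (with_pars N) (s0, 0)) (@App _ (with_pars N) (inr (to_elt a)) (fun i => match notF (ltn_ord i) with end))).
split; first by split=> //=; split=> // -[].
by move=> w.
Qed.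

Lemma definable_dfc A n (X : set ('I_n -> N s0)) :
  definable A X <-> dfc A (fun v => X (fun i : 'I_n => v i)).
Proof.
split=> [[phi [o iv ->]]|h].
  exists phi; split=> // w; exact: (@holdsE _ _ (expanded N)).
have [|phi [o iv hphi]] := @fclass_in_vars _ _ (expanded N) s0 _ _ n (@ok_over A) h.
  move=> v w vw; rewrite (_ : (fun i : 'I_n => v i) = (fun i : 'I_n => w i))//.
  by apply: funext => i; exact: vw.
exists phi; split=> //; apply/seteqP; split=> a.
  move=> Xa v va; apply/hphi; rewrite (_ : (fun i : 'I_n => _) = a)//.
  by apply: funext => i; exact: va.
have [x0] := carrier_inhabited N s0.
move=> /(_ (@mkasg _ _ (expanded N) s0 (fun i => odflt x0 (omap a (insub i))))).
rewrite -hphi => h'.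
suff -> : a = (fun i : 'I_n => @mkasg _ _ (expanded N) s0 (fun i => odflt x0 (omap a (insub i))) (s0, val i)).
  apply: h' => i; by rewrite mkasgE /= valK.
by apply: funext => i; rewrite mkasgE /= valK.
Qed.

Lemma unary_dfc A (X : set (N s0)) : definable A (unary X) <-> dfc A (fun v => X (v 0)).
Proof. exact: definable_dfc. Qed.

Lemma binary_dfc A (R : N s0 -> N s0 -> Prop) :
  definable A (binary R) <-> dfc A (fun v => R (v 0) (v 1)).
Proof. exact: definable_dfc. Qed.

Lemma pholds1_dfc A phi : over A phi -> in_vars s0 1 phi ->
  dfc A (fun v => pholds1 phi (v 0)).
Proof. by move=> o iv; exists phi; split=> // w; apply: (@holdsE _ _ (expanded N)) => // -[[|//] i1]. Qed.

Lemma dfc_pholds1 A (X : set (N s0)) : dfc A (fun v => X (v 0)) ->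
  exists phi, [/\ over A phi, in_vars s0 1 phi & forall a, X a <-> pholds1 phi a].
Proof.
move=> /unary_dfc[phi [o iv e]]; exists phi; split=> // a.
rewrite -[X a]/(unary X (fun=> a)) e; exact: iff_refl.
Qed.

Lemma pholds1_Not phi a : in_vars s0 1 phi -> pholds1 (Not phi) a <-> ~ pholds1 phi a.
Proof.
move=> iv.
have iv' : in_vars s0 1 (Not phi) by move=> z /= [/iv|].
pose w := @mkasg _ _ (expanded N) s0 (fun=> a).
have wa : forall i : 'I_1, w (s0, val i) = a by move=> i; rewrite /w mkasgE.
by rewrite /pholds1 /pholds (holdsE iv' wa) (holdsE iv wa).
Qed.

Definition tp A a : set (pformula N) :=
  [set phi | [/\ over A phi, in_vars s0 1 phi & pholds1 phi a]].

Lemma tp_complete A a : complete_type A s0 (tp A a).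
Proof.
split.
- by move=> phi [].
- by move=> X _ Xtp; exists a => phi /Xtp[].
- move=> phi o iv; have [h|h] := pselect (pholds1 phi a); [left|right]; split=> //.
    by move=> z /= [/iv|].
  exact/pholds1_Not.
Qed.

Lemma realizations_tp A a b :
  realizations (tp A a) b <-> forall X : set (N s0), dfc A (fun v => X (v 0)) -> X a -> X b.
Proof.
split=> [h X /dfc_pholds1[phi [o iv e]] /e Xa|h phi [o iv ha]].
  by apply/e; exact: h.
by apply: (h (pholds1 phi)) => //; exact: pholds1_dfc.
Qed.

Lemma complete_tp A p a : complete_type A s0 p -> realizations p a -> p = tp A a.
Proof.
move=> [po _ pc] pa; apply/seteqP; split=> phi.
  by move=> pphi; have [o iv] := po _ pphi; split=> //; exact: pa.
move=> [o iv ha]; have [//|] := pc _ o iv.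
by move=> /pa /(pholds1_Not _ iv).
Qed.

Lemma realizes_tp A a : realizations (tp A a) a.
Proof. by apply/realizations_tp. Qed.

Lemma rel_definable_dfc (P : set (N s0)) A n (X : set ('I_n -> N s0)) :
  rel_definable P A X <->
  exists Y : set ('I_n -> N s0), dfc A (fun v => Y (fun i : 'I_n => v i)) /\ X = Y `&` [set a | forall i, P (a i)].
Proof.
split=> -[Y [DY e]]; exists Y; split=> //.
  by apply/definable_dfc.
by apply/definable_dfc.
Qed.

Lemma rel_unary_dfc (P : set (N s0)) A (X : set (N s0)) :
  rel_definable P A (unary X) <->
  exists Y : set (N s0), dfc A (fun v => Y (v 0)) /\ X = Y `&` P.
Proof.
rewrite rel_definable_dfc; split=> -[Y [DY e]].
  exists [set a | Y (fun=> a)]; split.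
    apply: d_ext DY => v /=.
    suff -> : (fun i : 'I_1 => v i) = (fun=> v 0) by []; by apply: funext => i; rewrite ord1.
  apply/seteqP; split=> a.
    move=> Xa; have : unary X (fun=> a) by [].
    by rewrite e => -[? /(_ ord0)].
  move=> [Ya Pa]; have : (Y `&` [set a | forall i, P (a i)]) (fun=> a) by split.
  by rewrite -e.
exists (unary Y); split=> //; apply/seteqP; split=> a /=; rewrite /unary e.
  by move=> [Ya Pa]; split=> // i; rewrite ord1.
by move=> [Ya /(_ ord0)].
Qed.

Lemma rel_binary_dfc (P : set (N s0)) A (R : N s0 -> N s0 -> Prop) :
  rel_definable P A (binary R) <->
  exists Y : N s0 -> N s0 -> Prop, dfc A (fun v => Y (v 0) (v 1)) /\
    forall a b, R a b <-> [/\ Y a b, P a & P b].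
Proof.
rewrite rel_definable_dfc; split=> -[Y [DY e]].
  pose pr a b : 'I_2 -> N s0 := fun i => if i is Ordinal 0 _ then a else b.
  exists (fun a b => Y (pr a b)); split.
    apply: d_ext DY => v.
    suff -> : (fun i : 'I_2 => v i) = pr (v 0) (v 1) by []; by apply: funext => -[[|[|]]].
  move=> a b; rewrite -[R a b]/(binary R (pr a b)) e; split.
    by move=> [? h]; split=> //; [exact: (h ord0)|exact: (h ord_max)].
  by move=> [? ? ?]; split=> // -[[|]].
exists (binary Y); split=> //; apply/seteqP; split=> a /=; rewrite /binary /= e.
  by move=> [Ya P0 P1]; split=> // -[[|[|//]] i2]; [move: P0|move: P1]; congr (P (a _)); exact: val_inj.
by move=> [Ya h].
Qed.

End Types.

(** * Relations with constants *)

Section Constants.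
Context {U : Type} (D : ((nat -> U) -> Prop) -> Prop).
Implicit Types (v : nat -> U) (B : set U) (X : (nat -> U) -> Prop).

Definition ev v (x : nat + U) : U := match x with inl i => v i | inr a => a end.

(** Constants are kept apart from the relation, as values of [s]: they can be moved by an
    automorphism, abstracted one at a time, or cut down to finitely many. [D] will be the class of
    0-definable relations, or that of relations definable in C^eq over A. *)
Definition pclass B X := exists (Y : (nat -> U) -> Prop) (s : nat -> nat + U),
  [/\ D Y, forall i a, s i = inr a -> B a & forall v, X v <-> Y (fun i => ev v (s i))].

Lemma pclass_sub B B' X : B `<=` B' -> pclass B X -> pclass B' X.
Proof. by move=> BB' [Y [s [DY sB h]]]; exists Y, s; split=> // i a /sB /BB'. Qed.

Lemma pclass_base B X : D X -> pclass B X.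
Proof. by move=> DX; exists X, inl; split. Qed.

Hypothesis HD : defclass D.

Lemma pclass_defclass B : defclass (pclass B).
Proof.
have H0 := HD.
split.
- by exists (fun=> False), inl; split=> //; exact: (dc_bot H0).
- move=> X X' [Y [s [DY sB h]]] [Y' [s' [DY' sB' h']]].
  pose s2 i := if odd i then s' i./2 else s i./2.
  exists (fun v => Y (fun i => v i.*2) -> Y' (fun i => v i.*2.+1)), s2; split.
  + by apply: (dc_imp H0); [exact: (d_reindex H0 double DY)|exact: (d_reindex H0 (fun i => i.*2.+1) DY')].
  + by move=> i a; rewrite /s2; case: odd => [/sB'|/sB].
  + move=> v.
    have e1 : (fun i => ev v (s2 i.*2)) = (fun i => ev v (s i)).
      by apply: funext => i; rewrite /s2 odd_double doubleK.
    have e2 : (fun i => ev v (s2 i.*2.+1)) = (fun i => ev v (s' i)).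
      by apply: funext => i; rewrite /s2 /= odd_double /= uphalf_double.
    by rewrite e1 e2; have := h v; have := h' v; tauto.
- move=> n X [Y [s [DY sB h]]].
  pose isn i := if s i is inl m then m == n else false.
  exists (fun v => forall u, Y (fun i => if isn i then u else v i)), s; split=> //.
    apply: (d_all H0 (G := fun u v => Y (fun i => if isn i then u else v i))).
    apply: d_ext (d_reindex H0 (fun i => if isn i then 0 else i.+1) DY) => v.
    suff -> : (fun i => v (if isn i then 0 else i.+1)) = (fun i => if isn i then v 0 else shift 1 v i) by [].
    by apply: funext => i; case: isn.
  move=> v.
  have e u : (fun i => ev (upn v n u) (s i)) = (fun i => if isn i then u else ev v (s i)).
    apply: funext => i; rewrite /isn; case: (s i) => [m|a] //=; by rewrite /upn; case: eqP.
  by split=> hh u; have := hh u; have := h (upn v n u); rewrite e; tauto.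
- by move=> i j; apply: pclass_base; exact: (dc_eq H0).
- move=> X [Y [s [DY sB h]]]; have [n hn] := dc_supp H0 DY.
  pose K := \max_(i < n) if s i is inl m then m.+1 else 0.
  exists K => v w vw /h hv; apply/h; apply: hn hv => i ni.
  case si : (s i) => [m|a] //=; apply: vw.
  have := @leq_bigmax 'I_n (fun i => if s i is inl m then m.+1 else 0) (Ordinal ni).
  by rewrite /= si.
Qed.

Lemma pclass_param B a : B a -> dterm (D := pclass B) (fun=> a).
Proof.
move=> Ba; exists (fun v => v 0 = v 1), (fun i => if i is 0 then inl 0 else inr a).
split=> //; first exact: (dc_eq (HD)).
by move=> [|i] b // [<-].
Qed.

Lemma pclass_finite B X : pclass B X ->
  exists l : seq {classic U}, (forall b : {classic U}, b \in l -> B b) /\ pclass [set b | (b : {classic U}) \in l] X.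
Proof.
have H0 := HD.
move=> [Y [s [DY sB h]]]; have [n hn] := dc_supp H0 DY.
pose l : seq {classic U} := pmap (fun i => if s i is inr a then Some (a : {classic U}) else None) (iota 0 n).
exists l; split=> [b|].
  by rewrite mem_pmap => /mapP[i _]; case si: (s i) => [//|a] [->]; exact: sB si.
(* Places beyond the support are reset to a variable, so that they contribute no constant. *)
exists Y, (fun i => if (i < n)%N then s i else inl 0); split=> //.
  move=> i a; case: ifP => // ni si; rewrite /= mem_pmap; apply/mapP; exists i; last by rewrite si.
  by rewrite mem_iota.
by move=> v; rewrite h; apply: supp_le (hn) _ _ _ => i ->.
Qed.

Lemma pclass_decompose B a X : pclass (B `|` [set a]) X ->
  exists Y : U -> (nat -> U) -> Prop, pclass B (fun v => Y (v 0) (shift 1 v)) /\ forall v, X v <-> Y a v.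
Proof.
have H0 := HD.
move=> [Z [s [DZ sB h]]].
pose isa i := if s i is inr b then pselect (b = a) : bool else false.
exists (fun u v => Z (fun i => if isa i then u else ev v (s i))); split; last first.
  move=> v; rewrite h.
  suff -> : (fun i => ev v (s i)) = (fun i => if isa i then a else ev v (s i)) by [].
  by apply: funext => i; rewrite /isa; case: (s i) => //= b; case: pselect.
pose s' i : nat + U := if isa i then inl 0 else match s i with inl m => inl m.+1 | inr b => inr b end.
exists Z, s'; split=> //.
  move=> i b; rewrite /s' /isa; case si: (s i) => [m|c] //.
  by case: pselect => //= nca [<-]; have [//|] := sB i c si.
move=> v; suff -> : (fun i => if isa i then v 0 else ev (shift 1 v) (s i)) = (fun i => ev v (s' i)) by [].
by apply: funext => i; rewrite /s'; case: ifP => //; case: (s i).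
Qed.

End Constants.

Section Real_definability.
Context {L : signature unit} (M : structure L).
Local Notation U := (M tt).
Local Notation Meq := (eq_structure M).
Implicit Types (v : nat -> U) (B : set U) (X : (nat -> U) -> Prop).

Definition els B : set (elt M) := [set c | exists2 u, B u & c = to_elt u].

Lemma els_ex (A : set (elt M)) : exists B, A = els B.
Proof.
exists [set u | A (to_elt u)]; apply/seteqP; split=> [[[] u] Au|c [u Au ->//]].
by exists u.
Qed.

Lemma els_sub B B' : B `<=` B' -> els B `<=` els B'.
Proof. by move=> BB' c [u Bu ->]; exists u => //; exact: BB'. Qed.

Lemma elsU B B' : els (B `|` B') = els B `|` els B'.
Proof.
apply/seteqP; split=> c; first by move=> [u [] Bu ->]; [left|right]; exists u.
by move=> [|] [u Bu ->]; exists u => //; [left|right].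
Qed.

Lemma els1 (a : U) : els [set a] = [set to_elt a].
Proof. by apply/seteqP; split=> c; [move=> [u -> ->]|move=> ->; exists a]. Qed.

Definition dfn B : ((nat -> U) -> Prop) -> Prop := pclass (@dfn0 _ M) B.

Lemma dfn_sub B B' X : B `<=` B' -> dfn B X -> dfn B' X.
Proof. exact: pclass_sub. Qed.

Lemma dfn0_dfn B X : @dfn0 _ M X -> dfn B X.
Proof. exact: pclass_base. Qed.

Lemma dfn_defclass B : defclass (dfn B).
Proof. exact: (pclass_defclass (@dfn0_defclass _ M)). Qed.

Lemma dfn_param B a : B a -> dterm (D := dfn B) (fun=> a).
Proof. exact: (pclass_param (@dfn0_defclass _ M)). Qed.

Lemma dfn_finite B X : dfn B X ->
  exists l : seq {classic U}, (forall b : {classic U}, b \in l -> B b) /\ dfn [set b | (b : {classic U}) \in l] X.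
Proof. exact: (pclass_finite (@dfn0_defclass _ M)). Qed.

Lemma dfn_decompose B a X : dfn (B `|` [set a]) X ->
  exists Y : U -> (nat -> U) -> Prop, dfn B (fun v => Y (v 0) (shift 1 v)) /\ forall v, X v <-> Y a v.
Proof. exact: (pclass_decompose (@dfn0_defclass _ M)). Qed.

Lemma dfn_dfc B X : dfn B X -> dfc (els B) X.
Proof.
move=> [Y [s [DY sB h]]].
apply: (d_ext (X := fun v => Y (fun i => ev v (s i)))); first by move=> v; rewrite h.
have HD := @dfc_defclass _ _ M tt (els B).
apply: (d_subst HD (t := fun i v => ev v (s i))); first exact: dfn0_fclass.
move=> i; case si : (s i) => [m|a]; first exact: dterm_var.
by apply: dfc_param; exists a => //; exact: sB si.
Qed.

Lemma eq_dfn (A : set (elt Meq)) B X :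
  (forall c, A c -> forall g : nat -> nat, dfn B (fun v => projT2 c = abs (projT1 c) (fun i => v (g i)))) ->
  @dfc _ _ Meq (Real M tt) A X -> dfn B X.
Proof. move=> h DX; apply: (d_eqclass (dfn_defclass B) _ h DX); exact: dfn0_dfn. Qed.

Lemma dfc_dfn B X : dfc (els B) X -> dfn B X.
Proof.
move=> /fclass_emb; apply: eq_dfn => c [_ [u Bu ->] <-] g /=.
apply: (d_eq (dfn_defclass B) (t := fun=> u) (u := fun v => v (g 0))); first exact: dfn_param.
exact: dterm_var (dfn_defclass B) (g 0).
Qed.

Lemma dfn_eq (A : set (elt Meq)) B X :
  (forall b, B b -> A (@to_elt _ _ Meq (Real M tt) b)) ->
  dfn B X -> @dfc _ _ Meq (Real M tt) A X.
Proof.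
move=> BA /dfn_dfc /fclass_emb; apply: dfc_sub => _ [_ [u Bu ->] <-].
exact: BA.
Qed.

Lemma rel_unary_dfn (P : set U) B (X : set U) :
  rel_definable P (els B) (unary X) <->
  exists Y : set U, dfn B (fun v => Y (v 0)) /\ X = Y `&` P.
Proof.
by rewrite rel_unary_dfc; split=> -[Y [/= DY e]]; exists Y; split=> //; [exact: dfc_dfn|exact: dfn_dfc].
Qed.

Lemma rel_binary_dfn (P : set U) B (R : U -> U -> Prop) :
  rel_definable P (els B) (binary R) <->
  exists Y : U -> U -> Prop, dfn B (fun v => Y (v 0) (v 1)) /\
    forall a b, R a b <-> [/\ Y a b, P a & P b].
Proof.
by rewrite rel_binary_dfc; split=> -[Y [/= DY e]]; exists Y; split=> //; [exact: dfc_dfn|exact: dfn_dfc].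
Qed.

End Real_definability.

(** * Automorphisms of the monster model *)

Section Automorphisms.
Context {L : signature unit} {M : structure L}.
Local Notation U := (M tt).
Implicit Types (B : set U) (f g : U -> U) (X : (nat -> U) -> Prop).

(* Only the real sort and the 0-definable relations on it matter, so [f] need
   not be presented as an automorphism in the sense of [Defs]. *)
Definition aut B f := [/\ bijective f,
  forall X, @dfn0 _ M X -> forall v, X v <-> X (fun i => f (v i))
  & forall b, B b -> f b = b].

Lemma aut_id B : aut B id.
Proof. by split=> //; exists id. Qed.

Lemma aut_comp B f g : aut B f -> aut B g -> aut B (f \o g).
Proof.
move=> [bf hf Bf] [bg hg Bg]; split.
- exact: bij_comp.
- by move=> X DX v; rewrite (hg X DX) (hf X DX).
- by move=> b Bb /=; rewrite Bg// Bf.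
Qed.

Lemma aut_inv B f : aut B f -> exists g, [/\ aut B g, cancel f g & cancel g f].
Proof.
move=> [[g fg gf] hf Bf]; exists g; split=> //; split.
- by exists f.
- move=> X DX v; rewrite (hf X DX (fun i => g (v i))).
  by rewrite (_ : (fun i => f (g (v i))) = v)//; apply: funext => i; rewrite gf.
- by move=> b Bb; rewrite -{1}(Bf b Bb) fg.
Qed.

Lemma aut_sub B B' f : B' `<=` B -> aut B f -> aut B' f.
Proof. by move=> BB' [bf hf Bf]; split=> // b /BB' /Bf. Qed.

Lemma aut_setU1 B a f : aut B f -> f a = a -> aut (B `|` [set a]) f.
Proof. by move=> [bf hf Bf] fa; split=> // b [/Bf|->]. Qed.

Lemma aut_inj B f : aut B f -> injective f.
Proof. by move=> [/bij_inj]. Qed.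

Lemma aut_fix B f b : aut B f -> B b -> f b = b.
Proof. by move=> [_ _]; apply. Qed.

Lemma aut_dfn B f X : aut B f -> dfn B X -> forall v, X v <-> X (fun i => f (v i)).
Proof.
move=> [bf hf Bf] [Y [s [DY sB h]]] v.
have -> : X (fun i => f (v i)) <-> Y (fun i => f (ev v (s i))).
  rewrite h (_ : (fun i => ev (fun i => f (v i)) (s i)) = (fun i => f (ev v (s i))))//.
  by apply: funext => i; case si : (s i) => [m|a] //=; rewrite Bf//; exact: sB si.
by rewrite h; exact: hf.
Qed.

Lemma aut_dfn1 B f (R : U -> Prop) a : aut B f -> dfn B (fun v => R (v 0)) ->
  (R a <-> R (f a)).
Proof. by move=> af DR; exact: (aut_dfn af DR (fun=> a)). Qed.

Lemma aut_dfn2 B f (R : U -> U -> Prop) a b : aut B f -> dfn B (fun v => R (v 0) (v 1)) ->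
  (R a b <-> R (f a) (f b)).
Proof. by move=> af DR; exact: (aut_dfn af DR (fun i => if i is 0 then a else b)). Qed.

Lemma aut_dfn3 B f (R : U -> U -> U -> Prop) a b c : aut B f ->
  dfn B (fun v => R (v 0) (v 1) (v 2)) -> (R a b c <-> R (f a) (f b) (f c)).
Proof.
by move=> af DR; exact: (aut_dfn af DR (fun i => if i is 0 then a else if i is 1 then b else c)).
Qed.

Definition eqv B a b := exists f, aut B f /\ f a = b.

Lemma eqv_refl B a : eqv B a a.
Proof. by exists id; split=> //; exact: aut_id. Qed.

Lemma eqv_sym B a b : eqv B a b -> eqv B b a.
Proof. by move=> [f [/aut_inv[g [ag fg _]] <-]]; exists g. Qed.

Lemma eqv_trans B a b c : eqv B a b -> eqv B b c -> eqv B a c.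
Proof.
move=> [f [af <-]] [g [ag <-]]; exists (g \o f); split=> //; exact: aut_comp.
Qed.

Lemma eqv_sub B B' a b : B' `<=` B -> eqv B a b -> eqv B' a b.
Proof. by move=> BB' [f [af fa]]; exists f; split=> //; exact: aut_sub af. Qed.

(** Conjugation by [f]: if [g] fixes B pointwise, then f g f^-1 fixes the image of B. *)
Lemma eqv_image B B' A f a b : aut A f ->
  (forall x, B' x -> exists2 y, B y & f y = x) ->
  eqv B a b -> eqv B' (f a) (f b).
Proof.
move=> af hB [g [ag <-]]; have [h [ah fh hf]] := aut_inv af.
have A0 C : C `<=` [set: U] by [].
have toset0 (C : set U) k : aut C k -> aut set0 k by apply: aut_sub => x.
have [bk hk _] : aut set0 (f \o (g \o h)).
  by apply: aut_comp; [exact: toset0 af|apply: aut_comp; [exact: toset0 ag|exact: toset0 ah]].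
exists (f \o (g \o h)); split; last by rewrite /= fh.
split=> // x /hB[y By <-] /=; by rewrite fh (aut_fix ag By).
Qed.

Lemma eqv_dfn B a b (R : U -> Prop) : eqv B a b -> dfn B (fun v => R (v 0)) -> (R a <-> R b).
Proof. by move=> [f [af <-]] DR; exact: (@aut_dfn1 B f R a af DR). Qed.

End Automorphisms.

Lemma automorphism_sat (S : Type) (L : signature S) (M : structure L)
    (g : forall s, M s -> M s) : automorphism g ->
  forall (phi : formula L) (v : assignment M),
    sat v phi <-> sat (fun z => g z.1 (v z)) phi.
Proof.
move=> [bg gf gr].
have he s (t : term L s) (v : assignment M) : eval (fun z => g z.1 (v z)) t = g s (eval v t).
  elim: t => [z|f ts IH] //=; rewrite gf; congr fn_int.
  by apply: functional_extensionality_dep => i; exact: IH.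
elim=> [|s t u|r ts|phi IH psi IH'|z phi IH] v //.
- rewrite /= !he; split=> [->//|]; by move/(bij_inj (bg s)).
- rewrite /= gr.
  suff -> : (fun i => g _ (eval v (ts i))) = (fun i => eval (fun z => g z.1 (v z)) (ts i)) by [].
  by apply: functional_extensionality_dep => i; rewrite he.
- by move: (IH v) (IH' v) => /=; tauto.
- have e x : (fun z' => g z'.1 (upd v z x z')) = upd (fun z => g z.1 (v z)) z (g z.1 x).
    apply: functional_extensionality_dep => z'.
    have [->|ne] := pselect (z' = z); first by rewrite !upd_eq.
    by rewrite !upd_neq.
  split=> /sat_All h; apply/sat_All => x.
    have [k _ gk] := bg z.1; by rewrite -(gk x) -e -IH.
  by apply/IH; rewrite e.
Qed.

Lemma to_elt_inj (L : signature unit) (M : structure L) (a b : M tt) :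
  to_elt a = to_elt b :> elt M -> a = b.
Proof.
pose r (c : elt M) : M tt := match c with existT s x =>
  match s return M s -> M tt with tt => id end x end.
by move=> /(congr1 r).
Qed.

(** * Conjugacy and saturation over real parameters *)

Section Monster.
Context {L : signature unit} {M : structure L} {kappa : Type}.
Hypothesis mon : monster kappa M.
Local Notation U := (M tt).
Implicit Types (B : set U).

Definition smallU B := small kappa (els B).

Let small_L : small kappa [set: formula L]. Proof. by case: mon. Qed.

Lemma smallU_setU1 B a : smallU B -> smallU (B `|` [set a]).
Proof. by rewrite /smallU elsU els1; exact: small_setU1 small_L tt _ _ _. Qed.

Lemma smallU_countable B : countable B -> smallU B.
Proof.
move=> cB; apply: (small_countable small_L tt); rewrite /els.
have -> : [set c | exists2 u, B u & c = to_elt u] = (@to_elt _ _ M tt) @` B.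
  by apply/seteqP; split=> c [u Bu e]; exists u.
exact: card_le_trans (card_image_le _ _) cB.
Qed.

Lemma smallU_seq (l : seq {classic U}) : smallU [set b | (b : {classic U}) \in l].
Proof. by apply: smallU_countable; apply: finite_set_countable; exact: ((@finite_seqP {classic U} [set b | b \in l]).2 (ex_intro _ l erefl)). Qed.

(** The map that sends [a] to [b] and fixes B is elementary: in a formula the variables with value
    [a] are merged into one, the others become constants of B. If [a] lies in B, equality of types
    forces b = a. *)
Lemma homogeneous B a b : smallU B ->
  (forall R : U -> Prop, dfn B (fun v => R (v 0)) -> (R a <-> R b)) -> eqv B a b.
Proof.
move=> sB h; case: mon => _ _ hom.
pose f (s : unit) : M s -> M s := match s with
  | tt => fun u => if pselect (u = a) then b else u end.
have [|g [ag gf]] := hom (els (B `|` [set a])) f (smallU_setU1 sB).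
  move=> phi v w hvw.
  (* A variable that is not free receives the value [a], so that it is merged as well and asks for
     no constant. *)
  pose val i := if pselect (free (tt, i) phi) then v (tt, i) else a.
  pose s i : nat + U := if pselect (val i = a) then inl 0 else inr (val i).
  pose Y (x : nat -> U) := sat (@mkasg _ _ M tt x) phi.
  have DY : @dfn0 _ M Y.
    exists phi; split=> // w'; apply: sat_ext => -[[] i] _.
    by rewrite mkasgE.
  have DX : dfn B (fun x => Y (fun i => ev (fun=> x 0) (s i))).
    apply: (d_reindex (dfn_defclass B) (fun=> 0) (X := fun x => Y (fun i => ev x (s i)))).
    exists Y, s; split=> // i c; rewrite /s; case: pselect => // ne [<-].
    move: ne; rewrite /val; case: pselect => // fi ne.
    by have [[u [Bu|ua] /to_elt_inj e] _] := hvw _ fi; rewrite e// in ne *.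
  have valE (w' : assignment M) (x : U) :
      (forall i, free (tt, i) phi -> w' (tt, i) = (if pselect (v (tt, i) = a) then x else v (tt, i))) ->
      Y (fun i => ev (fun=> x) (s i)) <-> sat w' phi.
    move=> hw'; apply: sat_ext => -[[] i] fi; rewrite mkasgE hw'// /s /val.
    by case: (pselect (free _ _)) => // fi'; case: pselect.
  rewrite -(valE v a); last by move=> i _; case: pselect.
  rewrite -(valE w b); last by move=> i /hvw[_ ->] /=; case: pselect.
  exact: (h (fun x => Y (fun i => ev (fun=> x) (s i)))).
have ags := automorphism_sat ag.
exists (g tt); split; last by rewrite gf /=; [case: pselect|exists a => //; right].
split; first by case: ag.
- move=> X [phi [_ hphi]] v.
  have := ags phi (@mkasg _ _ M tt v); rewrite -!hphi.
  have -> : (fun n => @mkasg _ _ M tt v (tt, n) : U) = v by apply: funext => n; rewrite mkasgE.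
  suff -> : (fun n => g tt (@mkasg _ _ M tt v (tt, n))) = (fun i => g tt (v i)) by [].
  by apply: funext => n; rewrite mkasgE.
- move=> c Bc; rewrite gf; last by exists c => //; left.
  rewrite /=; case: pselect => // ca; subst c.
  exact: (h (fun x => x = a) (dfn_param Bc)).1.
Qed.

(** [saturated] speaks of complete types only; the directed family is enlarged to an ultrafilter,
    whose formulas over B form such a type. *)
Lemma saturation B (F : (U -> Prop) -> Prop) : smallU B ->
  (exists R, F R) ->
  (forall R, F R -> dfn B (fun v => R (v 0))) ->
  (forall R, F R -> exists a, R a) ->
  (forall R R', F R -> F R' -> exists2 Q, F Q & forall a, Q a -> R a /\ R' a) ->
  exists a, forall R, F R -> R a.
Proof.
move=> sB F0 FB Fne Fdir; case: mon => _ sat_M _.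
have PF : ProperFilter (filter_from F id).
  apply: filter_from_proper; last by move=> R /Fne.
  by apply: filter_from_filter => // R R' FR /(Fdir _ _ FR)[Q FQ QR]; exists Q.
have [G [uG FG]] := ultraFilterLemma PF.
pose p : set (pformula M) := [set phi | [/\ over (els B) phi, in_vars tt 1 phi & G (pholds1 phi)]].
have pc : complete_type (els B) tt p.
  split=> [phi [//]|X Xfin Xp|phi o iv].
  - suff : G [set a | forall phi, X phi -> pholds1 phi a].
      by move=> /filter_ex.
    have [l Xl] := (@finite_seqP {classic pformula M} X).1 Xfin.
    move: Xp; rewrite Xl; elim: l {Xl Xfin X} => [|phi l IH] Xp.
      by apply: filterS filterT => a _ phi.
    have Gphi : G (pholds1 phi) by have [] := Xp phi (mem_head _ _).
    have {}IH := IH (fun psi lpsi => Xp psi (mem_behead (s := phi :: l) lpsi)).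
    apply: filterS (filterI Gphi IH) => a [h1 h2] psi /=.
    by rewrite inE => /orP[/eqP ->//|/h2].
  - have [h|h] := @in_ultra_setVsetC _ G (pholds1 phi) uG; [left|right]; split=> //.
      by move=> z /= [/iv|].
    by apply: filterS h => a ha; apply/pholds1_Not.
have [a pa] := sat_M _ _ _ sB pc.
exists a => R FR.
have [phi [o iv e]] := dfc_pholds1 (dfn_dfc (FB R FR)).
apply/e; apply: pa; split=> //; apply: (filterS (P := R)) => [b /e//|].
by apply: FG; exists R.
Qed.

(** The sets [F S] express a condition on x that refers to the whole type of [a] over B, one
    instance for each formula S of that type; monotonicity makes the instances directed. *)
Lemma type_saturation B C a (F : (U -> Prop) -> U -> Prop) : smallU C ->
  (forall S, dfn B (fun v => S (v 0)) -> dfn C (fun v => F S (v 0))) ->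
  (forall S S', (forall x, S x -> S' x) -> forall x, F S x -> F S' x) ->
  (forall S, dfn B (fun v => S (v 0)) -> S a -> exists x, F S x) ->
  exists x, forall S, dfn B (fun v => S (v 0)) -> S a -> F S x.
Proof.
move=> sC FC Fmono Fne.
have [||||x hx] := @saturation C (fun R => exists S, [/\ dfn B (fun v => S (v 0)), S a & R = F S]) sC.
- by exists (F (fun=> True)), (fun=> True); split=> //; exact: (d_True (dfn_defclass B)).
- by move=> R [S [DS Sa ->]]; exact: FC.
- by move=> R [S [DS Sa ->]]; exact: Fne.
- move=> R R' [S [DS Sa ->]] [S' [DS' Sa' ->]].
  exists (F (fun x => S x /\ S' x)).
    by exists (fun x => S x /\ S' x); split=> //; exact: (d_and (dfn_defclass B)).
  by move=> x hx; split; apply: Fmono hx => y [].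
by exists x => S DS Sa; apply: hx; exists S.
Qed.

Lemma type_orbit B a b : smallU B ->
  (forall R : U -> Prop, dfn B (fun v => R (v 0)) -> R a -> R b) -> eqv B a b.
Proof.
move=> sB h; apply: homogeneous => // R DR; split; first exact: h.
by move=> Rb; apply: contrapT => nRa; exact: (h (fun x => ~ R x) (d_not (dfn_defclass B) DR)).
Qed.

Lemma realizations_eqv B a b : smallU B ->
  realizations (tp (els B) a) b <-> eqv B a b.
Proof.
move=> sB; rewrite realizations_tp; split=> [h|e X DX Xa].
  by apply: type_orbit => // R /dfn_dfc; exact: h.
by rewrite -(eqv_dfn (R := X) e)//; exact: dfc_dfn.
Qed.

End Monster.

(** * Cuts and components *)

Notation "B +: a" := (B `|` [set a]) (at level 50, left associativity).

Ltac dmem := solve [ done | by left | by right | by left; left | by left; right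
  | by left; left; left | by left; left; right ].
Ltac dtermt := first [ exact: (dterm_var (dfn_defclass _)) | (apply: dfn_param; dmem) ].
(** Definability by following the syntax: relations known from hypotheses are tried first, and a
    body without variables last, as a mere truth value. *)
Ltac dstep := match goal with
  | H : dfn ?B (fun v => ?R (v 0) (v 1) (v 2)) |- dfn ?B (fun v => ?R _ _ _) =>
      apply: (d3 (dfn_defclass B) (R := R) H); dtermt
  | H : dfn ?B (fun v => ?R (v 0) (v 1)) |- dfn ?B (fun v => ?R _ _) =>
      apply: (d2 (dfn_defclass B) (R := R) H); dtermt
  | H : dfn ?B (fun v => ?R (v 0)) |- dfn ?B (fun v => ?R _) =>
      apply: (d1 (dfn_defclass B) (R := R) H); dtermt
  | |- dfn ?B (fun v => _ = _) => apply: (d_eq (dfn_defclass B)); dtermt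
  | |- dfn ?B (fun v => _ /\ _) => apply: (d_and (dfn_defclass B))
  | |- dfn ?B (fun v => _ \/ _) => apply: (d_or (dfn_defclass B))
  | |- dfn ?B (fun v => ~ _) => apply: (d_not (dfn_defclass B))
  | |- dfn ?B (fun v => _ <-> _) => apply: (d_iff (dfn_defclass B))
  | |- dfn ?B (fun v => exists u, _) => apply: (d_ex (dfn_defclass B)) => /=
  | |- dfn ?B (fun v => _ -> _) => apply: (dc_imp (dfn_defclass B))
  | |- dfn ?B (fun v => forall u, _) => apply: (d_all (dfn_defclass B)) => /=
  | |- dfn ?B (fun v => ?P) => exact: (d_const (dfn_defclass B) P)
  end.
Ltac ddfn := repeat (rewrite /shift /=; dstep).

Section Core.
Context {L : signature unit} {M : structure L} {kappa : Type}.
Hypothesis mon : monster kappa M.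
Local Notation U := (M tt).
Implicit Types (B : set U) (X R : U -> Prop) (E : U -> U -> Prop).

Local Notation small := (@smallU L M kappa).

Lemma small0 : small set0.
Proof. exact: smallU_countable mon _ (countable0 _). Qed.

Lemma small1 a : small (set0 +: a).
Proof. exact: smallU_setU1 mon _ _ small0. Qed.

Definition ER B a E := [/\ forall x, eqv B a x -> E x x,
  forall x y, eqv B a x -> eqv B a y -> E x y -> E y x
  & forall x y z, eqv B a x -> eqv B a y -> eqv B a z -> E x y -> E y z -> E x z].

Definition cvx (lt : U -> U -> Prop) X := forall x y z, X x -> X z -> lt x y -> lt y z -> X y.

(** What is used of the theory, phrased for orbits, and in a form that the reverse order satisfies
    too, so that each one-sided lemma can be used on both sides. [go_wqo] is local: on [th] the
    0-definable sets that occur in X keep the truth value they have at [x0]. *)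
Record gorder (lt : U -> U -> Prop) : Prop := Gorder {
  go_dfn : forall B, dfn B (fun v => lt (v 0) (v 1));
  go_irr : forall x, ~ lt x x;
  go_trans : forall x y z, lt x y -> lt y z -> lt x z;
  go_total : forall x y, [\/ lt x y, x = y | lt y x];
  go_wqo : forall B X (x0 : U), dfn B (fun v => X (v 0)) ->
    exists n (C : 'I_n -> U -> Prop) (th : U -> Prop),
      [/\ dfn set0 (fun v => th (v 0)), th x0, forall i, cvx lt (C i)
        & forall z, th z -> (X z <-> exists i, C i z)];
  go_simple : forall B a X, small B -> dfn (B +: a) (fun v => X (v 0)) -> X a ->
    (forall x y, eqv B a x -> eqv B a y -> X y -> lt a x -> lt x y -> X x) ->
    exists E, [/\ dfn B (fun v => E (v 0) (v 1)), ER B a E &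
      forall x, eqv B a x -> lt a x -> (X x <-> E a x)] }.

Lemma decompose1 B c X : dfn (B +: c) (fun v => X (v 0)) ->
  exists G : U -> U -> Prop, dfn B (fun v => G (v 0) (v 1)) /\ forall z, X z <-> G c z.
Proof.
move=> /dfn_decompose[Y [DY XY]]; exists (fun c z => Y c (fun=> z)); split; last first.
  by move=> z; exact: (XY (fun=> z)).
apply: d_ext (d_reindex (dfn_defclass B) (fun i => if i is 0 then 0 else 1) DY) => v.
by rewrite (_ : shift 1 _ = fun=> v 1)//.
Qed.

Lemma decompose2 B c E : dfn (B +: c) (fun v => E (v 0) (v 1)) ->
  exists G : U -> U -> U -> Prop, dfn B (fun v => G (v 0) (v 1) (v 2)) /\
    forall x y, E x y <-> G c x y.
Proof.
move=> /dfn_decompose[Y [DY XY]].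
pose pr x y : nat -> U := fun i => if i is 0 then x else y.
exists (fun c x y => Y c (pr x y)); split; last first.
  by move=> x y; exact: (XY (pr x y)).
apply: d_ext (d_reindex (dfn_defclass B) (fun i => if i is 0 then 0 else if i is 1 then 1 else 2) DY) => v.
by rewrite (_ : shift 1 _ = pr (v 1) (v 2))//; apply: funext => -[|[]].
Qed.

Lemma not_eqv B x y : small B -> ~ eqv B x y ->
  exists R, dfn B (fun v => R (v 0)) /\ ~ (R x <-> R y).
Proof.
move=> sB nxy; apply: contrapT => h; apply: nxy; apply: (homogeneous mon) => // R DR.
by apply: contrapT => nR; apply: h; exists R.
Qed.

Section Order.
Context (lt : U -> U -> Prop) (G : gorder lt).

Let le x y := x = y \/ lt x y.

Let le_lt_trans x y z : le x y -> lt y z -> lt x z.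
Proof. by move=> [->//|xy]; exact: go_trans G _ _ _ xy. Qed.

Let lt_le_trans x y z : lt x y -> le y z -> lt x z.
Proof. by move=> xy [<-//|]; exact: go_trans G _ _ _ xy. Qed.

Let le_trans x y z : le x y -> le y z -> le x z.
Proof. by move=> [->//|xy] yz; right; exact: lt_le_trans xy yz. Qed.

Lemma lt_dfn B : dfn B (fun v => lt (v 0) (v 1)).
Proof. exact: go_dfn. Qed.

Lemma aut_lt B f x y : aut B f -> (lt x y <-> lt (f x) (f y)).
Proof. by move=> af; exact: aut_dfn2 af (lt_dfn B). Qed.

Section Chains.
Context (X th : U -> Prop).

(** Counts alternations: at points of [th] up to z, membership in X changes along a sequence of
    length j that starts inside X. Unlike X, this condition is a final segment in z. *)
Fixpoint chain j (z : U) : Prop :=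
  if j is j'.+1 then exists w, [/\ th w, le w z, chain j' w & (X w <-> ~~ odd j')] else True.

Lemma chain_up j x y : lt x y -> chain j x -> chain j y.
Proof.
case: j => // j xy [w [tw wx cw Xw]]; exists w; split=> //.
by right; exact: le_lt_trans wx xy.
Qed.

Lemma chain_dfn B j : dfn B (fun v => X (v 0)) -> dfn B (fun v => th (v 0)) ->
  dfn B (fun v => chain j (v 0)).
Proof.
move=> DX Dth; have Dlt := lt_dfn B.
elim: j => [|j IH] /=; first exact: (d_True (dfn_defclass B)).
apply: (d_ext (X := fun v => exists w, th w /\ (w = v 0 \/ lt w (v 0)) /\ chain j w /\ (X w <-> ~~ odd j))).
  by move=> v; split=> -[w]; [move=> [? [? []]]|move=> []]; exists w.
by ddfn.
Qed.

(** Each passage from inside X to outside leaves a convex piece behind for good: [done_at z]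
    collects the pieces without points from z on, and it grows at each passage. *)
Lemma chain_bounded n (C : 'I_n -> U -> Prop) : (forall i, cvx lt (C i)) ->
  (forall z, th z -> (X z <-> exists i, C i z)) ->
  forall k z, chain k.*2 z -> (k <= n)%N.
Proof.
move=> Ccvx XC.
pose done_at z : {set 'I_n} := finset.finset (fun i => `[< forall u, le z u -> ~ C i u >]).
have done_up x y : le x y -> done_at x \subset done_at y.
  move=> xy; apply/fintype.subsetP => i; rewrite !inE => /asboolP h.
  by apply/asboolP => u /(le_trans xy); exact: h.
suff h k z : chain k.*2 z -> (k <= #|done_at z|)%N.
  move=> k z /h /leq_trans; apply; rewrite -[X in (_ <= X)%N]card_ord.
  exact: max_card.
elim: k z => [//|k IH] z; rewrite doubleS /=.
move=> [w2 [tw2 w2z [w1 [tw1 w12 /IH ck Xw1]] Xw2]].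
have {}Xw1 : X w1 by apply/Xw1; rewrite odd_double.
have {}Xw2 : ~ X w2 by move=> /Xw2; rewrite odd_double.
have [i Ci] := (XC _ tw1).1 Xw1.
have lt12 : lt w1 w2 by case: w12 => // e; case: Xw2; rewrite -e.
have i2 : i \in done_at w2.
  rewrite inE; apply/asboolP => u w2u Cu; apply: Xw2; apply/XC => //; exists i.
  by case: w2u => [->//|w2u]; exact: Ccvx Ci Cu lt12 w2u.
have i1 : i \notin done_at w1.
  by rewrite inE; apply/asboolP => /(_ w1 (or_introl erefl)).
apply: leq_trans (subset_leq_card (done_up _ _ w2z)).
apply: leq_trans (_ : #|i |: done_at w1| <= _)%N; first by rewrite cardsU1 i1 add1n ltnS.
apply/subset_leq_card/fintype.subsetP => j; rewrite in_setU1 => /orP[/eqP ->//|].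
exact/fintype.subsetP/done_up.
Qed.

End Chains.

(** Let j be the greatest length of an alternation up to x. It is odd, since otherwise x itself,
    being in X, would prolong it; then y, being outside X, does prolong it, and length j + 1
    separates x from y. *)
Lemma cut0 B X x y : dfn B (fun v => X (v 0)) -> lt x y -> eqv set0 x y -> X x -> ~ X y ->
  exists H, [/\ dfn B (fun v => H (v 0)), forall u w, lt u w -> H u -> H w, ~ H x & H y].
Proof.
move=> DX xy exy Xx nXy.
have [n [C [th [Dth thx Ccvx XC]]]] := go_wqo G x DX.
have thy : th y by rewrite -(eqv_dfn exy Dth).
have [j [cj ncj]] : exists j, chain X th j x /\ ~ chain X th j.+1 x.
  apply: contrapT => h.
  have all j : chain X th j x.
    elim: j => // j IH; apply: contrapT => nc; apply: h; by exists j.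
  by have := chain_bounded Ccvx XC (all n.+1.*2); rewrite ltnn.
have oj : odd j.
  by apply: contrapT => oj; apply: ncj; exists x; split=> //; [left|split=> // _; apply/negP].
exists (chain X th j.+1); split=> //.
- by apply: chain_dfn => //; apply: dfn_sub Dth.
- by move=> u w; exact: chain_up.
- exists y; split=> //; [by left|exact: chain_up xy cj|].
  by rewrite oj.
Qed.

Lemma cut B X x y : dfn B (fun v => X (v 0)) -> lt x y -> eqv set0 x y -> ~ (X x <-> X y) ->
  exists H, [/\ dfn B (fun v => H (v 0)), forall u w, lt u w -> H u -> H w, ~ H x & H y].
Proof.
move=> DX xy exy nX; have [Xx|nXx] := pselect (X x).
  by apply: (cut0 DX xy exy Xx) => Xy; apply: nX; tauto.
apply: (cut0 (X := fun x => ~ X x) _ xy exy nXx); first by ddfn.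
by move=> nXy; apply: nX; tauto.
Qed.

Lemma cut_eqv B x y : small B -> lt x y -> eqv set0 x y -> ~ eqv B x y ->
  exists H, [/\ dfn B (fun v => H (v 0)), forall u w, lt u w -> H u -> H w, ~ H x & H y].
Proof.
by move=> sB xy exy /(not_eqv sB)[R [DR nR]]; exact: cut DR xy exy nR.
Qed.

Lemma eqv0 B x y : eqv B x y -> eqv set0 x y.
Proof. exact: eqv_sub. Qed.

Lemma eqv_convex B x y z : small B -> lt x y -> lt y z -> eqv B x z -> eqv set0 x y -> eqv B x y.
Proof.
move=> sB xy yz exz exy; apply: contrapT => nxy.
have [H [DH Hup nHx Hy]] := cut_eqv sB xy exy nxy.
by apply: nHx; rewrite (eqv_dfn exz DH); exact: Hup yz Hy.
Qed.

Lemma cut_semi B a y z : small B -> lt a y -> lt y z -> eqv B a y -> eqv B a z ->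
  ~ eqv (B +: a) y z ->
  exists E, [/\ dfn B (fun v => E (v 0) (v 1)), ER B a E, E a y & ~ E a z].
Proof.
move=> sB ay yz eay eaz nyz.
have eyz : eqv set0 y z by exact: (eqv_trans (eqv_sym (eqv0 eay)) (eqv0 eaz)).
have [H [DH Hup nHy Hz]] := cut_eqv (smallU_setU1 mon sB) yz eyz nyz.
have [|||E [DE EE hE]] := @go_simple _ G B a (fun x => ~ H x) sB.
- by ddfn.
- by move=> /(Hup _ _ ay).
- by move=> u w _ _ nHw _ uw /(Hup _ _ uw).
exists E; split=> //; first exact/hE.
by move=> /hE; apply=> //; exact: go_trans G _ _ _ ay yz.
Qed.

Lemma ER_aut B E f x y : dfn B (fun v => E (v 0) (v 1)) -> aut B f -> (E x y <-> E (f x) (f y)).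
Proof. by move=> DE af; exact: aut_dfn2 af DE. Qed.

(** Otherwise some relation over B links x0 to x1 but not to x2; the shift [f] makes it link x1 to
    x2, against transitivity. *)
Lemma eqv_step B x0 x1 x2 f : small B -> lt x0 x1 -> lt x1 x2 ->
  aut B f -> f x0 = x1 -> f x1 = x2 -> eqv (B +: x0) x1 x2.
Proof.
move=> sB x01 x12 af f0 f1; apply: contrapT => n12.
have e01 : eqv B x0 x1 by exists f.
have e12 : eqv B x1 x2 by exists f.
have e02 := eqv_trans e01 e12.
have [E [DE [Er Es Et] E01 nE02]] := cut_semi sB x01 x12 e01 e02 n12.
apply: nE02; apply: (Et x0 x1 x2) => //; first exact: eqv_refl.
by move: E01; rewrite (ER_aut _ _ DE af) f0 f1.
Qed.

End Order.

(** * The bound on grids *)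

Section Count.
Context (lt : U -> U -> Prop) (G : gorder lt).

(* A point of a grid is the least one in its row component or in its column
   component; this injects the grid into the set of components. *)
Lemma count_atoms m n n' (p : 'I_m -> 'I_m -> U)
    (C : 'I_m -> 'I_n -> U -> Prop) (C' : 'I_m -> 'I_n' -> U -> Prop) :
  (forall i k, cvx lt (C i k)) -> (forall j k, cvx lt (C' j k)) ->
  (forall i j, exists k, C i k (p i j)) -> (forall i j, exists k, C' j k (p i j)) ->
  (forall i i' j' k, C i k (p i' j') -> i = i') ->
  (forall j i' j' k, C' j k (p i' j') -> j = j') ->
  (m <= n + n')%N.
Proof.
move=> Cv Cv' hk hl Cd Cd'.
have [k hk'] := choice (fun ij : 'I_m * 'I_m => hk ij.1 ij.2).
have [l hl'] := choice (fun ij : 'I_m * 'I_m => hl ij.1 ij.2).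
pose least (ij : 'I_m * 'I_m) := forall i' j', C ij.1 (k ij) (p i' j') -> ~ lt (p i' j') (p ij.1 ij.2).
pose g ij : ('I_m * 'I_n) + ('I_m * 'I_n') :=
  if pselect (least ij) then inl (ij.1, k ij) else inr (ij.2, l ij).
have least' ij : ~ least ij -> forall i' j', C' ij.2 (l ij) (p i' j') -> ~ lt (p i' j') (p ij.1 ij.2).
  move=> nl i' j' Cij' lt2.
  have [i1 [j1 [Cij1 lt1]]] : exists i1 j1, C ij.1 (k ij) (p i1 j1) /\ lt (p i1 j1) (p ij.1 ij.2).
    apply: contrapT => h; apply: nl => i1 j1 C1 l1; apply: h; by exists i1, j1.
  have uniq i j : C ij.1 (k ij) (p i j) -> C' ij.2 (l ij) (p i j) -> ~ lt (p i j) (p ij.1 ij.2).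
    by move=> /Cd <- /Cd' <-; exact: go_irr.
  case: (go_total G (p i1 j1) (p i' j')) => [h|e|h].
  - by apply: (uniq i' j') => //; exact: Cv Cij1 (hk' ij) h lt2.
  - by apply: (uniq i' j') => //; rewrite -e.
  - by apply: (uniq i1 j1) => //; exact: Cv' Cij' (hl' ij) h lt1.
have ginj : injective g.
  move=> ij ij'; rewrite /g.
  case: pselect => a; case: pselect => b // -[e1 e2].
  - have h1 := a ij'.1 ij'.2; have h2 := b ij.1 ij.2.
    case: (go_total G (p ij.1 ij.2) (p ij'.1 ij'.2)) => [h|h|h].
    + by case: h2 => //; rewrite -e1 -e2; exact: hk'.
    + have := hl' ij; rewrite h => /Cd' e; rewrite (surjective_pairing ij) (surjective_pairing ij').
      by rewrite e1 e.
    + by case: h1 => //; rewrite e1 e2; exact: hk'.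
  - have h1 := least' _ a ij'.1 ij'.2; have h2 := least' _ b ij.1 ij.2.
    case: (go_total G (p ij.1 ij.2) (p ij'.1 ij'.2)) => [h|h|h].
    + by case: h2 => //; rewrite -e1 -e2; exact: hl'.
    + have := hk' ij; rewrite h => /Cd e; rewrite (surjective_pairing ij) (surjective_pairing ij').
      by rewrite e1 e.
    + by case: h1 => //; rewrite e1 e2; exact: hl'.
have := leq_card g ginj; rewrite card_sum !card_prod !card_ord -mulnDr.
by case: m {p C C' Cv Cv' hk hl Cd Cd' k hk' l hl' least g least' ginj} => // m; rewrite leq_pmul2l.
Qed.

(** N depends on X and X' alone: pulling back along an automorphism over B keeps the number of
    convex pieces, and [th], being 0-definable, holds at every conjugate of [c]. So N is known
    before the size of the grid is chosen. *)
Lemma count_orbit B B' c X X' : dfn B' (fun v => X (v 0)) -> dfn B' (fun v => X' (v 0)) ->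
  exists N, forall m (g g' : 'I_m -> U -> U) (p : 'I_m -> 'I_m -> U),
    (forall i, aut B (g i)) -> (forall i, aut B (g' i)) -> (forall i j, eqv B c (p i j)) ->
    (forall i j, X (g i (p i j))) -> (forall i j, X' (g' j (p i j))) ->
    (forall i i' j', X (g i (p i' j')) -> i = i') ->
    (forall j i' j', X' (g' j (p i' j')) -> j = j') -> (m <= N)%N.
Proof.
move=> DX DX'.
have [n [C [th [Dth thc Ccvx XC]]]] := go_wqo G c DX.
have [n' [C' [th' [Dth' thc' Ccvx' XC']]]] := go_wqo G c DX'.
exists (n + n')%N => m g g' p ag ag' ep hX hX' dX dX'.
have thp h i j : aut B h -> th (h (p i j)).
  move=> ah; have e : eqv set0 c (h (p i j)).
    by apply: eqv0; apply: eqv_trans (ep i j) _; exists h.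
  by rewrite -(eqv_dfn e Dth).
have thp' h i j : aut B h -> th' (h (p i j)).
  move=> ah; have e : eqv set0 c (h (p i j)).
    by apply: eqv0; apply: eqv_trans (ep i j) _; exists h.
  by rewrite -(eqv_dfn e Dth').
apply: (@count_atoms m n n' p (fun i k x => C k (g i x)) (fun i k x => C' k (g' i x))).
- move=> i k x y z Cx Cz xy yz; apply: (Ccvx k _ _ _ Cx Cz); exact: (aut_lt G _ _ (ag i)).1.
- move=> i k x y z Cx Cz xy yz; apply: (Ccvx' k _ _ _ Cx Cz); exact: (aut_lt G _ _ (ag' i)).1.
- by move=> i j; apply/XC; [exact: thp|exact: hX].
- by move=> i j; apply/XC'; [exact: thp'|exact: hX'].
- by move=> i i' j' k Ck; apply: (dX i i' j'); apply/XC; [exact: thp|exists k].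
- by move=> i i' j' k Ck; apply: (dX' i i' j'); apply/XC'; [exact: thp'|exists k].
Qed.

End Count.

End Core.

(** * Orbits under condition (R) *)

Section Binarity.
Context {L : signature unit} {M : structure L} {kappa : Type}.
Hypothesis mon : monster kappa M.
Local Notation U := (M tt).
Implicit Types (B : set U) (X R : U -> Prop) (E : U -> U -> Prop).
Local Notation small := (@smallU L M kappa).

(** The orbit form of [condition_R], to which it is shown equivalent below. *)
Definition condR := forall B a E, small B -> dfn B (fun v => E (v 0) (v 1)) -> ER B a E ->
  exists psi : U -> U -> Prop, dfn set0 (fun v => psi (v 0) (v 1)) /\
    forall x y, eqv B a x -> eqv B a y -> (E x y <-> psi x y).

Hypothesis HR : condR.

(** A failure yields, by [cut_semi], a relation E with E x y and not E x z; by (R) it is 0-definable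
    on the orbit, against conjugacy of y and z over x. *)
Lemma eqv_above (lt : U -> U -> Prop) (G : @gorder L M kappa lt) B x y z : small B ->
  eqv B x y -> eqv B x z -> lt x y -> eqv (set0 +: x) y z -> eqv (B +: x) y z.
Proof.
move=> sB; have Dlt := lt_dfn G (set0 +: x).
wlog yz : y z / lt y z => [hw exy exz xy eyz|exy exz xy eyz].
  case: (go_total G y z) => [h|->|h]; [exact: hw|exact: eqv_refl|].
  apply: eqv_sym; apply: hw => //; last exact: eqv_sym.
  by rewrite -(eqv_dfn (R := fun z => lt x z) eyz)//; ddfn.
apply: contrapT => nyz.
have [E [DE EE Exy nExz]] := cut_semi mon G sB xy yz exy exz nyz.
have [psi [Dpsi hpsi]] := HR sB DE EE.
have {}Dpsi : dfn (set0 +: x) (fun v => psi (v 0) (v 1)) by apply: dfn_sub Dpsi.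
apply: nExz; apply/hpsi => //; first exact: eqv_refl.
rewrite -(eqv_dfn (R := fun z => psi x z) eyz); last by ddfn.
by apply/hpsi => //; exact: eqv_refl.
Qed.

Context (lt : U -> U -> Prop) (G : @gorder L M kappa lt)
  (G' : @gorder L M kappa (fun x y => lt y x)).

Lemma eqv_pair B x y z : small B -> eqv B x y -> eqv B x z -> eqv (set0 +: x) y z ->
  eqv (B +: x) y z.
Proof.
move=> sB exy exz eyz; case: (go_total G x y) => [xy|xy|yx].
- exact: (eqv_above G sB exy exz xy eyz).
- suff -> : z = y by exact: eqv_refl.
  by move: eyz => [f [af <-]]; rewrite -xy (aut_fix af)//; right.
- exact: (eqv_above G' sB exy exz yx eyz).
Qed.

Definition homog (x : nat -> U) := (forall i j, (i < j)%N -> lt (x i) (x j)) /\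
  forall i j, (i < j)%N -> exists f, [/\ aut set0 f, f (x 0) = x i & f (x 1) = x j].

Lemma homog_pairs x i j i' j' : homog x -> (i < j)%N -> (i' < j')%N ->
  exists f, [/\ aut set0 f, f (x i) = x i' & f (x j) = x j'].
Proof.
move=> [_ hx] /hx[f [/aut_inv[h [ah fh hf]] fi fj]] /hx[g [ag gi gj]].
exists (g \o h); split; first exact: aut_comp.
- by rewrite -gi -fi /= fh.
- by rewrite -gj -fj /= fh.
Qed.

Lemma homog_eqv0 x i j : homog x -> eqv set0 (x i) (x j).
Proof. by move=> hx; have [f [af fi _]] := homog_pairs hx (ltnSn i) (ltnSn j); exists f. Qed.

(** The automorphism taking the pair (x i, x j) to (x j, x (j + 1)) is a shift to which [eqv_step]
    applies: the second point of a pair can advance while the first stays fixed. *)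
Lemma homog_consecutive x : (forall n, lt (x n) (x n.+1)) ->
  (forall n, exists f, [/\ aut set0 f, f (x 0) = x n & f (x 1) = x n.+1]) -> homog x.
Proof.
move=> xlt hx.
have mono i k : lt (x i) (x (i + k.+1)%N).
  elim: k => [|k IH]; first by rewrite addn1.
  by rewrite addnS; exact: go_trans G _ _ _ IH (xlt _).
split=> [i j ij|i j ij]; first by have := mono i (j - i.+1)%N; rewrite addnS -addSn subnKC.
suff h k : exists f, [/\ aut set0 f, f (x 0) = x i & f (x 1) = x (i + k.+1)%N].
  by have := h (j - i.+1)%N; rewrite addnS -addSn subnKC.
elim: k => [|k [f [af f0 f1]]]; first by rewrite addn1; exact: hx.
pose j' := (i + k.+1)%N.
have [g [ag g0 g1]] := hx j'; have [h [ah fh hf]] := aut_inv af.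
have [|||||e [ae e1]] := @eqv_step _ _ _ mon _ G set0 (x i) (x j') (x j'.+1) (g \o h) (small0 mon).
- exact: mono.
- exact: xlt.
- exact: aut_comp.
- by rewrite /= -f0 fh.
- by rewrite /= /j' -f1 fh.
exists (e \o f); split.
- by apply: aut_comp => //; apply: aut_sub ae.
- by rewrite /= f0 (aut_fix ae)//; right.
- by rewrite /= f1 -/j' e1 /j' !addnS.
Qed.

(** Suppose [g] is right on the terms 0, ..., n. The image of term n + 1 and its target are both
    conjugate to [y], the image of term n, over B and the images of the terms before n: this is the
    induction hypothesis with index n skipped. Over [y] alone they are conjugate by homogeneity of
    pairs, so [eqv_pair] corrects [g]. *)
Lemma eqv_indisc B x : small B -> homog x -> (forall k, eqv B (x 0) (x k)) ->
  forall n (s : nat -> nat), (forall i j, (i < j)%N -> (s i < s j)%N) ->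
  exists g, aut B g /\ forall k, (k < n)%N -> g (x k) = x (s k).
Proof.
move=> sB hx hB; elim=> [|n IH] s smono; first by exists id; split=> //; exact: aut_id.
case: n IH => [|n] IH.
  by have [g [ag g0]] := hB (s 0); exists g; split=> // -[].
have [g [ag gx]] := IH s smono.
pose B' := B `|` [set y | exists2 k, (k < n)%N & y = x (s k)].
have sB' : small B'.
  rewrite /B'; elim: (n) => [|m IHm].
    rewrite (_ : [set y | _] = set0) ?setU0//.
    by apply/seteqP; split=> // y [].
  apply: (small_sub (B := els ((B `|` [set y | exists2 k, (k < m)%N & y = x (s k)]) +: x (s m)))).
    apply: els_sub => y [By|[k]]; first by left; left.
    by rewrite ltnS leq_eqVlt => /orP[/eqP ->|km] ->; [right|left; right; exists k].
  exact: (smallU_setU1 mon IHm).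
have in_aut f : aut B f -> (forall k, (k < n)%N -> f (x (s k)) = x (s k)) -> aut B' f.
  by move=> [bf hf Bf] fx; split=> // y [/Bf//|[k kn ->]]; exact: fx.
have [h [ah gh hg]] := aut_inv ag.
pose y := x (s n); pose z := x (s n.+1).
have skip (t : nat -> nat) i j : (forall i j, (i < j)%N -> (t i < t j)%N) -> (i < j)%N ->
    ((if (i < n)%N then t i else t i.+1) < (if (j < n)%N then t j else t j.+1))%N.
  by move=> ht ij; do 2 case: ifP => ?; apply: ht; lia.
have eyz : eqv B' y z.
  have [g1 [ag1 g1x]] := IH (fun k => if (k < n)%N then s k else s k.+1) (fun i j => skip s i j smono).
  exists (g1 \o h); split.
    apply: in_aut; first exact: aut_comp.
    move=> k kn; rewrite /= -(gx k) ?gh ?g1x ?kn ?gx//; lia.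
  by rewrite /y -(gx n)//= gh g1x// ltnn.
have eyg : eqv B' y (g (x n.+1)).
  have [g1 [ag1 g1x]] := IH (fun k => if (k < n)%N then k else k.+1) (fun i j => skip id i j (fun _ _ => id)).
  exists (g \o (g1 \o h)); split.
    apply: in_aut; first by apply: aut_comp => //; exact: aut_comp.
    by move=> k kn; rewrite /= -{1}(gx k) ?gh ?g1x ?kn ?gx//; lia.
  by rewrite /y -(gx n)//= gh g1x// ltnn.
have e0 : eqv (set0 +: y) (g (x n.+1)) z.
  have [f [af fn fn1]] := homog_pairs hx (ltnSn n) (smono n n.+1 (ltnSn n)).
  exists (f \o h); split.
    apply: aut_setU1; last by rewrite /y -{1}(gx n)//= gh fn.
    by apply: aut_comp => //; apply: aut_sub ah.
  by rewrite /= gh fn1.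
have [g2 [ag2 g2z]] := eqv_pair sB' eyg eyz e0.
exists (g2 \o g); split.
  by apply: aut_comp => //; apply: aut_sub ag2 => b Bb; left; left.
move=> k; rewrite ltnS leq_eqVlt => /orP[/eqP -> //|].
move=> kn; rewrite /= gx//; apply: (aut_fix ag2).
move: kn; rewrite ltnS leq_eqVlt => /orP[/eqP ->|kn]; first by right.
by left; right; exists k.
Qed.

(* With two cuts, moving the sequence so that [c] cuts it at any two prescribed
   places gives conjugates of [c] that contradict [count_orbit]. *)
Lemma one_cut B x c i j : small B -> homog x -> (forall k, eqv B (x 0) (x k)) ->
  (i.+1 < j)%N -> eqv (B +: c) (x i) (x i.+1) \/ eqv (B +: c) (x j) (x j.+1).
Proof.
move=> sB hx hB ij; apply: contrapT => /not_orP[ni nj].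
have sBc := smallU_setU1 mon (a := c) sB.
have xlt k : lt (x k) (x k.+1) by apply: hx.1.
have [H [DH Hup nHi Hi]] := cut_eqv mon G sBc (xlt i) (homog_eqv0 _ _ hx) ni.
have [H' [DH' Hup' nHj Hj]] := cut_eqv mon G sBc (xlt j) (homog_eqv0 _ _ hx) nj.
have [Ga [DGa HGa]] := decompose1 DH; have [Ga' [DGa' HGa']] := decompose1 DH'.
pose B' := B `|` range x.
have Bx k : B' (x k) by right; exists k.
have BB' : B `<=` B' by left.
have DGa1 := dfn_sub BB' DGa; have DGa1' := dfn_sub BB' DGa'.
pose X c' := ~ Ga c' (x i) /\ Ga c' (x i.+1).
pose X' c' := ~ Ga' c' (x j) /\ Ga' c' (x j.+1).
have DX : dfn B' (fun v => X (v 0)).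
  by apply: (d_and (dfn_defclass _)); [apply: (d_not (dfn_defclass _))|];
     apply: (d2 (dfn_defclass B') DGa1); [exact: dterm_var (dfn_defclass _) 0|exact: dfn_param|exact: dterm_var (dfn_defclass _) 0|exact: dfn_param].
have DX' : dfn B' (fun v => X' (v 0)).
  by apply: (d_and (dfn_defclass _)); [apply: (d_not (dfn_defclass _))|];
     apply: (d2 (dfn_defclass B') DGa1'); [exact: dterm_var (dfn_defclass _) 0|exact: dfn_param|exact: dterm_var (dfn_defclass _) 0|exact: dfn_param].
have [N hN] := count_orbit G B c DX DX'.
pose m := N.+1.
(* Terms up to i + 1 move by a < m and the later ones by m + b, so [s] is increasing for all choices
   of a and b. *)
pose s (a b : nat) k := if (k <= i.+1)%N then (k + a)%N else (k + m + b)%N.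
have smono a b : (a < m)%N -> forall k l, (k < l)%N -> (s a b k < s a b l)%N.
  by move=> am k l kl; rewrite /s; do 2 case: ifP => ?; lia.
have mv (a b : 'I_m) : exists g, [/\ aut B g, g (x i) = x (i + a)%N, g (x i.+1) = x (i.+1 + a)%N,
    g (x j) = x (j + m + b)%N & g (x j.+1) = x (j.+1 + m + b)%N].
  have [g [ag gx]] := eqv_indisc sB hx hB j.+2 (smono a b (ltn_ord a)).
  exists g; split=> //; rewrite gx /s; try lia.
  - by rewrite leqnSn.
  - by rewrite leqnn.
  - by case: ifP => //; lia.
  - by case: ifP => //; lia.
have [h hh] := choice (fun ab : 'I_m * 'I_m => mv ab.1 ab.2).
have inv (a b : 'I_m) : exists k, [/\ aut B k, cancel (h (a, b)) k & cancel k (h (a, b))].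
  by have [ag _ _ _ _] := hh (a, b); exact: aut_inv.
have [k hk] := choice (fun ab : 'I_m * 'I_m => inv ab.1 ab.2).
pose p a b := h (a, b) c.
(* A conjugate of [c] defines a final segment, which can begin at one place only; hence that place
   determines the row, and likewise the column. *)
have Gup a b u w : lt u w -> Ga (p a b) u -> Ga (p a b) w.
  have [ak kh hk'] := hk (a, b).
  rewrite (aut_dfn2 _ _ ak DGa) (aut_dfn2 (p a b) w ak DGa) /p kh => uw.
  by rewrite -!HGa; apply: Hup; exact: (aut_lt G u w ak).1.
have Gup' a b u w : lt u w -> Ga' (p a b) u -> Ga' (p a b) w.
  have [ak kh hk'] := hk (a, b).
  rewrite (aut_dfn2 _ _ ak DGa') (aut_dfn2 (p a b) w ak DGa') /p kh => uw.
  by rewrite -!HGa'; apply: Hup'; exact: (aut_lt G u w ak).1.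
pose g a := k (a, @ord0 N); pose g' b := k (@ord0 N, b).
have XE a u : X (g a u) <-> ~ Ga u (x (i + a)%N) /\ Ga u (x (i.+1 + a)%N).
  have [ag h1 h2 _ _] := hh (a, ord0); have [ak kh hk'] := hk (a, ord0).
  by rewrite /X -h1 -h2 !(aut_dfn2 (g a u) _ ag DGa) /g hk'.
have XE' b u : X' (g' b u) <-> ~ Ga' u (x (j + m + b)%N) /\ Ga' u (x (j.+1 + m + b)%N).
  have [ag _ _ h1 h2] := hh (ord0, b); have [ak kh hk'] := hk (ord0, b).
  by rewrite /X' -h1 -h2 !(aut_dfn2 (g' b u) _ ag DGa') /g' hk'.
suff : (m <= N)%N by rewrite /m ltnn.
apply: (hN m g g' p).
- by move=> a; have [] := hk (a, ord0).
- by move=> a; have [] := hk (ord0, a).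
- by move=> a b; have [ag _ _ _ _] := hh (a, b); exists (h (a, b)).
- move=> a b; have [ag h1 h2 _ _] := hh (a, b); apply/XE; rewrite -h1 -h2 /p.
  by rewrite -!(aut_dfn2 c _ ag DGa) -!HGa.
- move=> a b; have [ag _ _ h1 h2] := hh (a, b); apply/XE'; rewrite -h1 -h2 /p.
  by rewrite -!(aut_dfn2 c _ ag DGa') -!HGa'.
- move=> a a' b' /XE [n1 y1].
  have [_ h1 h2 _ _] := hh (a', b').
  have [n2 y2] : ~ Ga (p a' b') (x (i + a')%N) /\ Ga (p a' b') (x (i.+1 + a')%N).
    have [ag h3 h4 _ _] := hh (a', b'); rewrite -h3 -h4 /p.
    by rewrite -!(aut_dfn2 c _ ag DGa) -!HGa.
  apply: val_inj => /=; case: (ltngtP a a') => // aa.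
  + case: n2; have [e|ne] := eqVneq (i.+1 + a)%N (i + a')%N; first by rewrite -e.
    by apply: Gup y1; apply: hx.1; lia.
  + case: n1; have [e|ne] := eqVneq (i.+1 + a')%N (i + a)%N; first by rewrite -e.
    by apply: Gup y2; apply: hx.1; lia.
- move=> b a' b' /XE' [n1 y1].
  have [n2 y2] : ~ Ga' (p a' b') (x (j + m + b')%N) /\ Ga' (p a' b') (x (j.+1 + m + b')%N).
    have [ag _ _ h3 h4] := hh (a', b'); rewrite -h3 -h4 /p.
    by rewrite -!(aut_dfn2 c _ ag DGa') -!HGa'.
  apply: val_inj => /=; case: (ltngtP b b') => // aa.
  + case: n2; have [e|ne] := eqVneq (j.+1 + m + b)%N (j + m + b')%N; first by rewrite -e.
    by apply: Gup' y1; apply: hx.1; lia.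
  + case: n1; have [e|ne] := eqVneq (j.+1 + m + b')%N (j + m + b)%N; first by rewrite -e.
    by apply: Gup' y2; apply: hx.1; lia.
Qed.

End Binarity.

(** * Joining two parameters *)

Section Pairs.
Context {L : signature unit} {M : structure L} {kappa : Type}.
Hypothesis mon : monster kappa M.
Local Notation U := (M tt).
Implicit Types (A B : set U).
Local Notation small := (@smallU L M kappa).
Local Notation gorder := (@gorder L M kappa).

(** Each of the two automorphisms moves w further up; the smaller of the two images lies in both
    orbits, because orbits are convex within an orbit over the empty set. *)
Lemma common_step (lt : U -> U -> Prop) (G : gorder lt) A b c u w : small A -> lt u w ->
  eqv (A +: b) u w -> eqv (A +: c) u w ->
  exists z, [/\ lt w z, eqv (A +: b) w z, eqv (A +: c) w z &
    exists f, [/\ aut set0 f, f u = w & f w = z]].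
Proof.
move=> sA uw [f [af fu]] [g [ag gu]].
have sAb := smallU_setU1 mon (a := b) sA; have sAc := smallU_setU1 mon (a := c) sA.
have w1 : lt w (f w) by rewrite -{1}fu -(aut_lt G _ _ af).
have w2 : lt w (g w) by rewrite -{1}gu -(aut_lt G _ _ ag).
have af0 : aut set0 f by apply: aut_sub af.
have ag0 : aut set0 g by apply: aut_sub ag.
have e1 : eqv (A +: b) w (f w) by exists f.
have e2 : eqv (A +: c) w (g w) by exists g.
case: (go_total G (f w) (g w)) => [h|h|h].
- exists (f w); split=> //; last by exists f.
  exact: (eqv_convex mon G sAc w1 h e2 (eqv0 e1)).
- by exists (f w); split=> //; [rewrite h|exists f].
- exists (g w); split=> //; last by exists g.
  exact: (eqv_convex mon G sAb w2 h e1 (eqv0 e2)).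
Qed.

Hypothesis HR : condR (kappa := kappa) (M := M).
Context (lt : U -> U -> Prop) (G : gorder lt) (G' : gorder (fun x y => lt y x)).

(** An automorphism [f] over A b takes x to x' but may move b'. Both f b' and b' are conjugate to b
    over A x', and they are conjugate to each other over b; [eqv_pair] at b then brings f b' back to
    b' while fixing A, x' and b. *)
Lemma eqv_exchange A b b' x x' : small A -> eqv (A +: b) x x' ->
  eqv (A +: x) b b' -> eqv (A +: x') b b' -> eqv (A +: b +: b') x x'.
Proof.
move=> sA [f [af fx]] e e'.
have fb : f b = b by apply: (aut_fix af); right.
have e1 : eqv (A +: x') b (f b').
  rewrite -{1}fb; apply: (eqv_image af _ e) => y [Ay|->]; last by exists x => //; right.
  by exists y; [left|apply: (aut_fix af); left].
have e0 : eqv (set0 +: b) (f b') b'.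
  apply: eqv_sym; exists f; split=> //; apply: aut_sub af => y [//|->]; by right.
have [g [ag gf]] := eqv_pair mon HR G G' (smallU_setU1 mon sA) e1 e' e0.
exists (g \o f); split; last by rewrite /= fx (aut_fix ag)//; left; right.
have aA : aut A (g \o f).
  apply: aut_comp; first by apply: aut_sub ag => y Ay; left; left.
  by apply: aut_sub af => y Ay; left.
apply: aut_setU1; last exact: gf.
by apply: aut_setU1 => //=; rewrite fb (aut_fix ag)//; right.
Qed.

(* If not, extend [x, x'] to a sequence inside both orbits; [c] cuts it over [A b]
   between its second and third terms.  Shifting by an automorphism over [A c]
   gives [b'] such that [c] cuts the sequence over [A b'] two places further, and
   [b'] is conjugate to [b] over each term: so [c] has two cuts over [A b b']. *)
Lemma eqv_join A b c x x' : small A -> eqv (A +: b) x x' -> eqv (A +: c) x x' ->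
  eqv (A +: b +: c) x x'.
Proof.
move=> sA.
wlog lxx' : x x' / lt x x' => [hw eb ec|eb ec].
  case: (go_total G x x') => [h|->|h]; [exact: hw|exact: eqv_refl|].
  by apply: eqv_sym; apply: hw => //; exact: eqv_sym.
apply: contrapT => nbc.
have sAb := smallU_setU1 mon (a := b) sA; have sAc := smallU_setU1 mon (a := c) sA.
pose Q u w := [/\ lt u w, eqv (A +: b) u w & eqv (A +: c) u w].
pose sim u w u' w' := exists f : U -> U, [/\ aut set0 f, f u = u' & f w = w'].
have sim_trans u w u1 w1 u2 w2 : sim u w u1 w1 -> sim u1 w1 u2 w2 -> sim u w u2 w2.
  move=> [f [af <- <-]] [g [ag gu gw]]; exists (g \o f); split=> //; exact: aut_comp.
have sim_sym u w u1 w1 : sim u w u1 w1 -> sim u1 w1 u w.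
  by move=> [f [af <- <-]]; have [g [ag fg gf]] := aut_inv af; exists g; split.
have nxt (uw : U * U) : exists z, Q uw.1 uw.2 -> Q uw.2 z /\ sim uw.1 uw.2 uw.2 z.
  have [[h1 h2 h3]|nq] := pselect (Q uw.1 uw.2); last by exists uw.1.
  by have [z [? ? ? ?]] := common_step G sA h1 h2 h3; exists z.
have [nx hnx] := choice nxt.
(* With [z0] in front, the cut falls between [y 1] and [y 2], and after a shift by two between [y 3]
   and [y 4]. Terms from [y 2] on are reached by the shift, and [one_cut] handles the steps before
   [y 2]. Were the cut at the first step, the step leading to [y 2] would be adjacent to the shifted
   cut and out of reach of [one_cut]. *)
have [z0 [z0x ebz ecz [f0 [af0 f0x' f0x]]]] := common_step G' sA lxx' (eqv_sym eb) (eqv_sym ec).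
pose st := fix st n : U * U := if n is n'.+1 then ((st n').2, nx (st n')) else (x, x').
pose y n := if n is n'.+1 then (st n').1 else z0.
have stQ n : Q (st n).1 (st n).2 /\ sim x x' (st n).1 (st n).2.
  elim: n => [|n [IH IH']]; first by split=> //; exists id; split=> //; exact: aut_id.
  by have [h1 h2] := hnx _ IH; split=> //; exact: sim_trans IH' h2.
have sim0 : sim x x' z0 x by exists f0.
have yQ n : Q (y n) (y n.+1).
  case: n => [|n]; last exact: (stQ n).1.
  by split=> //; exact: eqv_sym.
have ysim n : sim x x' (y n) (y n.+1).
  by case: n => [|n] //; exact: (stQ n).2.
have hy : homog lt y.
  apply: (homog_consecutive mon G) => n; first by have [] := yQ n.
  exact: sim_trans (sim_sym _ _ _ _ (ysim 0)) (ysim n).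
have yb k : eqv (A +: b) (y 0) (y k).
  elim: k => [|k IH]; first exact: eqv_refl.
  by apply: eqv_trans IH _; have [] := yQ k.
have yc k : eqv (A +: c) (y 0) (y k).
  elim: k => [|k IH]; first exact: eqv_refl.
  by apply: eqv_trans IH _; have [] := yQ k.
(* Two is the least shift for which the two cuts are far enough apart for [one_cut]; eight terms
   carry the images past the new cut. *)
have [h [ah hyk]] := eqv_indisc mon HR G G' sAc hy yc 8 (s := fun k => k.+2) (fun i j ij => ij).
have hA B : B `<=` A -> forall u, B u -> exists2 v, B v & h v = u.
  by move=> BA u Bu; exists u => //; apply: (aut_fix ah); left; exact: BA.
pose b' := h b.
have im u w : eqv (A +: b) u w -> eqv (A +: b') (h u) (h w).
  apply: (eqv_image ah) => v [Av|->]; last by exists b => //; right.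
  by exists v; [left|apply: (aut_fix ah); left].
have im' u w : eqv (A +: c +: b') (h u) (h w) -> eqv (A +: c +: b) u w.
  have [k [ak hk kh]] := aut_inv ah.
  move=> e; rewrite -(hk u) -(hk w); apply: (eqv_image ak _ e) => v [Av|->].
    by exists v; [left|apply: (aut_fix ak)].
  by exists b'; [right|rewrite /b' hk].
have ncut1 : ~ eqv (A +: c +: b) (y 1) (y 2).
  by move=> e; apply: nbc; apply: eqv_sub e => v [[|]|]; by [left; left|right|left; right].
have ncut3 : ~ eqv (A +: c +: b') (y 3) (y 4).
  by rewrite -(hyk 1)// -(hyk 2)// => /im'.
have ycc k : (k.+1 < 3)%N \/ (4 < k)%N -> eqv (A +: b') (y k) (y k.+1).
  move=> hk; have e : eqv (A +: c +: b') (y k) (y k.+1).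
    case: hk => hk.
      by have [//|/ncut3] := one_cut mon HR G G' b' sAc hy yc hk.
    by have [/ncut3|//] := one_cut mon HR G G' b' sAc hy yc hk.
  by apply: eqv_sub e => v [Av|->]; [left; left|right].
have yb' k : eqv (A +: b') (y 2) (y k).
  have mid k' : (k' < 8)%N -> eqv (A +: b') (y 2) (y k'.+2).
    by move=> k8; rewrite -(hyk 0)// -(hyk k')//; exact: im.
  have [k2|k2] := ltnP k 2.
    have e01 : eqv (A +: b') (y 0) (y 1) by apply: ycc; left.
    have e12 : eqv (A +: b') (y 1) (y 2) by apply: ycc; left.
    by case: k k2 => [|[|//]] _; apply: eqv_sym => //; exact: eqv_trans e01 e12.
  elim: k k2 => // k IH k2; have [k5|k5] := ltnP 4 k.
    by apply: eqv_trans (IH _) _; [lia|apply: ycc; right].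
  by case: k {IH} k2 k5 => [|k] // k2 k5; apply: mid; lia.
have bb' k : eqv (A +: y k) b b'.
  have [f [af fk]] := yb' k; have [e [ae ek]] := eqv_sym (yb k).
  exists (f \o (h \o e)); split; last first.
    by rewrite /= (aut_fix ae) ?(aut_fix af)//; right.
  apply: aut_setU1; last by rewrite /= ek hyk.
  apply: aut_comp; first by apply: aut_sub af => v; left.
  apply: aut_comp; first by apply: aut_sub ah => v; left.
  by apply: aut_sub ae => v; left.
have ybb' k : eqv (A +: b +: b') (y 0) (y k) by apply: eqv_exchange.
have [] := one_cut mon HR G G' c (smallU_setU1 mon (a := b') sAb) hy ybb' (isT : (1.+1 < 3)%N).
  move=> e; apply: ncut1; apply: eqv_sub e => v [[Av|->]|->]; by [left; left; left|right|left; left; right].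
move=> e; apply: ncut3; apply: eqv_sub e => v [[Av|->]|->]; by [left; left; left|right|left; right].
Qed.

End Pairs.

(** * Condition (R) and binarity *)

Section Entailment.
Context {S : Type} {L : signature S}.

Definition closure (l : seq (@var S)) (phi : formula L) := foldr (fun z psi => All z psi) phi l.

Lemma closure_free (l : seq {classic @var S}) phi (z : {classic @var S}) :
  free z (closure l phi) -> free z phi /\ z \notin l.
Proof.
elim: l => [//|x l IH] /= [xz /IH[zf zl]]; split=> //; rewrite inE negb_or zl andbT.
by apply/eqP => zx; apply: xz.
Qed.

Lemma closure_sat (N : structure L) l phi :
  (forall v : assignment N, sat v (closure l phi)) <-> (forall v : assignment N, sat v phi).
Proof.
elim: l => [//|x l IH]; rewrite -IH; split=> h v; last by move=> w _; exact: h.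
exact: (h v v (fun _ _ => erefl)).
Qed.

(** Completeness concerns sentences, hence the detour through the universal closure. *)
Lemma complete_entails (T : set (formula L)) (N : structure L) phi :
  complete_theory T -> models N T -> (forall v : assignment N, sat v phi) -> entails T phi.
Proof.
move=> [_ _ Tc] NT h; have [l hl] := free_list phi.
have [z /closure_free[/hl zl]|e|e] := Tc (closure l phi).
- by rewrite zl.
- by move=> N' N'T; apply/closure_sat; exact: e.
- have v : assignment N.
    move=> z; exact: projT1 (cid (let: inhabits x := carrier_inhabited N z.1 in
                            ex_intro (fun=> True) x I)).
  exact: False_ind _ (e N NT v ((closure_sat N l phi).2 h v)).
Qed.

End Entailment.

(** * From pairs to tuples *)

Section Tuples.
Context {L : signature unit} {M : structure L} {kappa : Type}.
Hypothesis mon : monster kappa M.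
Local Notation U := (M tt).
Implicit Types (A B : set U).
Local Notation small := (@smallU L M kappa).

Lemma compactness n B (F : ((nat -> U) -> Prop) -> Prop) : small B ->
  (exists X, F X) -> (forall X, F X -> dfn B X) ->
  (forall X, F X -> forall v w : nat -> U, (forall i, (i < n)%N -> v i = w i) -> X v -> X w) ->
  (forall X, F X -> exists v, X v) ->
  (forall X Y, F X -> F Y -> exists2 Z, F Z & forall v, Z v -> X v /\ Y v) ->
  exists v, forall X, F X -> X v.
Proof.
elim: n B F => [|n IH] B F sB F0 FB Fs Fne Fdir.
  have [X0 FX0] := F0; have [v X0v] := Fne X0 FX0.
  by exists v => X FX; have [w Xw] := Fne X FX; exact: Fs Xw.
have [||||u hu] := @saturation _ _ _ mon B (fun R => exists2 X, F X & R = fun u => exists y, X (scons u y)) sB.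
- by have [X FX] := F0; exists (fun u => exists y, X (scons u y)); exists X.
- move=> R [X FX ->].
  pose sg i := if i is i'.+1 then i' else n.
  apply: d_ext (d_ex_many (dfn_defclass B) n (d_reindex (dfn_defclass B) sg (FB X FX))) => v.
  split=> -[y Xy]; exists y; apply: Fs Xy => // -[|i] ni /=; rewrite /scat /= ?ltnn ?subnn//.
    by move: ni; rewrite ltnS => ->.
  by move: ni; rewrite ltnS => ->.
- move=> R [X FX ->]; have [v Xv] := Fne X FX.
  by exists (v 0), (fun i => v i.+1); apply: Fs Xv => // -[].
- move=> R R' [X FX ->] [Y FY ->]; have [Z FZ hZ] := Fdir X Y FX FY.
  exists (fun u => exists y, Z (scons u y)); first by exists Z.
  by move=> u [y /hZ[Xy Yy]]; split; exists y.
have [|||||v hv] := IH (B +: u) (fun Y => exists2 X, F X & Y = fun v => X (scons u v)) (smallU_setU1 mon sB).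
- by have [X FX] := F0; exists (fun v => X (scons u v)), X.
- move=> Y [X FX ->].
  apply: (d_subst (dfn_defclass _) (X := X) (t := fun i v => scons u v i)).
    by apply: dfn_sub (FB X FX) => b; left.
  move=> [|i]; first by apply: dfn_param; right.
  exact: (dterm_var (dfn_defclass _) i).
- move=> Y [X FX ->] v w vw; apply: Fs => // -[|i] //= ni; exact: vw.
- by move=> Y [X FX ->]; apply: (hu (fun u => exists y, X (scons u y))); exists X.
- move=> Y Y' [X FX ->] [X' FX' ->]; have [Z FZ hZ] := Fdir X X' FX FX'.
  by exists (fun v => Z (scons u v)); [exists Z|move=> v /hZ].
by exists (scons u v) => X FX; apply: (hv (fun v => X (scons u v))); exists X.
Qed.

Hypothesis HR : condR (kappa := kappa) (M := M).
Context (lt : U -> U -> Prop) (G : @gorder L M kappa lt)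
  (G' : @gorder L M kappa (fun x y => lt y x)).

Definition initial (a : nat -> U) n : set U := [set u | exists2 k, (k < n)%N & u = a k].

Lemma initial0 a : initial a 0 = set0.
Proof. by apply/seteqP; split=> // u []. Qed.

Lemma initialS a n : initial a n.+1 = initial a n +: a n.
Proof.
apply/seteqP; split=> u.
  move=> [k]; rewrite ltnS leq_eqVlt => /orP[/eqP -> ->|kn ->]; first by right.
  by left; exists k.
by move=> [[k kn ->]|->]; [exists k => //; exact: ltnW|exists n].
Qed.

Lemma small_setU_initial B a n : small B -> small (B `|` initial a n).
Proof.
move=> sB; elim: n => [|n IH]; first by rewrite initial0 setU0.
by rewrite initialS setUA; exact: (smallU_setU1 mon IH).
Qed.

Lemma small_initial a n : small (initial a n).
Proof. by rewrite -(set0U (initial a n)); apply: small_setU_initial; exact: small0 mon. Qed.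

(** [eqv_join] is applied with the first n entries as base and the next two as the parameters to
    join. In [a'] entry n is replaced by entry n + 1, so that both hypotheses are instances for a
    tuple shorter by one. *)
Lemma eqv_initial a n x x' : eqv set0 x x' ->
  (forall k, (k < n)%N -> eqv (set0 +: a k) x x') -> eqv (initial a n) x x'.
Proof.
move=> e0; elim: n a => [|n IH] a ha.
  by rewrite initial0.
case: n IH ha => [|n] IH ha.
  by rewrite initialS initial0; exact: ha.
rewrite !initialS; apply: (eqv_join mon HR G G' (@small_initial a n)).
  by rewrite -initialS; apply: IH => k kn; apply: ha; exact: ltnW.
pose a' k := if k == n then a n.+1 else a k.
have -> : initial a n +: a n.+1 = initial a' n.+1.
  rewrite initialS {2}/a' eqxx; congr (_ `|` _).
  by apply/seteqP; split=> u [k kn ->]; exists k => //; rewrite /a'; case: eqP => //; lia.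
by apply: IH => k kn; rewrite /a'; case: eqP => _; apply: ha => //; exact: ltnW.
Qed.

Lemma eqv_tuple (a a' : nat -> U) n :
  (forall i j, (i < n)%N -> (j < n)%N -> exists f, [/\ aut set0 f, f (a i) = a' i & f (a j) = a' j]) ->
  exists f, aut set0 f /\ forall i, (i < n)%N -> f (a i) = a' i.
Proof.
elim: n => [|n IH] h; first by exists id; split=> //; exact: aut_id.
have [|f [af fa]] := IH; first by move=> i j ni nj; apply: h; exact: ltnW.
have [k [ak fk kf]] := aut_inv af.
have [||e [ae ea]] := @eqv_initial a' n (f (a n)) (a' n).
- have [g [ag ga _]] := h n n (ltnSn n) (ltnSn n).
  by exists (g \o k); split; [exact: aut_comp|rewrite /= fk].
- move=> i ni; have [g [ag gi gn]] := h i n (ltnW ni) (ltnSn n).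
  exists (g \o k); split; last by rewrite /= fk.
  by apply: aut_setU1; [exact: aut_comp|rewrite /= -(fa i ni) fk gi fa].
exists (e \o f); split; first by apply: aut_comp => //; apply: aut_sub ae.
move=> i; rewrite ltnS leq_eqVlt => /orP[/eqP -> //|ni] /=.
by rewrite fa// (aut_fix ae)//; exists i.
Qed.

Lemma dfn_set0 (X : (nat -> U) -> Prop) : dfn set0 X -> @dfn0 _ M X.
Proof.
move=> [Y [s [DY s0 h]]].
apply: d_ext (d_reindex (@dfn0_defclass _ M) (fun i => if s i is inl m then m else 0) DY) => v.
have -> : (fun i => v (if s i is inl m then m else 0)) = (fun i => ev v (s i)).
  by apply: funext => i; case si : (s i) => [//|b]; have := s0 i b si.
by rewrite h.
Qed.

Lemma eqv_of_pairs (a0 a1 b0 b1 : U) :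
  (forall R : U -> U -> Prop, @dfn0 _ M (fun v => R (v 0) (v 1)) -> R a0 a1 -> R b0 b1) ->
  exists f, [/\ aut set0 f, f a0 = b0 & f a1 = b1].
Proof.
move=> h.
have [f [af f0]] : eqv set0 a0 b0.
  by apply: (type_orbit mon (small0 mon)) => R /dfn_set0 DR; exact: (h (fun x _ => R x) DR).
have [g [ag gf]] : eqv (set0 +: b0) (f a1) b1.
  apply: (type_orbit mon (@small1 _ _ _ mon b0)) => R /decompose1[Ga [DGa HGa]] /HGa.
  rewrite -f0 -(aut_dfn2 _ _ af DGa) => hGa; apply/HGa; apply: (h Ga) hGa.
  exact: dfn_set0.
exists (g \o f); split=> //.
- by apply: aut_comp => //; apply: aut_sub ag.
- by rewrite /= f0 (aut_fix ag)//; right.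
Qed.

Definition pairwise_definable : ((nat -> U) -> Prop) -> Prop := fun X =>
  exists psi, bool_comb_formula (@at_most_two_free _ L) psi /\
    forall w : assignment M, X (fun n => w (tt, n)) <-> sat w psi.

Lemma pairwise_supp X : pairwise_definable X -> @dfn0 _ M X.
Proof. by move=> [psi [_ h]]; exists psi. Qed.

Lemma pairwise_not X : pairwise_definable X -> pairwise_definable (fun v => ~ X v).
Proof.
move=> [psi [bpsi h]]; exists (Imp psi Bot); split; first by apply: bcf_imp => //; exact: bcf_bot.
by move=> w /=; rewrite h.
Qed.

Lemma pairwise_and X Y : pairwise_definable X -> pairwise_definable Y ->
  pairwise_definable (fun v => X v /\ Y v).
Proof.
move=> [psi [bpsi h]] [chi [bchi h']].
exists (Imp (Imp psi (Imp chi Bot)) Bot); split.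
  by do !apply: bcf_imp => //; exact: bcf_bot.
move=> w /=; rewrite h h'; split=> [[? ?] /(_ _ _)|]; first exact.
by move=> hh; split; apply: contrapT => n; apply: hh.
Qed.

Lemma pairwise_base (R : U -> U -> Prop) i j : @dfn0 _ M (fun v => R (v 0) (v 1)) ->
  pairwise_definable (fun v => R (v i) (v j)).
Proof.
move=> DR.
have DR' := d_reindex (@dfn0_defclass _ M) (fun k => if k is 0 then i else j) DR.
have [||psi [_ fpsi hpsi]] := @fclass_free _ _ M tt _ _ (fun k => k = i \/ k = j) _ DR'.
- by split.
- by move=> v w vw; rewrite !vw; auto.
exists psi; split=> //; apply: bcf_base; exists (tt, i), (tt, j) => -[[] k] /fpsi /= [_ [->|->]].
  by left.
by right.
Qed.

(** Pairs determine tuples up to conjugacy, so tuples that agree on all binary formulas agree on X.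
    Compactness is used twice: first to find, around each point of X, a Boolean combination of
    binary formulas inside X, then to cover X by finitely many of these. *)
Lemma all_pairwise X : @dfn0 _ M X -> pairwise_definable X.
Proof.
move=> DX; have H0 := @dfn0_defclass _ M.
have [n hn] := dc_supp H0 DX.
have D0 Y : @dfn0 _ M Y -> dfn set0 Y by exact: dfn0_dfn.
pose cut_to (Y : (nat -> U) -> Prop) a v := Y (fun i => if (i < n)%N then v i else a).
have [a0 _] : exists a : U, True by case: (carrier_inhabited M tt) => a; exists a.
pose ok Y := pairwise_definable Y /\
  forall v w : nat -> U, (forall i, (i < n)%N -> v i = w i) -> Y v -> Y w.
have ok_and Y Z : ok Y -> ok Z -> ok (fun v => Y v /\ Z v).
  move=> [pY sY] [pZ sZ]; split; first exact: pairwise_and.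
  by move=> v w vw [/(sY _ _ vw) ? /(sZ _ _ vw) ?].
have ok_not Y : ok Y -> ok (fun v => ~ Y v).
  move=> [pY sY]; split; first exact: pairwise_not.
  by move=> v w vw nY Yw; apply: nY; apply: sY Yw => i ni; rewrite vw.
have okF : ok (fun=> False).
  split=> //; exists Bot; split=> //; exact: bcf_bot.
have nX : @dfn0 _ M (fun v => ~ X v) by exact: d_not.
have snX : forall v w : nat -> U, (forall i, (i < n)%N -> v i = w i) -> ~ X v -> ~ X w.
  by move=> v w vw nXv Xw; apply: nXv; apply: hn Xw => i ni; rewrite vw.
have claim a : X a -> exists Y, [/\ ok Y, Y a & forall b, Y b -> X b].
  move=> Xa; apply: contrapT => nY.
  have [|||||b hb] := @compactness n set0
      (fun Z => exists Y, [/\ ok Y, Y a & Z = fun v => Y v /\ ~ X v]) (small0 mon).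
  - exists (fun v => ~ False /\ ~ X v), (fun v => ~ False); split=> //; exact: ok_not.
  - by move=> Z [Y [[/pairwise_supp DY _] Ya ->]]; apply: D0; exact: d_and.
  - move=> Z [Y [[_ sY] Ya ->]] v w vw [/(sY _ _ vw) ? /(snX _ _ vw) ?] //.
  - move=> Z [Y [oY Ya ->]]; apply: contrapT => nZ; apply: nY; exists Y; split=> // b Yb.
    by apply: contrapT => nXb; apply: nZ; exists b.
  - move=> Z Z' [Y [oY Ya ->]] [Y' [oY' Ya' ->]].
    exists (fun v => (Y v /\ Y' v) /\ ~ X v); last by move=> v [[]].
    by exists (fun v => Y v /\ Y' v); split=> //; exact: ok_and.
  have hb' Y : ok Y -> Y a -> Y b.
    by move=> oY Ya; have [] := hb (fun v => Y v /\ ~ X v) (ex_intro _ Y (And3 oY Ya erefl)).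
  have [_ nXb] := hb (fun v => ~ False /\ ~ X v) (ex_intro _ _ (And3 (ok_not _ okF) (@id False) erefl)).
  have [|f [af fa]] := @eqv_tuple a b n.
    move=> i j ni nj; apply: eqv_of_pairs => R DR Rij.
    apply: (hb' (fun v => R (v i) (v j))) => //; split; first exact: pairwise_base.
    by move=> v w vw; rewrite !vw.
  apply: nXb; apply: (hn (fun i => f (a i))) => //.
  exact: (aut_dfn af (D0 _ DX) a).1 Xa.
have [//|nY] := pselect (pairwise_definable X).
have [|||||a ha] := @compactness n set0
    (fun Z => exists Y, [/\ ok Y, forall b, Y b -> X b & Z = fun v => ~ Y v /\ X v]) (small0 mon).
- by exists (fun v => ~ False /\ X v), (fun=> False); split.
- move=> Z [Y [[/pairwise_supp DY _] Ya ->]]; apply: D0; apply: d_and => //; exact: d_not.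
- move=> Z [Y [oY Ya ->]] v w vw [nYv /(hn _ _ vw) Xw]; split=> //.
  exact: (ok_not _ oY).2 vw nYv.
- move=> Z [Y [[pY _] YX ->]]; apply: contrapT => nZ; apply: nY.
  have -> : X = Y; last by [].
  apply: funext => v; apply: propext; split=> [Xv|/YX//].
  by apply: contrapT => nYv; apply: nZ; exists v.
- move=> Z Z' [Y [oY Ya ->]] [Y' [oY' Ya' ->]].
  exists (fun v => ~ (~ (~ Y v /\ ~ Y' v)) /\ X v).
    exists (fun v => ~ (~ Y v /\ ~ Y' v)); split=> //.
      exact: (ok_not _ (ok_and _ _ (ok_not _ oY) (ok_not _ oY'))).
    by move=> b hb; apply: contrapT => nXb; apply: hb; split=> [/Ya|/Ya'].
  by move=> v [/contrapT[]].
have [_ Xa] := ha (fun v => ~ False /\ X v) (ex_intro _ (fun=> False) (And3 okF (fun b => False_ind _) erefl)).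
have [Y [oY Ya YX]] := claim a Xa.
by have [] := ha (fun v => ~ Y v /\ X v) (ex_intro _ Y (And3 oY YX erefl)).
Qed.

Lemma binary_of_R T : complete_theory T -> models M T -> binary_theory T.
Proof.
move=> Tc MT phi.
have [|psi [bpsi h]] := @all_pairwise (fun v => sat (@mkasg _ _ M tt v) phi).
  exists phi; split=> // w; apply: sat_ext => -[[] i] _; by rewrite mkasgE.
have h' (w : assignment M) : sat w phi <-> sat w psi.
  by rewrite -h; apply: sat_ext => -[[] i] _; rewrite mkasgE.
exists psi; split=> //; split; apply: (complete_entails Tc MT) => v /=; by move/h'.
Qed.

End Tuples.

(** * From binarity to (R), and the two forms of (R) *)

Section Binary_theories.
Context {L : signature unit} {M : structure L} {kappa : Type}.
Hypothesis mon : monster kappa M.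
Local Notation U := (M tt).

Lemma condR_of_binary T : models M T -> binary_theory T -> condR (kappa := kappa) (M := M).
Proof.
move=> MT bT B a Y sB0 DY _.
have [Z [s [[phi [_ hphi]] sB hZ]]] := DY.
have [psi [bpsi [ephi epsi]]] := bT phi.
pose pr (x y : U) : nat -> U := fun i => if i is 0 then x else y.
pose val x y := @mkasg _ _ M tt (fun i => ev (pr x y) (s i)).
have YE x y : Y x y <-> sat (val x y) psi.
  have -> : Y x y <-> sat (val x y) phi.
    rewrite -hphi; have := hZ (pr x y); rewrite (_ : (fun n => val x y (tt, n) : U) = (fun i => ev (pr x y) (s i)))//.
    by apply: funext => n; rewrite /val mkasgE.
  by split; [exact: (ephi M MT (val x y))|exact: (epsi M MT (val x y))].
suff [R [DR hR]] : exists R : U -> U -> Prop, dfn set0 (fun v => R (v 0) (v 1)) /\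
    forall x y, eqv B a x -> eqv B a y -> (R x y <-> sat (val x y) psi).
  by exists R; split=> // x y ax ay; rewrite hR.
have H0 := @dfn0_defclass _ M.
elim: bpsi {ephi epsi YE} => {psi} [chi [[[] i] [[[] j] fchi]]||chi psi _ [R [DR hR]] _ [R' [DR' hR']]].
- pose Q (u w : U) := sat (@mkasg _ _ M tt (fun k => if k == i then u else w)) chi.
  have DQ : @dfn0 _ M (fun v => Q (v 0) (v 1)).
    have D1 : @dfn0 _ M (fun v => sat (@mkasg _ _ M tt v) chi).
      exists chi; split=> // w; apply: sat_ext => -[[] k] _; by rewrite mkasgE.
    apply: d_ext (d_reindex H0 (fun k => if k == i then 0 else 1) D1) => v.
    rewrite /Q (_ : (fun k => v (if k == i then 0 else 1)) = (fun k => if k == i then v 0 else v 1))//.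
    by apply: funext => k; case: eqP.
  have QE x y : Q (ev (pr x y) (s i)) (ev (pr x y) (s j)) <-> sat (val x y) chi.
    apply: sat_ext => -[[] k] /fchi[[->]|[->]]; rewrite /val !mkasgE ?eqxx//.
    by case: eqP => [->|].
  have DQB : dfn B (fun v => Q (v 0) (v 1)) by exact: dfn0_dfn.
  case si : (s i) QE => [m|c]; case sj : (s j) => [m'|c'] QE.
  + exists (fun x y => Q (pr x y m) (pr x y m')); split=> [|x y _ _]; last exact: QE.
    apply: dfn0_dfn; apply: d_ext (d_reindex H0 (fun k => if k is 0 then (if m is 0 then 0 else 1) else (if m' is 0 then 0 else 1)) DQ) => v.
    by case: (m); case: (m').
  (* One variable is a parameter: the truth value is constant on the orbit, so its value at [a]
     replaces it, and a truth value needs no parameters. *)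
  + have DQ1 : dfn B (fun v => Q (v 0) c').
      by apply: (d2 (dfn_defclass B) DQB); [exact: (dterm_var (dfn_defclass B) 0)|apply: dfn_param; exact: sB sj].
    exists (fun x y => Q a c'); split=> [|x y ax ay]; first exact: (d_const (dfn_defclass _)).
    have em : eqv B a (pr x y m) by case: (m).
    by rewrite -QE; exact: (eqv_dfn (R := fun x => Q x c') em DQ1).
  + have DQ1 : dfn B (fun v => Q c (v 0)). 
      by apply: (d2 (dfn_defclass B) DQB); [apply: dfn_param; exact: sB si|exact: (dterm_var (dfn_defclass B) 0)].
    exists (fun x y => Q c a); split=> [|x y ax ay]; first exact: (d_const (dfn_defclass _)).
    have em : eqv B a (pr x y m') by case: (m').
    by rewrite -QE; exact: (eqv_dfn (R := fun x => Q c x) em DQ1).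
  + exists (fun x y => Q c c'); split=> [|x y _ _]; last exact: QE.
    exact: (d_const (dfn_defclass _)).
- by exists (fun _ _ => False); split=> //; exact: (dc_bot (dfn_defclass _)).
- exists (fun x y => R x y -> R' x y); split; first exact: (dc_imp (dfn_defclass _) DR DR').
  by move=> x y ax ay /=; rewrite hR// hR'.
Qed.

Lemma condR_of_condition_R : condition_R M kappa -> condR (kappa := kappa) (M := M).
Proof.
move=> HR B a E sB DE [Er Es Et].
pose P : set U := realizations (tp (els B) a).
have Porb (b : U) : P b <-> eqv B a b by exact: realizations_eqv mon _ _ _ sB.
pose E' x y := [/\ E x y, P x & P y].
have [|Y [DY hY]] := (rel_binary_dfn P set0 E').1.
  rewrite (_ : els set0 = set0); last by apply/seteqP; split=> // c [].
  apply: (HR (els B) _ sB (tp_complete _ _)).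
  split; last by apply/rel_binary_dfn; exists E.
  split.
  - by move=> x y [].
  - by move=> x Px; split=> //; apply: Er; exact/Porb.
  - by move=> x y [Exy Px Py]; split=> //; apply: Es => //; exact/Porb.
  - move=> x y z [Exy Px Py] [Eyz _ Pz]; split=> //.
    by apply: (Et x y z) => //; exact/Porb.
exists Y; split=> // x y /Porb Px /Porb Py; split=> h.
  by have /hY[] : E' x y by split.
by have [] : E' x y by apply/hY.
Qed.

Lemma condition_R_of_condR : condR (kappa := kappa) (M := M) -> condition_R M kappa.
Proof.
move=> HR A p sA pc E [[EP Er Es Et] DE].
have [B eAB] := els_ex A; subst A.
have e0 : set0 = els (M := M) set0 by apply/seteqP; split=> // c [].
have [Y [DY hE]] := (rel_binary_dfn _ _ _).1 DE.
rewrite e0; apply: (@rel_binary_dfn _ M (realizations p) set0 E).2.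
have [[a Pa]|nP] := pselect (exists a : U, realizations p a); last first.
  exists (fun _ _ => True); split; first exact: (d_True (dfn_defclass _)).
  by move=> x y; split=> [/EP[Px _]|[_ Px _]]; case: nP; exists x.
have Porb z : realizations p z <-> eqv B a z.
  by rewrite (complete_tp pc Pa); exact: (realizations_eqv mon).
have EY x y : eqv B a x -> eqv B a y -> (E x y <-> Y x y).
  by move=> /Porb Px /Porb Py; rewrite hE; split=> [[]|].
have [|psi [Dpsi hpsi]] := HR B a Y sA DY.
  split.
  - by move=> x ax; apply/EY => //; apply: Er; exact/Porb.
  - by move=> x y ax ay /(EY x y ax ay)/Es h; apply/EY.
  - move=> x y z ax ay az /(EY x y ax ay) xy /(EY y z ay az) yz.
    by apply/EY => //; exact: Et yz.
exists psi; split=> // x y; split=> [Exy|[h Px Py]].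
  have [Px Py] := EP _ _ Exy; have /hE[Yxy _ _] := Exy.
  by split=> //; apply/hpsi => //; exact/Porb.
by apply/hE; split=> //; apply/hpsi => //; exact/Porb.
Qed.

End Binary_theories.

(** * The order of a weakly quasi-o-minimal theory *)

Section Final_parts.
Context {U : Type} (P : set U) (R : U -> U -> Prop).
Hypothesis R_trans : forall x y z, R x y -> R y z -> R x z.
Hypothesis R_total : forall x y, P x -> P y -> [\/ R x y, x = y | R y x].

Lemma finite_upper (u0 : U) n (f : 'I_n -> U) : P u0 -> (forall i, P (f i)) ->
  exists u, P u /\ forall i, f i = u \/ R (f i) u.
Proof.
elim: n f => [|n IH] f Pu0 Pf; first by exists u0; split=> // -[].
have [u [Pu hu]] := IH (fun i => f (lift ord0 i)) Pu0 (fun i => Pf _).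
have low i : (f i = f ord0) \/ exists j, i = lift ord0 j.
  by case: (unliftP ord0 i) => [j ->|->]; [right; exists j|left].
case: (R_total (Pf ord0) Pu) => h.
- by exists u; split=> // i; case: (low i) => [->|[j ->//]]; right.
- by exists u; split=> // i; case: (low i) => [->|[j ->//]]; left.
- exists (f ord0); split=> // i; case: (low i) => [->|[j ->]]; first by left.
  by right; case: (hu j) => [->//|k]; exact: R_trans k h.
Qed.

Definition eventually (X : U -> Prop) := exists u, P u /\ forall z, P z -> u = z \/ R u z -> X z.

Lemma eventually_and X Y : eventually X -> eventually Y -> eventually (fun z => X z /\ Y z).
Proof.
have step v w z : R v w -> w = z \/ R w z -> v = z \/ R v z.
  by move=> vw [<-|wz]; right=> //; exact: R_trans vw wz.
move=> [u [Pu hu]] [w [Pw hw]]; case: (R_total Pu Pw) => h.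
- by exists w; split=> // z Pz wz; split; [apply: hu => //; exact: step h wz|exact: hw].
- by exists u; split=> // z Pz uz; split; [exact: hu|apply: hw => //; rewrite -h].
- by exists u; split=> // z Pz uz; split; [exact: hu|apply: hw => //; exact: step h uz].
Qed.

Lemma eventually_ex X : eventually X -> exists z, P z /\ X z.
Proof. by move=> [u [Pu hu]]; exists u; split=> //; apply: hu => //; left. Qed.

(** A cofinal convex piece contains a final part; if no piece is cofinal, a common bound leaves all
    of them behind. *)
Lemma eventually_or_not (u0 : U) n (C : 'I_n -> U -> Prop) (X : U -> Prop) : P u0 ->
  (forall i x y z, C i x -> C i z -> P y -> R x y -> R y z -> C i y) ->
  (forall z, P z -> (X z <-> exists i, C i z)) ->
  eventually X \/ eventually (fun z => ~ X z).
Proof.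
move=> Pu0 Ccvx XC.
have [[i hi]|nco] := pselect (exists i, forall u, P u -> exists z, [/\ P z, u = z \/ R u z & C i z]).
  have [z0 [Pz0 _ Cz0]] := hi u0 Pu0.
  left; exists z0; split=> // z Pz [<-|z0z]; first by apply/XC => //; exists i.
  have [y [Py zy Cy]] := hi z Pz; apply/XC => //; exists i.
  by case: zy => [->//|zy]; exact: Ccvx Cz0 Cy Pz z0z zy.
have bnd i : exists u, P u /\ forall z, P z -> u = z \/ R u z -> ~ C i z.
  apply: contrapT => h; apply: nco; exists i => u Pu; apply: contrapT => h'.
  by apply: h; exists u; split=> // z Pz uz Ciz; apply: h'; exists z.
have [f hf] := choice bnd.
have [u [Pu hu]] := finite_upper Pu0 (fun i => (hf i).1).
right; exists u; split=> // z Pz uz /(XC z Pz)[i Ci].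
apply: (hf i).2 Ci => //.
case: (hu i) => [->//|fu]; right; case: uz => [<-//|uz]; exact: R_trans fu uz.
Qed.

End Final_parts.

Lemma final_partP (U : Type) (P : set U) (R : U -> U -> Prop) (X : U -> Prop) :
  linear_order_on P R ->
  (exists F, final_part P R F /\ F `<=` X) <->
  eventually P R X.
Proof.
move=> [RP _ R_trans _]; split=> [[F [[FP [u Fu] Fup] FX]]|[u [Pu hu]]].
  exists u; split; first exact: FP.
  by move=> z Pz [<-|uz]; apply: FX => //; exact: Fup uz.
exists [set z | P z /\ (u = z \/ R u z)]; split; last by move=> z [Pz uz]; exact: hu.
split; first by move=> z [].
  by exists u; split=> //; left.
move=> x y [Px ux] xy; split; first by have [] := RP _ _ xy.
by right; case: ux => [->//|ux]; exact: R_trans xy.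
Qed.

Section Good_orders.
Context {L : signature unit} {M : structure L} {kappa : Type}.
Hypothesis mon : monster kappa M.
Local Notation U := (M tt).
Implicit Types (B : set U) (X : U -> Prop).
Local Notation small := (@smallU L M kappa).

Definition locally_convex (lt : U -> U -> Prop) X := forall x0 : U,
  exists n (C : 'I_n -> U -> Prop) (th : U -> Prop),
      [/\ dfn set0 (fun v => th (v 0)), th x0, forall i, cvx lt (C i)
        & forall z, th z -> (X z <-> exists i, C i z)].

(** A convex set is the difference of two final segments, [H1] and [H2]. Once the 0-definable sets
    are frozen on [th], membership in X depends only on the position with respect to n final
    segments, and the points in a given position form a convex set. *)
Lemma bool_comb_convex (lt : U -> U -> Prop) X : linear_order_on setT lt ->
  bool_comb [set Y | definable (M := M) set0 (unary Y) \/ convex setT lt Y] X ->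
  locally_convex lt X.
Proof.
move=> [_ irr trs tot] bX x0.
pose up (H : U -> Prop) := forall u w, lt u w -> H u -> H w.
suff [n [H [th [Dth thx Hup hX]]]] : exists n (H : 'I_n -> U -> Prop) (th : U -> Prop),
    [/\ dfn set0 (fun v => th (v 0)), th x0, forall i, up (H i)
      & forall z z', th z -> th z' -> (forall i, H i z <-> H i z') -> X z -> X z'].
  pose pat (z : U) : {ffun 'I_n -> bool} := [ffun i => `[< H i z >]].
  pose C (k : 'I_#|{ffun 'I_n -> bool}|) (z : U) :=
    pat z = enum_val k /\ exists y, [/\ th y, pat y = enum_val k & X y].
  exists #|{ffun 'I_n -> bool}|, C, th; split=> //.
    move=> k x y z [ex hk] [ez _] xy yz; split=> //; rewrite -ex.
    apply/ffunP => i; rewrite !ffunE; apply/asboolP/asboolP => h; last exact: Hup xy h.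
    have : pat z i by rewrite ffunE; apply/asboolP; exact: Hup yz h.
    by rewrite ez -ex ffunE => /asboolP.
  move=> z tz; split=> [Xz|[k [ez [y [ty ey Xy]]]]].
    by exists (enum_rank (pat z)); split; rewrite enum_rankK//; exists z.
  apply: (hX y z ty tz) => // i.
  have := congr1 (fun f : {ffun _ -> _} => f i) (etrans ey (esym ez)).
  by rewrite !ffunE => e; split=> /asboolP; [rewrite e|rewrite -e] => /asboolP.
elim: bX => {X} [Y [dY|[_ cY]]|Y bY [n [H [th [Dth thx Hup hX]]]]|Y Z bY [n [H [th [Dth thx Hup hY]]]] bZ [m [K [th' [Dth' thx' Kup hZ]]]]].
- have e0 : set0 = els (M := M) set0 by apply/seteqP; split=> // c [].
  have DY : dfn set0 (fun v => Y (v 0)) by apply: dfc_dfn; rewrite -e0; exact/unary_dfc.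
  exists 0, (fun _ _ => True), (fun z => Y z <-> Y x0); split=> //.
    by apply: (d_iff (dfn_defclass _) DY); exact: (d_const (dfn_defclass _)).
  by move=> z z' h h' _ /h /h'.
- pose H1 z := exists2 y, Y y & y = z \/ lt y z.
  pose H2 z := H1 z /\ ~ Y z.
  have YE z : Y z <-> H1 z /\ ~ H2 z.
    split=> [Yz|[h1 h2]]; first by split=> [|[]//]; exists z => //; left.
    by apply: contrapT => nY; apply: h2.
  have up1 : up H1.
    by move=> u w uw [y Yy yu]; exists y => //; right; case: yu => [->//|yu]; exact: trs yu uw.
  have up2 : up H2.
    move=> u w uw [h1 nYu]; split; first exact: up1 uw h1.
    move=> Yw; apply: nYu; case: h1 => y Yy [<-//|yu].
    exact: (cY y u w Yy Yw I yu uw).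
  exists 2, (fun i => if i == ord0 then H1 else H2), (fun=> True); split=> //.
  + exact: (d_True (dfn_defclass _)).
  + by move=> i; case: eqP.
  + move=> z z' _ _ h; have := h ord0; have := h ord_max => /= h2 h1.
    by rewrite (YE z) (YE z') h1 h2.
- exists n, H, th; split=> // z z' tz tz' h nYz Yz'; apply: nYz.
  by apply: (hX z' z tz' tz) => // i; split=> /h.
- exists (n + m)%N, (fun i => match fintype.split i with inl j => H j | inr j => K j end),
    (fun z => th z /\ th' z); split=> //.
  + exact: (d_and (dfn_defclass _)).
  + by move=> i; case: fintype.splitP.
  + move=> z z' [t1 t1'] [t2 t2'] h [Yz|Zz]; [left|right].
      apply: (hY z z' t1 t2) Yz => i; have := h (lshift m i).
      by rewrite -[lshift m i]/(unsplit (inl i)) unsplitK.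
    apply: (hZ z z' t1' t2') Zz => i; have := h (rshift n i).
    by rewrite -[rshift n i]/(unsplit (inr i)) unsplitK.
Qed.

Section Intro.
Context (lt : U -> U -> Prop).
Hypothesis lt_lin : linear_order_on setT lt.
Hypothesis lt_def : dfn set0 (fun v => lt (v 0) (v 1)).
Hypothesis lt_wqo : forall B X, dfn B (fun v => X (v 0)) -> locally_convex lt X.

Lemma trace_convex (P : set U) X : (forall R, dfn set0 (fun v => R (v 0)) -> P `<=` R \/ P `<=` ~` R) ->
  locally_convex lt X ->
  exists (n : nat) (C : 'I_n -> set U),
    (forall i, convex P (fun x y => [/\ lt x y, P x & P y]) (C i)) /\
    X `&` P = [set a | exists i, C i a].
Proof.
move=> hP cX; have [[x0 Px0]|nP] := pselect (exists x, P x); last first.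
  exists 0, (fun=> set0); split; first by case.
  by apply/seteqP; split=> [a [_ Pa]|a [[]]//]; case: nP; exists a.
have [n [C [th [Dth thx Ccvx XC]]]] := cX x0.
have Pth : P `<=` th.
  by have [//|/(_ _ Px0)] := hP th Dth.
exists n, (fun i => C i `&` P); split.
  move=> i; split=> [a []//|a b c [Ca _] [Cc _] Pb [ab _ _] [bc _ _]]; split=> //.
  exact: Ccvx Ca Cc ab bc.
apply/seteqP; split=> [a [Xa Pa]|a [i [Ca Pa]]].
  by have [i Ci] := (XC a (Pth a Pa)).1 Xa; exists i.
by split=> //; apply/XC; [exact: Pth|exists i].
Qed.

Hypothesis T_simple : theory_simple_semiintervals M kappa.

(** Restricted to the type of [a], the order gives a weakly o-minimal pair; the points of X from [a]
    on form a semiinterval of it, and simplicity supplies E. *)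
Lemma gorder_intro : @gorder L M kappa lt.
Proof.
have [lt_setT irr trs tot] := lt_lin.
have D B : dfn B (fun v => lt (v 0) (v 1)) by apply: dfn_sub lt_def.
split=> //.
- by move=> x y; exact: tot.
- by move=> B X x0 DX; exact: lt_wqo DX x0.
move=> B a X sB DX Xa cX.
pose P : set U := realizations (tp (els B) a).
have Porb (b : U) : P b <-> eqv B a b by exact: realizations_eqv mon _ _ _ sB.
have Pa : P a by exact: realizes_tp.
pose ltP x y := [/\ lt x y, P x & P y].
have e0 : set0 = els (M := M) set0 by apply/seteqP; split=> // c [].
have simp : simple_semiintervals (els B) tt (tp (els B) a).
  apply: (T_simple (tp_complete set0 a)) => //; last first.
  - move=> phi [o iv h]; split=> //; exact: over_sub o.
  - exact: tp_complete.
have wom : weakly_o_minimal_pair (els B) (tp (els B) a) ltP.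
  split.
  - exact: tp_complete.
  - split.
    + by move=> x y [].
    + by move=> x [/irr].
    + by move=> x y z [xy Px Py] [yz _ Pz]; split=> //; exact: trs xy yz.
    + move=> x y Px Py; case: (tot x y I I) => h; first by apply: Or31.
        exact: Or32.
      exact: Or33.
  - by apply/rel_binary_dfn; exists lt.
  - move=> B' X'; have [B2 ->] := els_ex B' => /rel_unary_dfn[Y [DY ->]].
    apply: trace_convex; last exact: lt_wqo DY.
    move=> R DR; have [Ra|nRa] := pselect (R a); [left|right] => b /Porb /eqv0 e /=.
      by rewrite -/(R b) -(eqv_dfn e DR).
    by rewrite -(eqv_dfn e DR).
pose I x := [/\ P x, a = x \/ lt a x & X x].
have semi : semiinterval (els B) (tp (els B) a) ltP a I.
  split.
  - split=> [x []//|x y z [Px ax Xx] [Pz az Xz] Py [xy _ _] [yz _ _]].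
    have ay : lt a y by case: ax => [->//|/trs]; apply.
    by split=> //; [right|apply: (cX y z) => //; exact/Porb].
  - by split=> //; left.
  - by move=> x [Px [->|ax] _]; [left|right].
  - rewrite -els1 -elsU; apply/rel_unary_dfn.
    exists (fun x => (a = x \/ lt a x) /\ X x); split.
      have Dlt := D (B +: a); by ddfn.
    by apply/seteqP; split=> [x [? ? ?]|x [[? ?] ?]].
have [E [[[EP Er Es Et] DE] hI]] := simp ltP wom a I semi.
have [Y [DY hY]] := (rel_binary_dfn P B E).1 DE.
exists Y; split=> //.
  split.
  - by move=> x /Porb Px; have /hY[] := Er x Px.
  - move=> x y /Porb Px /Porb Py Yxy.
    by have /Es/hY[] : E x y by apply/hY.
  - move=> x y z /Porb Px /Porb Py /Porb Pz Yxy Yyz.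
    have Exy : E x y by apply/hY.
    have Eyz : E y z by apply/hY.
    by have /hY[] := Et _ _ _ Exy Eyz.
move=> x /Porb Px ax; split=> [Xx|Yax].
  have : I x by split=> //; right.
  by rewrite hI => -[/hY[]].
have : [set x | E a x /\ (a = x \/ ltP a x)] x.
  by split; [apply/hY|right].
by rewrite -hI => -[].
Qed.

End Intro.

Lemma exists_gorder : weakly_quasi_o_minimal M -> theory_simple_semiintervals M kappa ->
  exists lt : U -> U -> Prop, [/\ @gorder L M kappa lt, @gorder L M kappa (fun x y => lt y x)
    & forall B X, dfn B (fun v => X (v 0)) -> locally_convex lt X].
Proof.
move=> [lt [lin def wqo]] T_simple.
have e0 : set0 = els (M := M) set0 by apply/seteqP; split=> // c [].
have Dlt : dfn set0 (fun v => lt (v 0) (v 1)) by apply: dfc_dfn; rewrite -e0; exact/binary_dfc.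
have W B X : dfn B (fun v => X (v 0)) -> locally_convex lt X.
  move=> DX; apply: bool_comb_convex lin _; apply: (wqo (els B)).
  by apply/unary_dfc; exact: dfn_dfc.
exists lt; split=> //; first exact: gorder_intro.
have [_ irr trs tot] := lin.
apply: gorder_intro => //.
- split=> //; first by move=> x y z xy yz; exact: trs yz xy.
  by move=> x y _ _; case: (tot x y I I) => h; [apply: Or33|apply: Or32|apply: Or31].
- exact: (d_reindex (dfn_defclass _) (fun i => if i is 0 then 1 else 0) Dlt).
- move=> B X /W W' x0; have [n [C [th [Dth thx Ccvx XC]]]] := W' x0.
  exists n, C, th; split=> // i x y z Cx Cz xy yz; exact: Ccvx Cz Cx yz xy.
Qed.

End Good_orders.

(** * From condition (R) to triviality *)

Section Imaginary_definability.
Context {L : signature unit} {M : structure L}.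
Local Notation U := (M tt).
Local Notation Meq := (eq_structure M).
Implicit Types (A : set (elt Meq)) (B : set U) (X : (nat -> U) -> Prop).

Definition dE A : ((nat -> U) -> Prop) -> Prop := @dfc _ _ Meq (Real M tt) A.

Definition relt (u : U) : elt Meq := @to_elt _ _ Meq (Real M tt) u.

Lemma dE_defclass A : defclass (dE A).
Proof. exact: (@dfc_defclass _ _ Meq (Real M tt) A). Qed.

Lemma dfn0_dE A X : @dfn0 _ M X -> dE A X.
Proof. by move=> DX; apply: (@dfn_eq _ M A set0) => //; exact: dfn0_dfn. Qed.

Lemma dE_const A c : A c -> forall g : nat -> nat,
  dE A (fun v => projT2 c = abs (projT1 c) (fun i => v (g i))).
Proof.
case: c => -[[]|d] x Ac g.
  apply: (d_eq (dE_defclass A) (t := fun=> x) (u := fun v => v (g 0))).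
    exact: (@dfc_param _ _ Meq (Real M tt)).
  exact: dterm_var (dE_defclass A) (g 0).
pose cst_term : term (with_pars Meq) (Imag d) :=
  @App _ (with_pars Meq) (inr (existT _ (Imag d) x)) (fun i => match notF (ltn_ord i) with end).
pose cls_term : term (with_pars Meq) (Imag d) :=
  @App _ (with_pars Meq) (inl (inr d)) (fun i => Var (with_pars Meq) (Real M tt, g i)).
exists (Equal cst_term cls_term); split; last by move=> w.
by split; split=> // -[].
Qed.

Lemma abs_aut g s (t t' : nat -> U) : aut set0 g ->
  (abs s t = abs s t' <-> abs s (fun i => g (t i)) = abs s (fun i => g (t' i))).
Proof.
move=> [_ ag _]; have H0 := @dfn0_defclass _ M.
pose v i := if odd i then t' i./2 else t i./2.
have := ag _ (d_abs_eq H0 (fun X DX => DX) s double (fun i => i.*2.+1)) v.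
have e1 (h : U -> U) : (fun i => h (v i.*2)) = (fun i => h (t i)).
  by apply: funext => i; rewrite /v odd_double doubleK.
have e2 (h : U -> U) : (fun i => h (v i.*2.+1)) = (fun i => h (t' i)).
  by apply: funext => i; rewrite /v /= odd_double /= uphalf_double.
by rewrite (e1 id) (e2 id) (e1 g) (e2 g).
Qed.

(** The A-definable relations that [g] preserves form a class to which [d_eqclass] applies, so [g]
    need not be extended to the imaginary sorts. The hypothesis says, in terms of names, that [g]
    fixes the parameters. *)
Lemma aut_dE A g X : aut set0 g ->
  (forall c, A c -> forall t : nat -> U,
    projT2 c = abs (projT1 c) t <-> projT2 c = abs (projT1 c) (fun i => g (t i))) ->
  dE A X -> forall v, X v <-> X (fun i => g (v i)).
Proof.
move=> ag Ag DX; have HA := dE_defclass A; have [h [ah gh hg]] := aut_inv ag.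
pose D X := dE A X /\ forall v, X v <-> X (fun i => g (v i)).
suff : D X by case.
have HD : defclass D.
  split.
  - by split=> //; exact: (dc_bot HA).
  - move=> Y Y' [DY hY] [DY' hY']; split; first exact: (dc_imp HA).
    by move=> v; rewrite (hY v) (hY' v).
  - move=> n Y [DY hY]; split; first exact: (dc_all HA).
    move=> v; have e u : (fun i => g (upn v n u i)) = upn (fun i => g (v i)) n (g u).
      by apply: funext => i; rewrite /upn; case: eqP.
    split=> hv u; last by apply/hY; rewrite e.
    by have := hv (h u); rewrite hY e hg.
  - move=> i j; split; first exact: (dc_eq HA).
    by move=> v; split=> [->//|]; exact: aut_inj ag _ _.
  - by move=> Y [/(dc_supp HA)].
apply: (d_eqclass HD _ _ DX) => [Y DY|c Ac s].
  by split; [exact: dfn0_dE|case: ag => _ + _; exact].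
by split; [exact: dE_const|move=> v; exact: Ag].
Qed.

Definition rep (c : elt Meq) : nat -> U := projT1 (cid (abs_surj (projT2 c))).

Lemma repE c : abs (projT1 c) (rep c) = projT2 c.
Proof. exact: projT2 (cid (abs_surj (projT2 c))). Qed.

(** Real names of the imaginary parameters. What is definable over A is definable over this set,
    which is small and real, so that conjugacy makes sense over it. *)
Definition reps A : set U := [set u | exists2 c, A c & exists n, u = rep c n].

Lemma dE_reps A X : dE A X -> dfn (reps A) X.
Proof.
have HD := @dfn_defclass _ M (reps A).
apply: eq_dfn => c Ac g; rewrite -(repE c).
have h := d_abs_eq HD (@dfn0_dfn _ M (reps A)) (projT1 c) double (fun i => i.*2.+1).
pose t i (v : nat -> U) := if odd i then v (g i./2) else rep c i./2.
apply: d_ext (d_subst HD (t := t) h _) => [v|i].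
  rewrite /t (_ : (fun i => if odd i.*2 then _ else _) = rep c); last first.
    by apply: funext => i; rewrite odd_double doubleK.
  rewrite (_ : (fun i => if odd i.*2.+1 then _ else _) = (fun i => v (g i)))//.
  by apply: funext => i; rewrite /= odd_double /= uphalf_double.
rewrite /t; case: (odd i); first exact: dterm_var HD (g i./2).
by apply: dfn_param; exists c => //; exists i./2.
Qed.

Lemma pclass_params A (B : set U) X :
  dE (A `|` relt @` B) X -> pclass (dE A) B X.
Proof.
have HD := pclass_defclass (dE_defclass A) B.
apply: (d_eqclass HD) => [Y /(@dfn0_dE A)|c [Ac|[b Bb <-]] g]; first exact: pclass_base.
  by apply: pclass_base; exact: dE_const.
apply: (d_eq HD (t := fun=> b) (u := fun v => v (g 0))).
  exact: (pclass_param (dE_defclass A)).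
exact: dterm_var HD (g 0).
Qed.

Definition supp n X := forall v w : nat -> U, (forall i, (i < n)%N -> v i = w i) -> X v -> X w.

Lemma suppE n X v w : supp n X -> (forall i, (i < n)%N -> v i = w i) -> (X v <-> X w).
Proof. by move=> sX vw; split; apply: sX => // i /vw. Qed.

Lemma supp_not n X : supp n X -> supp n (fun v => ~ X v).
Proof. by move=> sX v w vw nX Xw; apply: nX; apply: sX Xw => i /vw. Qed.

Lemma sequence_params A (a : nat -> U) n (X : U -> Prop) :
  dE (A `|` relt @` initial a n) (fun v => X (v 0)) ->
  exists Phi, [/\ dE A Phi, supp n.+1 Phi & forall z, X z <-> Phi (scons z a)].
Proof.
move=> /pclass_params[Z [s [DZ sB h]]].
have idx (b : U) : exists j, initial a n b -> (j < n)%N /\ b = a j.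
  by have [[j jn ->]|nb] := pselect (initial a n b); [exists j|exists 0].
have [ix hix] := choice idx.
pose sg i := match s i with inl _ => 0 | inr b => (ix b).+1 end.
exists (fun v => Z (fun i => v (sg i))); split.
- exact: (d_reindex (dE_defclass A) sg DZ).
- move=> v w vw; rewrite (_ : (fun i => v (sg i)) = (fun i => w (sg i)))//.
  apply: funext => i; apply: vw; rewrite /sg; case si: (s i) => [//|b].
  by rewrite ltnS; exact: (hix _ (sB i b si)).1.
- move=> z; rewrite (h (fun=> z)).
  rewrite (_ : (fun i => ev (fun=> z) (s i)) = (fun i => scons z a (sg i)))//.
  apply: funext => i; rewrite /sg; case si: (s i) => [//|b] /=.
  exact: (hix _ (sB i b si)).2.
Qed.

End Imaginary_definability.

(** * Pairwise independence implies independence *)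

Section Triviality_of_R.
Context {L : signature unit} {M : structure L} {kappa : Type}.
Hypothesis mon : monster kappa M.
Local Notation U := (M tt).
Local Notation Meq := (eq_structure M).
Implicit Types (A : set (elt Meq)) (B : set U) (X : (nat -> U) -> Prop).
Local Notation small := (@smallU L M kappa).

Lemma small_reps A : Defs.small kappa A -> small (reps A).
Proof.
move=> sA; have [sL _ _] := mon.
apply: (small_le (B := reps A)); last exact: (small_seq_bigcup sL tt sA).
apply: card_le_trans (card_image_le (@to_elt _ _ M tt) (reps A)).
by apply: subset_card_le => c [u Au ->]; exists u.
Qed.

Hypothesis HR : condR (kappa := kappa) (M := M).
Context (lt : U -> U -> Prop) (G : @gorder L M kappa lt).
Hypothesis W : forall B (X : U -> Prop), dfn B (fun v => X (v 0)) -> locally_convex lt X.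

Let le x y := x = y \/ lt x y.
Let le_trans x y z : le x y -> le y z -> le x z.
Proof. by move=> [->//|xy] [<-|yz]; right=> //; exact: go_trans G _ _ _ xy yz. Qed.
Let le_total x y : le x y \/ lt y x.
Proof. by case: (go_total G x y) => h; [left; right|left; left|right]. Qed.

Context (A : set (elt Meq)) (a0 : U).
Hypothesis sA : Defs.small kappa A.

(** The type of [a0] over A, not an orbit: A may be imaginary, and conjugacy is established over
    real elements only. *)
Definition locus : set U := [set b | forall R : U -> Prop, dE A (fun v => R (v 0)) -> R a0 -> R b].
Local Notation P := locus.

Lemma locus_dE (R : U -> Prop) b c : dE A (fun v => R (v 0)) -> P b -> P c -> R b -> R c.
Proof.
move=> DR Pb Pc Rb; apply: (Pc R DR); apply: contrapT => nRa.
exact: (Pb (fun x => ~ R x) (d_not (dE_defclass A) DR) nRa).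
Qed.

Lemma locus_a0 : P a0. Proof. by []. Qed.

Local Notation eventually := (eventually P lt).

Lemma eventually_dec B (R : U -> Prop) : dfn B (fun v => R (v 0)) ->
  eventually R \/ eventually (fun z => ~ R z).
Proof.
move=> DR; have [n [C [th [Dth tha Ccvx RC]]]] := W DR a0.
have Pth z : P z -> th z by move=> Pz; apply: (Pz th) => //; apply: dfn_eq Dth.
apply: (eventually_or_not (R := lt) (P := P) (C := C) _ _ locus_a0) => [x y z|x y _ _|i x y z Cx Cz _|z /Pth].
- exact: (go_trans G).
- exact: (go_total G).
- exact: Ccvx Cx Cz.
- exact: RC.
Qed.

Lemma locus_saturation B (F : (U -> Prop) -> U -> Prop) : small B -> reps A `<=` B ->
  (forall S, dE A (fun v => S (v 0)) -> dfn B (fun v => F S (v 0))) ->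
  (forall S S' : U -> Prop, (forall x, S x -> S' x) -> forall x, F S x -> F S' x) ->
  (forall S, dE A (fun v => S (v 0)) -> S a0 -> exists x, F S x) ->
  exists x, forall S, dE A (fun v => S (v 0)) -> S a0 -> F S x.
Proof.
move=> sB AB FB Fmono Fne.
have [||||x hx] := @saturation _ _ _ mon B (fun R => exists S, [/\ dE A (fun v => S (v 0)), S a0 & R = F S]) sB.
- by exists (F (fun=> True)), (fun=> True); split=> //; exact: (d_True (dE_defclass A)).
- by move=> R [S [DS Sa ->]]; exact: FB.
- by move=> R [S [DS Sa ->]]; exact: Fne.
- move=> R R' [S [DS Sa ->]] [S' [DS' Sa' ->]].
  exists (F (fun x => S x /\ S' x)).
    by exists (fun x => S x /\ S' x); split=> //; exact: (d_and (dE_defclass A)).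
  by move=> x hx; split; apply: Fmono hx => y [].
by exists x => S DS Sa; apply: hx; exists S.
Qed.

(** By saturation, what holds at all points of the locus beyond u holds at all points beyond u of
    one formula of the type; statements about final parts become expressible. *)
Lemma bounded_formula B u (R : U -> Prop) : small B -> reps A `<=` B ->
  dfn B (fun v => R (v 0)) -> (forall z, P z -> le u z -> R z) ->
  exists th, [/\ dE A (fun v => th (v 0)), th a0 & forall z, th z -> le u z -> R z].
Proof.
move=> sB AB DR hu; apply: contrapT => nth.
have sBu := smallU_setU1 mon (a := u) sB.
have AB' : reps A `<=` B +: u by move=> x /AB; left.
have Dlt := lt_dfn G (B +: u).
have DR' : dfn (B +: u) (fun v => R (v 0)) by apply: dfn_sub DR => x; left.
have [|||z hz] := @locus_saturation (B +: u) (fun S z => S z /\ (u = z \/ lt u z) /\ ~ R z) sBu AB'.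
- move=> S /dE_reps/(dfn_sub AB') DS; ddfn.
- by move=> S S' SS' x [/SS' ? ?].
- move=> S DS Sa; apply: contrapT => nz; apply: nth; exists S; split=> // z Sz uz.
  by apply: contrapT => nRz; apply: nz; exists z.
have Pz : P z by move=> S DS Sa; have [] := hz S DS Sa.
by have [_ [uz]] := hz _ (d_True (dE_defclass A)) I; apply; exact: hu.
Qed.

Definition same n (x y : nat -> U) := forall Psi, dE A Psi -> supp n Psi -> (Psi x <-> Psi y).

Lemma same_eventually n x y Phi th : dE A Phi -> supp n.+1 Phi -> same n x y ->
  dE A (fun v => th (v 0)) ->
  (exists u, P u /\ forall z, th z -> le u z -> Phi (scons z x)) ->
  exists u, P u /\ forall z, th z -> le u z -> Phi (scons z y).
Proof.
move=> DPhi sPhi xy Dth [u0 [Pu0 hu0]].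
have HA := dE_defclass A.
have DltA : dE A (fun v => lt (v 0) (v 1)) by apply: (dfn_eq (B := set0)) (lt_dfn G _).
pose B := reps A `|` initial y n.
have AB : reps A `<=` B by left.
have sB : small B by apply: (small_setU_initial mon); exact: small_reps.
have DPhiy B' : B `<=` B' -> dfn B' (fun v => Phi (scons (v 0) (fun i => if (i < n)%N then y i else v 1))).
  move=> BB'; apply: (d_subst (dfn_defclass B') (t := fun i v => scons (v 0) (fun i => if (i < n)%N then y i else v 1) i)).
    by apply: dfn_sub (dE_reps DPhi) => z /AB/BB'.
  move=> [|i] /=; first exact: dterm_var (dfn_defclass _) 0.
  case ni : (i < n)%N; last exact: dterm_var (dfn_defclass _) 1.
  by apply: dfn_param; apply: BB'; right; exists i.
have PhiE z c : Phi (scons z (fun i => if (i < n)%N then y i else c)) <-> Phi (scons z y).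
  by apply: (suppE sPhi) => -[|i] //=; rewrite ltnS => ->.
have DPy : dfn B (fun v => Phi (scons (v 0) y)).
  by apply: d_ext (DPhiy B (fun _ => id)) => v; exact: PhiE.
have Dlt := lt_dfn G B.
have Dth' := dfn_sub AB (dE_reps Dth).
have [|||u hu] := @locus_saturation B (fun S u => S u /\ forall z, th z -> (u = z \/ lt u z) -> Phi (scons z y)) sB AB.
- move=> S /dE_reps/(dfn_sub AB) DS.
  apply: (d_and (dfn_defclass B)); first exact: DS.
  apply: (d_all (dfn_defclass B) (G := fun z v => th z -> (v 0 = z \/ lt (v 0) z) -> Phi (scons z y))).
  apply: (dc_imp (dfn_defclass B)); first exact: Dth'.
  apply: (dc_imp (dfn_defclass B)); last exact: DPy.
  by rewrite /shift /=; ddfn.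
- by move=> S S' SS' u [/SS' ? ?].
- move=> S DS Sa.
  pose Psi v := exists u, S u /\ forall z, th z -> (u = z \/ lt u z) -> Phi (scons z v).
  suff DP : dE A Psi.
    have sP : supp n Psi.
      move=> v w vw [u [Su hu]]; exists u; split=> // z tz uz.
      by apply: sPhi (hu z tz uz) => -[|i] //= ni; exact: vw.
    have Px : Psi x by exists u0; split=> //; exact: (Pu0 S).
    exact: (xy Psi DP sP).1 Px.
  apply: (d_ex HA (G := fun u v => S u /\ forall z, th z -> (u = z \/ lt u z) -> Phi (scons z v))).
  apply: (d_and HA); first exact: (d_reindex HA (fun=> 0) DS).
  apply: (d_all HA (G := fun z v => th z -> (v 0 = z \/ lt (v 0) z) -> Phi (scons z (shift 1 v)))).
  apply: (dc_imp HA); first exact: (d_reindex HA (fun=> 0) Dth).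
  apply: (dc_imp HA).
    apply: (d_or HA); first exact: (dc_eq HA 1 0).
    exact: (d_reindex HA (fun i => if i is 0 then 1 else 0) DltA).
  apply: d_ext (d_reindex HA (fun i => if i is i'.+1 then i'.+2 else 0) DPhi) => v.
  by rewrite (_ : (fun i => v (if i is i'.+1 then i'.+2 else 0)) = scons (v 0) (shift 1 (shift 1 v)))//; apply: funext => -[].
exists u; split; first by move=> S DS Sa; have [] := hu S DS Sa.
by move=> z tz uz; have [_] := hu _ (d_True HA) I; exact.
Qed.

(** The Morley condition at place j, for the type of [a0] over A. *)
Definition independent (x : nat -> U) j := forall Phi, dE A Phi -> supp j.+1 Phi ->
  eventually (fun z => Phi (scons z x)) -> Phi (scons (x j) x).

Lemma dfn_section B (x : nat -> U) n Phi : dE A Phi -> supp n.+1 Phi -> reps A `<=` B ->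
  initial x n `<=` B -> dfn B (fun v => Phi (scons (v 0) x)).
Proof.
move=> DPhi sPhi AB xB.
apply: d_ext (d_subst (dfn_defclass B) (t := fun i v => scons (v 0) (fun i => if (i < n)%N then x i else v 1) i)
   (dfn_sub AB (dE_reps DPhi)) _).
  by move=> v; apply: (suppE sPhi) => -[|i] //=; rewrite ltnS => ->.
move=> [|i] /=; first exact: dterm_var (dfn_defclass _) 0.
case ni : (i < n)%N; last exact: dterm_var (dfn_defclass _) 1.
by apply: dfn_param; apply: xB; exists i.
Qed.

Lemma small_section (x : nat -> U) n : small (reps A `|` initial x n).
Proof. by apply: (small_setU_initial mon); exact: small_reps. Qed.

Lemma eventually_bounded (x : nat -> U) n Phi : dE A Phi -> supp n.+1 Phi ->
  eventually (fun z => Phi (scons z x)) ->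
  exists th, [/\ dE A (fun v => th (v 0)), th a0 &
    exists u, P u /\ forall z, th z -> le u z -> Phi (scons z x)].
Proof.
move=> DPhi sPhi [u [Pu hu]].
have [|||th [Dth tha hth]] := @bounded_formula (reps A `|` initial x n) u (fun z => Phi (scons z x)) (small_section (x := x) (n := n)).
- by left.
- by apply: (dfn_section DPhi sPhi) => y; [left|right].
- exact: hu.
by exists th; split=> //; exists u.
Qed.

Lemma same_eventually' n x y Phi : dE A Phi -> supp n.+1 Phi -> same n x y ->
  eventually (fun z => Phi (scons z x)) -> eventually (fun z => Phi (scons z y)).
Proof.
move=> DPhi sPhi xy /(eventually_bounded DPhi sPhi)[th [Dth tha h]].
have [u [Pu hu]] := same_eventually DPhi sPhi xy Dth h.
by exists u; split=> // z Pz uz; apply: hu => //; exact: (Pz th).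
Qed.

(** A formula in z with the earlier terms as parameters is eventually true or eventually false, and
    which of the two depends on the type of these terms only. *)
Lemma independent_same n x y : (forall j, (j < n)%N -> independent x j) ->
  (forall j, (j < n)%N -> independent y j) -> same n x y.
Proof.
elim: n => [|n IH] hx hy.
  by move=> Psi _ sPsi; split; apply: sPsi.
have {}IH : same n x y by apply: IH => j jn; [apply: hx|apply: hy]; exact: ltnW.
suff one x' y' : (forall j, (j < n.+1)%N -> independent x' j) ->
  (forall j, (j < n.+1)%N -> independent y' j) -> same n x' y' ->
  forall Psi, dE A Psi -> supp n.+1 Psi -> Psi x' -> Psi y'.
  move=> Psi DPsi sPsi; split; first exact: one.
  by apply: one => // Psi' D' s'; apply: iff_sym; exact: IH.
move=> {}hx {}hy xy Psi DPsi sPsi Psix.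
pose sg i := if i == n then 0 else i.+1.
pose Phi v := Psi (fun i => v (sg i)).
have DPhi : dE A Phi by exact: (d_reindex (dE_defclass A) sg DPsi).
have sPhi : supp n.+1 Phi.
  move=> v w vw; apply: sPsi => i; rewrite ltnS leq_eqVlt => /orP[/eqP ->|ni].
    by apply: vw; rewrite /sg eqxx.
  by apply: vw; rewrite /sg; case: eqP => //; lia.
have PhiE (z : nat -> U) : Phi (scons (z n) z) <-> Psi z.
  apply: (suppE sPsi) => i _; rewrite /sg; by case: eqP => [->|].
have DR := dfn_section DPhi sPhi (B := reps A `|` initial x' n) (fun _ h => or_introl h) (fun _ h => or_intror h).
case: (@eventually_dec _ (fun z => Phi (scons z x')) DR) => ev.
  by apply/PhiE; apply: hy => //; exact: (same_eventually' DPhi sPhi xy ev).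
by have := hx n (ltnSn n) _ (d_not (dE_defclass A) DPhi) (supp_not sPhi) ev; rewrite PhiE.
Qed.

(** Asked over the representatives of A rather than over A itself: the stronger condition makes
    orbits over real elements available. *)
Lemma independent_exists n : exists y : nat -> U, forall j, (j < n)%N ->
  forall R : U -> Prop, dfn (reps A `|` initial y j) (fun v => R (v 0)) -> eventually R -> R (y j).
Proof.
elim: n => [|n [y hy]]; first by exists (fun=> a0).
have [||||u hu] := @saturation _ _ _ mon (reps A `|` initial y n)
  (fun R => dfn (reps A `|` initial y n) (fun v => R (v 0)) /\ eventually R) (small_section (x := y) (n := n)).
- exists (fun=> True); split; first exact: (d_True (dfn_defclass _)).
  by exists a0; split.
- by move=> R [].
- by move=> R [_ /(@eventually_ex _ P lt)[z []]]; exists z.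
- move=> R R' [DR eR] [DR' eR']; exists (fun z => R z /\ R' z) => //; split.
    exact: (d_and (dfn_defclass _)).
  exact: (eventually_and (go_trans G) (fun x y _ _ => go_total G x y)).
exists (upn y n u) => j; have ini k : (k <= n)%N -> initial (upn y n u) k = initial y k.
  move=> kn; apply/seteqP; split=> z [i ik ->]; exists i => //; rewrite /upn; case: eqP => //; lia.
rewrite ltnS => jn; rewrite ini//; move: jn; rewrite leq_eqVlt => /orP[/eqP ->|jn] R DR eR.
  by rewrite /upn eqxx; exact: (hu R).
by rewrite /upn ltn_eqF//; exact: hy.
Qed.

(* A failure of [Phi] is moved to a sequence [y] that is Morley up to [m] and a
   point [y'] above [y m].  The points below a failure form a semiinterval with
   minimum [y m]; by (R) it is given by a formula in [y m] only, and pairs suffice. *)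
Lemma independent_of_pairs (x : nat -> U) : (forall j, P (x j)) ->
  (forall i j, (i < j)%N -> forall Phi, dE A Phi -> supp 2 Phi ->
    eventually (fun z => Phi (scons z (fun=> x i))) -> Phi (scons (x j) (fun=> x i))) ->
  forall n, independent x n.
Proof.
move=> Px pairs; have HA := dE_defclass A.
have DltA : dE A (fun v => lt (v 0) (v 1)) by apply: (dfn_eq (B := set0)) (lt_dfn G _).
elim/ltn_ind => -[_|m IH] Phi DPhi sPhi ev.
  have [z [Pz hz]] := eventually_ex ev.
  have E (v : U) y : Phi (fun=> v) <-> Phi (scons v y).
    by apply: (suppE sPhi) => -[|i] //; rewrite ltnS.
  apply/E; apply: (@locus_dE (fun z => Phi (fun=> z)) z) => //; last exact: (E z x).2 hz.
  exact: (d_reindex HA (fun=> 0) DPhi).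
apply: contrapT => nPhi.
have [th [Dth tha hth]] := eventually_bounded DPhi sPhi ev.
have [y hy] := independent_exists m.+1.
have iy j : (j < m.+1)%N -> independent y j.
  move=> jm Psi DPsi sPsi; apply: (hy j jm (fun z => Psi (scons z y))).
  by apply: (dfn_section DPsi sPsi) => u; [left|right].
have xy : same m.+1 x y by apply: independent_same => // j jm; exact: IH.
have yx : same m.+1 y x by move=> Psi DPsi sPsi; apply: iff_sym; exact: xy.
have [u [Pu hu]] := same_eventually DPhi sPhi xy Dth hth.
pose ym := y m.
have [||||y' hy'] := @saturation _ _ _ mon (reps A `|` initial y m.+1)
  (fun R => exists Chi, [/\ dE A Chi, supp m.+2 Chi, Chi (scons (x m.+1) x) &
     R = fun z => Chi (scons z y)]) (small_section (x := y) (n := m.+1)).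
- by exists (fun=> True), (fun=> True); split=> //; exact: (d_True HA).
- move=> R [Chi [DChi sChi _ ->]].
  by apply: (dfn_section DChi sChi) => z; [left|right].
- move=> R [Chi [DChi sChi hChi ->]].
  pose Psi v := exists z, Chi (scons z v).
  have DPsi : dE A Psi.
    apply: (d_ex HA (G := fun z v => Chi (scons z v))).
    apply: d_ext DChi => v; rewrite (_ : scons (v 0) (shift 1 v) = v)//.
    by apply: funext => -[].
  have sPsi : supp m.+1 Psi.
    by move=> v w vw [z hz]; exists z; apply: sChi hz => -[|i] //= im; exact: vw.
  have Psix : Psi x by exists (x m.+1).
  exact: (xy Psi DPsi sPsi).1 Psix.
- move=> R R' [Chi [DChi sChi hChi ->]] [Chi' [DChi' sChi' hChi' ->]].
  exists (fun z => Chi (scons z y) /\ Chi' (scons z y)) => //.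
  exists (fun v => Chi v /\ Chi' v); split=> //; first exact: (d_and HA).
  by move=> v w vw [? ?]; split; [exact: sChi vw _|exact: sChi' vw _].
have tr Chi : dE A Chi -> supp m.+2 Chi -> Chi (scons (x m.+1) x) -> Chi (scons y' y).
  by move=> DChi sChi hChi; apply: (hy' (fun z => Chi (scons z y))); exists Chi.
have Py' : P y'.
  move=> R DR Ra; apply: (tr (fun v => R (v 0))) => //; last exact: (Px m.+1).
  by move=> v w vw; rewrite vw.
have Pym : P ym.
  move=> R DR Ra; apply: (hy m (ltnSn m) R); first by apply: dfn_sub (dE_reps DR); left.
  by exists a0; split=> // z Pz _; exact: (Pz R).
have nPhi' : ~ Phi (scons y' y).
  apply: (tr (fun v => ~ Phi v)) => //; [exact: (d_not HA)|exact: supp_not].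
have thy' : th y' by exact: (Py' th).
(* The pair (y m, y') inherits the hypothesis on pairs, because y and y' together have the same type
   over A as the terms of x. *)
have right psi : dE A (fun v => psi (v 0) (v 1)) -> eventually (fun z => psi z ym) -> psi y' ym.
  move=> Dpsi evy.
  have Dpsi' : dE A (fun v => psi (v 0) (v m.+1)).
    exact: (d_reindex HA (fun i => if i is 0 then 0 else m.+1) Dpsi).
  have spsi' : supp m.+2 (fun v => psi (v 0) (v m.+1)) by move=> v w vw; rewrite !vw.
  apply: (tr (fun v => psi (v 0) (v m.+1))) => //.
  apply: (pairs m m.+1 (ltnSn m) (fun v => psi (v 0) (v 1))) => //.
    by move=> v w vw; rewrite !vw.
  exact: (@same_eventually' m.+1 y x (fun v => psi (v 0) (v m.+1))).
have le_ym : le ym y'.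
  apply: (right (fun z t => t = z \/ lt t z)); last by exists ym; split.
  apply: (d_or HA); first exact: (dc_eq HA 1 0).
  exact: (d_reindex HA (fun i => if i is 0 then 1 else 0) DltA).
pose B := reps A `|` initial y m.
have sB : small B by exact: small_section.
have AB : reps A `<=` B by left.
have eB : initial y m.+1 = initial y m +: ym by exact: initialS.
(* If R holds at [ym], then R holds eventually. That R holds from t on, throughout [thR], is
   therefore an eventual property of t over B, and independence gives it at [ym]. *)
have orbit z : P z -> lt ym z -> eqv B ym z.
  move=> Pz ymz; apply: (type_orbit mon sB) => R DR Rym.
  case: (eventually_dec DR) => [[w [Pw hw]]|ev']; last first.
    by have := hy m (ltnSn m) _ (d_not (dfn_defclass _) DR) ev'.
  have [thR [DthR thRa hthR]] := bounded_formula sB AB DR hw.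
  have DthR' := dfn_sub AB (dE_reps DthR); have DltB := lt_dfn G B.
  apply: (hy m (ltnSn m) (fun t => forall z, thR z -> t = z \/ lt t z -> R z)) => //.
  - by ddfn.
  - exists w; split=> // t Pt wt z' tz' tz; apply: hthR => //; exact: le_trans wt tz.
  - exact: (Pz thR).
  - by right.
(* If y' = ym, then [ym] is the last point of the locus, since a point above it would by [right] put
   y' strictly above [ym]; so the bound u is not above y', and Phi holds there. *)
case: le_ym => [e|ymy'].
  have nab z : P z -> ~ lt ym z.
    move=> Pz ymz.
    have : lt ym y'.
      apply: (right (fun z t => lt t z)).
        exact: (d_reindex HA (fun i => if i is 0 then 1 else 0) DltA).
      by exists z; split=> // w _; case=> [<-//|]; exact: go_trans G _ _ _ ymz.
    by rewrite e; exact: (go_irr G).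
  apply: nPhi'; apply: hu => //; case: (le_total u y') => // y'u.
  by case: (nab u Pu); rewrite e.
(* Restricting the failures to [th] makes this set definable, and no failure is left beyond u. *)
pose S0 z := exists w, (z = w \/ lt z w) /\ th w /\ ~ Phi (scons w y).
have DS0 : dfn (B +: ym) (fun v => S0 (v 0)).
  have Dlt := lt_dfn G (B +: ym).
  have Dth' : dfn (B +: ym) (fun v => th (v 0)).
    by apply: dfn_sub (dE_reps Dth) => z /AB; left.
  have DPhi' : dfn (B +: ym) (fun v => Phi (scons (v 0) y)).
    apply: (dfn_section DPhi sPhi) => z; first by move=> /AB; left.
    by rewrite eB => -[]; [left; right|right].
  apply: (d_ex (dfn_defclass _) (G := fun w v => (v 0 = w \/ lt (v 0) w) /\ th w /\ ~ Phi (scons w y))).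
  apply: (d_and (dfn_defclass _)); first by rewrite /shift /=; ddfn.
  apply: (d_and (dfn_defclass _)); first exact: Dth'.
  exact: (d_not (dfn_defclass _)).
have S0ym : S0 ym by exists y'; split=> //; right.
have [|E [DE EE hE]] := go_simple G sB DS0 S0ym.
  move=> z z' _ _ [w [z'w hw]] _ zz'; exists w; split=> //; right.
  by case: z'w => [<-//|]; exact: go_trans G _ _ _ zz'.
have [psi [Dpsi hpsi]] := HR sB DE EE.
have Dpsi' : dE A (fun v => ~ psi (v 1) (v 0)).
  have DpsiA : dE A (fun v => psi (v 0) (v 1)) by apply: (dfn_eq (B := set0)) Dpsi.
  exact: (d_not HA (d_reindex HA (fun i => if i is 0 then 1 else 0) DpsiA)).
suff : ~ psi ym y'.
  apply; apply/hpsi; [exact: eqv_refl|exact: orbit|].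
  by apply/hE; [exact: orbit|by []|exists y'; split=> //; left].
apply: (right (fun z t => ~ psi t z)) => //.
have [w [Pw uw y'w]] : exists w, [/\ P w, le u w & le y' w].
  by case: (le_total u y') => h; [exists y'; split=> //; left|exists u; split=> //; [left|right]].
exists w; split=> // z Pz wz.
have ymz : lt ym z.
  have [<-|y'z] := le_trans y'w wz; first exact: ymy'.
  exact: go_trans G _ _ _ ymy' y'z.
move=> /hpsi h; have /hE[|//|w' [zw' [tw' nw']]] := h (eqv_refl _ _) (orbit z Pz ymz).
  exact: orbit.
by apply: nw'; apply: hu => //; exact: le_trans (le_trans uw wz) zw'.
Qed.

End Triviality_of_R.

Section R_to_triviality.
Context {L : signature unit} {M : structure L} {kappa : Type}.
Hypothesis mon : monster kappa M.
Local Notation U := (M tt).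
Local Notation Meq := (eq_structure M).
Hypothesis HR : condR (kappa := kappa) (M := M).
Context (lt : U -> U -> Prop) (G : @gorder L M kappa lt).
Hypothesis W : forall B (X : U -> Prop), dfn B (fun v => X (v 0)) -> locally_convex lt X.

Lemma wom_pair_eq (A : set (elt Meq)) p (P : set U) : complete_type A (Real M tt) p ->
  P = (realizations p : set (Meq (Real M tt))) -> weakly_o_minimal_pair A p (fun x y : Meq (Real M tt) => [/\ lt x y, P x & P y]).
Proof.
move=> pc PE; split=> //; rewrite -PE.
- split.
  + by move=> x y [].
  + by move=> x [/(go_irr G)].
  + by move=> x y z [xy Px Py] [yz _ Pz]; split=> //; exact: (go_trans G xy yz).
  + move=> x y Px Py; case: (go_total G x y) => h; first by apply: Or31.
      exact: Or32.
    exact: Or33.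
- apply/(@rel_binary_dfc _ _ Meq (Real M tt)); exists lt; split=> //.
  by apply: (dfn_eq (B := set0)) (lt_dfn G _).
- move=> B X /(@rel_unary_dfc _ _ Meq (Real M tt))[Y [DY ->]].
  apply: (trace_convex (M := M)); last exact: W (dE_reps DY).
  move=> R DR; have [[a Pa]|nP] := pselect (exists a, P a); last by left=> b Pb; case: nP; exists b.
  have DRA : @dfc _ _ Meq (Real M tt) A (fun v => R (v 0)) by apply: (dfn_eq (B := set0)) DR.
  move: Pa PE => /[swap] -> Pa; rewrite (complete_tp pc Pa).
  have [Ra|nRa] := pselect (R a); [left|right] => b /realizations_tp h; first exact: h Ra.
  exact: (h (fun x => ~ R x) (d_not (@dfc_defclass _ _ Meq (Real M tt) A) DRA) nRa).
Qed.

Lemma trivial_of_R : all_real_types_trivial M kappa.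
Proof.
move=> A p sA pc; pose P : set U := (realizations p : set (Meq (Real M tt))).
have wom := wom_pair_eq pc (erefl P); have [_ lin _ _] := wom.
exists (fun x y => [/\ lt x y, P x & P y]); split=> //.
move=> a Pa right i phi [[iv hF] o].
have HA := @dE_defclass _ M A.
have PE : locus A (a 0) = P.
  rewrite /P (complete_tp pc (Pa 0)); apply/seteqP; split=> b.
    by move=> Pb; apply/realizations_tp => X DX; exact: Pb.
  by move=> /realizations_tp h R DR; exact: h.
have [Phi [DPhi sPhi hPhi]] : exists Phi, [/\ dE A Phi, supp i.+1 Phi &
    forall z, pholds1 phi z <-> Phi (scons z a)].
  apply: sequence_params; apply: (@pholds1_dfc _ _ Meq (Real M tt)) => //.
  apply: over_sub o => c [Ac|[j ji ->]]; first by left.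
  by right; exists (a j) => //; exists j.
have ind : independent lt A (a 0) a i.
  apply: (independent_of_pairs mon HR G W sA).
    by move=> j; rewrite -/(locus A (a 0)) PE; exact: Pa.
  move=> k j kj Psi DPsi sPsi ev.
  pose X z := Psi (scons z (fun=> a k)).
  have DX : dE (A `|` [set relt (a k)]) (fun v => X (v 0)).
    apply: (d_subst (dE_defclass _) (t := fun i v => scons (v 0) (fun=> a k) i)).
      by apply: dfc_sub DPsi; left.
    move=> [|n] /=; first exact: dterm_var (dE_defclass _) 0.
    by apply: (@dfc_param _ _ Meq (Real M tt)); right.
  have [psi [opsi ivpsi hpsi]] := @dfc_pholds1 _ _ Meq (Real M tt) _ X DX.
  apply/hpsi; apply: (right k j kj psi); split=> //; split=> //.
  have [u [Pu hu]] := ev.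
  apply/(final_partP (@pholds1 _ _ Meq (Real M tt) psi) lin); exists u; split; first by rewrite -/P -PE.
  move=> z Pz uz; apply/hpsi; apply: hu; first by rewrite -/(locus A (a 0) z) PE.
  by case: uz => [->|[]]; [left|right].
apply/hPhi; apply: ind => //.
have [u [Pu hu]] := (final_partP (@pholds1 _ _ Meq (Real M tt) phi) lin).1 hF.
exists u; split; first by rewrite -/(locus A (a 0) u) PE.
move=> z; rewrite -/(locus A (a 0) z) PE => Pz uz; apply/hPhi; apply: hu => //.
by case: uz => [->|uz]; [left|right].
Qed.

End R_to_triviality.

(** * Relatively definable equivalence relations on an orbit *)

Section Orbit_equivalences.
Context {L : signature unit} {M : structure L} {kappa : Type}.
Hypothesis mon : monster kappa M.
Local Notation U := (M tt).
Implicit Types (B : set U) (X R : U -> Prop) (E : U -> U -> Prop).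
Local Notation small := (@smallU L M kappa).
Local Notation dfn2 B E := (dfn B (fun v => E (v 0) (v 1))).

Definition sub_on B a E E' := forall x y : U, eqv B a x -> eqv B a y -> E x y -> E' x y.

(** Saturation is used twice, for y and then for z over y: if every formula of the type contained a
    pair in R, so would the type. *)
Lemma type_pairs B C a (R : U -> U -> Prop) : small C -> B `<=` C -> dfn2 C R ->
  (forall y z, eqv B a y -> eqv B a z -> ~ R y z) ->
  exists th, [/\ dfn B (fun v => th (v 0)), th a & forall y z, th y -> th z -> ~ R y z].
Proof.
move=> sC BC DR nR; apply: contrapT => h.
have sB : small B by apply: small_sub sC; exact: els_sub.
have [||S DS Sa|y hy] := @type_saturation _ _ _ mon B C a (fun S y => S y /\ exists z, S z /\ R y z) sC.
- move=> S /(dfn_sub BC) DS; ddfn.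
- by move=> S S' SS' y [Sy [z [Sz Ryz]]]; split; [exact: SS'|exists z; split=> //; exact: SS'].
- apply: contrapT => nS; apply: h; exists S; split=> // y z Sy Sz Ryz; apply: nS.
  by exists y; split=> //; exists z.
have CCy : C `<=` C +: y by move=> x; left.
have [||S DS Sa|z hz] := @type_saturation _ _ _ mon B (C +: y) a (fun S z => S z /\ R y z) (smallU_setU1 mon sC).
- have DR' : dfn2 (C +: y) R by exact: dfn_sub DR.
  by move=> S /(dfn_sub BC) /(dfn_sub CCy) DS; ddfn.
- by move=> S S' SS' z [/SS'].
- by have [_ [z hz]] := hy S DS Sa; exists z.
apply: (nR y z).
- by apply: (type_orbit mon) => // S DS Sa; have [] := hy S DS Sa.
- by apply: (type_orbit mon) => // S DS Sa; have [] := hz S DS Sa.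
- by have [] := hz _ (d_True (dfn_defclass B)) I.
Qed.

Lemma ER_base B a b E : eqv B a b -> ER B b E -> ER B a E.
Proof.
move=> ab [Er Es Et]; have ba := eqv_sym ab; split.
- by move=> x /(eqv_trans ba); exact: Er.
- by move=> x y /(eqv_trans ba) ? /(eqv_trans ba) ?; exact: Es.
- by move=> x y z /(eqv_trans ba) ? /(eqv_trans ba) ? /(eqv_trans ba) ?; exact: (Et x y z).
Qed.

Lemma ER_mono B B' a E : B `<=` B' -> ER B a E -> ER B' a E.
Proof.
move=> BB' [Er Es Et]; split.
- by move=> x /(eqv_sub BB'); exact: Er.
- by move=> x y /(eqv_sub BB') ? /(eqv_sub BB') ?; exact: Es.
- by move=> x y z /(eqv_sub BB') ? /(eqv_sub BB') ? /(eqv_sub BB') ?; exact: (Et x y z).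
Qed.

Section Ordered.
Context (lt : U -> U -> Prop) (G : @gorder L M kappa lt).

(** The class of x has finitely many convex pieces. Choose u in it that is not above the chosen
    points [f i], one in each piece that meets the class within the orbit: below u the class has no
    gaps, as every piece entered reaches u. An automorphism taking z to u carries this to the given
    points. *)
Lemma ER_convex B a E x y z : dfn2 B E -> ER B a E ->
  eqv B a x -> eqv B a y -> eqv B a z -> lt x y -> lt y z -> E x z -> E x y.
Proof.
move=> DE [Er Es Et] ax ay az xy yz xz.
have DX : dfn (B +: x) (fun v => E x (v 0)).
  by have DE' : dfn2 (B +: x) E; [apply: dfn_sub DE; left|ddfn].
have [n [C [th [Dth thx Ccv XC]]]] := go_wqo G x DX.
have tha w : eqv B a w -> th w.
  move=> aw; have e : eqv set0 x w by exact: eqv0 (eqv_trans (eqv_sym ax) aw).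
  by rewrite -(eqv_dfn e Dth).
pose P' : set U := [set w | eqv B a w /\ E x w].
have pick i : exists w, P' w /\ ((exists w', P' w' /\ C i w') -> C i w).
  have [[w [Pw Cw]]|nw] := pselect (exists w', P' w' /\ C i w'); first by exists w.
  by exists x; split=> //; split=> //; exact: Er.
have [f hf] := choice pick.
have [|x1 y1 _ _|||u [[au xu] hu]] := @finite_upper U P' (fun x y => lt y x) _ _ x n f.
- by move=> x1 y1 z1 h h'; exact: (go_trans G h' h).
- by case: (go_total G x1 y1) => h; [exact: Or33|exact: Or32|exact: Or31].
- by split=> //; exact: Er.
- by move=> i; exact: (hf i).1.
have T w m : eqv B a w -> eqv B a m -> lt w m -> lt m u -> E w u -> E m u.
  move=> aw am wm mu wu.
  have xw : E x w by apply: (Et x u w) => //; exact: Es.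
  have [i Ciw] := (XC w (tha w aw)).1 xw.
  have Cif : C i (f i) by apply: (hf i).2; exists w.
  have mf : lt m (f i) by case: (hu i) => [->//|uf]; exact: (go_trans G mu uf).
  have xm : E x m by apply/(XC m (tha m am)); exists i; exact: (Ccv i _ _ _ Ciw Cif wm mf).
  by apply: (Et m x u) => //; exact: Es.
have [g [ag gz]] : eqv B z u by exact: eqv_trans (eqv_sym az) au.
have orb w : eqv B a w -> eqv B a (g w) by move=> aw; apply: (eqv_trans aw); exists g.
have yz' : E y z.
  apply/(ER_aut _ _ DE ag); rewrite gz; apply: (T (g x)) => //; try exact: orb.
  - exact/(aut_lt G x y ag).
  - by rewrite -gz; exact/(aut_lt G y z ag).
  - by rewrite -gz; exact/(ER_aut x z DE ag).
by apply: (Et x z y) => //; exact: Es.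
Qed.

Lemma ER_split B a E E' : dfn2 B E -> dfn2 B E' -> ER B a E -> ER B a E' ->
  ~ sub_on B a E E' -> exists z, [/\ eqv B a z, lt a z, E a z & ~ E' a z].
Proof.
move=> DE DE' [Er Es Et] [Er' Es' Et'] nsub.
have [x [y [ax ay xy nxy]]] : exists x y, [/\ eqv B a x, eqv B a y, E x y & ~ E' x y].
  apply: contrapT => h; apply: nsub => x y ax ay xy; apply: contrapT => nxy.
  by apply: h; exists x, y.
wlog lxy : x y ax ay xy nxy / lt x y.
  move=> hw; case: (go_total G x y) => h; first exact: (hw x y).
    by case: nxy; rewrite -h; exact: Er'.
  by apply: (hw y x) => //; [exact: Es|move=> /(Es' _ _ ay ax)].
have [g [ag gx]] := eqv_sym ax; exists (g y); split.
- by apply: eqv_trans ay _; exists g.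
- by rewrite -gx; exact/(aut_lt G x y ag).
- by rewrite -gx; exact/(ER_aut x y DE ag).
- by rewrite -gx => h; apply: nxy; apply/(ER_aut x y DE' ag).
Qed.

Lemma ER_total B a E E' : dfn2 B E -> dfn2 B E' -> ER B a E -> ER B a E' ->
  sub_on B a E E' \/ sub_on B a E' E.
Proof.
move=> DE DE' EE EE'; apply: contrapT => /not_orP[n n'].
have [y [ay ly Ey nEy]] := ER_split DE DE' EE EE' n.
have [z [az lz Ez nEz]] := ER_split DE' DE EE' EE n'.
have aa := eqv_refl B a.
case: (go_total G y z) => h.
- exact: nEy (ER_convex DE' EE' aa ay az ly h Ez).
- by apply: nEy; rewrite h.
- exact: nEz (ER_convex DE EE aa az ay lz h Ey).
Qed.

Lemma sub_on_formula B a E E' : small B -> dfn2 B E -> dfn2 B E' -> sub_on B a E E' ->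
  exists th, [/\ dfn B (fun v => th (v 0)), th a & forall z, th z -> E a z -> E' a z].
Proof.
move=> sB DE DE' sub; have Ba : B `<=` B +: a by move=> x; left.
have [|y z _ az [Ez nEz]|th [Dth tha hth]] := @type_pairs B (B +: a) a
    (fun _ z => E a z /\ ~ E' a z) (smallU_setU1 mon sB) Ba.
- by move: DE DE' => /(dfn_sub Ba) DE /(dfn_sub Ba) DE'; ddfn.
- exact: nEz (sub _ _ (eqv_refl B a) az Ez).
by exists th; split=> // z tz Ez; apply: contrapT => nEz; exact: (hth z z tz tz).
Qed.

(** Each family is a chain on the orbit by [ER_total], so two conditions reduce to the smaller
    relation in F and the larger one in F'. These inclusions hold on the orbit only;
    [sub_on_formula] turns them into inclusions on a formula, as directedness requires. *)
Lemma ER_gap B a (F F' : (U -> U -> Prop) -> Prop) : small B ->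
  (exists E, F E) -> (exists E, F' E) ->
  (forall E, F E -> dfn2 B E /\ ER B a E) -> (forall E, F' E -> dfn2 B E /\ ER B a E) ->
  (forall E E', F E -> F' E' -> ~ sub_on B a E E') ->
  exists z, [/\ eqv B a z, lt a z, forall E, F E -> E a z & forall E, F' E -> ~ E a z].
Proof.
move=> sB [E0 F0] [E0' F0'] FP FP' FF'.
have sub_refl E : sub_on B a E E by [].
pose fam (S : U -> Prop) (E E' : U -> U -> Prop) z := S z /\ lt a z /\ E a z /\ ~ E' a z.
pose H (R : U -> Prop) := exists S E E', [/\ dfn B (fun v => S (v 0)), S a, F E, F' E' & R = fam S E E'].
have DT := d_True (dfn_defclass B).
have [|||R R' [S [E [E' [DS Sa FE FE' ->]]]] [S1 [E1 [E1' [DS1 Sa1 FE1 FE1' ->]]]]|z hz] :=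
    @saturation _ _ _ mon (B +: a) H (smallU_setU1 mon sB).
- by exists (fam (fun=> True) E0 E0'), (fun=> True), E0, E0'.
- have Ba : B `<=` B +: a by move=> x; left.
  move=> R [S [E [E' [DS Sa /FP[DE _] /FP'[DE' _] ->]]]].
  have Dlt := lt_dfn G (B +: a).
  by move: DS DE DE' => /(dfn_sub Ba) DS /(dfn_sub Ba) DE /(dfn_sub Ba) DE'; rewrite /fam; ddfn.
- move=> R [S [E [E' [DS Sa FE FE' ->]]]].
  have [DE EE] := FP E FE; have [DE' EE'] := FP' E' FE'.
  have [z [az lz Ez nEz]] := ER_split DE DE' EE EE' (FF' _ _ FE FE').
  by exists z; split=> //; rewrite -(eqv_dfn az DS).
- have [DE EE] := FP E FE; have [DE' EE'] := FP' E' FE'.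
  have [DE1 EE1] := FP E1 FE1; have [DE1' EE1'] := FP' E1' FE1'.
  have [D [FD DD sD sD1]] : exists D, [/\ F D, dfn2 B D, sub_on B a D E & sub_on B a D E1].
    by case: (ER_total DE DE1 EE EE1) => h; [exists E|exists E1].
  have [D' [FD' DD' sD' sD1']] : exists D', [/\ F' D', dfn2 B D', sub_on B a E' D' & sub_on B a E1' D'].
    by case: (ER_total DE' DE1' EE' EE1') => h; [exists E1'|exists E'].
  have [t1 [Dt1 ta1 h1]] := sub_on_formula sB DD DE sD.
  have [t2 [Dt2 ta2 h2]] := sub_on_formula sB DD DE1 sD1.
  have [t3 [Dt3 ta3 h3]] := sub_on_formula sB DE' DD' sD'.
  have [t4 [Dt4 ta4 h4]] := sub_on_formula sB DE1' DD' sD1'.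
  pose S2 z := S z /\ S1 z /\ t1 z /\ t2 z /\ t3 z /\ t4 z.
  exists (fam S2 D D'); first by exists S2, D, D'; split=> //; rewrite /S2; ddfn.
  move=> z [[Sz [S1z [z1 [z2 [z3 z4]]]]] [lz [Dz nDz]]]; split; split=> //; split=> //; split.
  + exact: h1.
  + by move=> /(h3 z z3).
  + exact: h2.
  + by move=> /(h4 z z4).
exists z; split.
- apply: (type_orbit mon sB) => S DS Sa.
  by have [] := hz (fam S E0 E0') (ex_intro _ S (ex_intro _ E0 (ex_intro _ E0' (And5 DS Sa F0 F0' erefl)))).
- by have [_ []] := hz (fam (fun=> True) E0 E0') (ex_intro _ _ (ex_intro _ E0 (ex_intro _ E0' (And5 DT I F0 F0' erefl)))).
- move=> E FE.
  by have [_ [_ []]] := hz (fam (fun=> True) E E0') (ex_intro _ _ (ex_intro _ E (ex_intro _ E0' (And5 DT I FE F0' erefl)))).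
- move=> E' FE'.
  by have [_ [_ []]] := hz (fam (fun=> True) E0 E') (ex_intro _ _ (ex_intro _ E0 (ex_intro _ E' (And5 DT I F0 FE' erefl)))).
Qed.

(* By saturation the classes are already convex on a formula [th] in the type
   of [a]; the parameters of [E] and [th] then suffice to apply simplicity. *)
Lemma ER_finite_params B a E : small B -> dfn2 B E -> ER B a E ->
  exists (l : seq {classic U}) (E' : U -> U -> Prop),
    [/\ forall b : {classic U}, b \in l -> B b,
        dfn2 [set b | (b : {classic U}) \in l] E',
        ER [set b | (b : {classic U}) \in l] a E'
      & forall x y, eqv B a x -> eqv B a y -> (E x y <-> E' x y)].
Proof.
move=> sB DE EE; have [Er Es Et] := EE.
have sBa := smallU_setU1 mon (a := a) sB.
have aa := eqv_refl B a.
have [th [Dth tha hth]] : exists th, [/\ dfn B (fun v => th (v 0)), th a &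
    forall y z, th y -> th z -> lt a z -> lt z y -> E a y -> E a z].
  have Dlt := lt_dfn G (B +: a).
  have DEa : dfn2 (B +: a) E by apply: dfn_sub DE; left.
  have [|||th [Dth tha hth]] := @type_pairs B (B +: a) a
      (fun y z => lt a z /\ lt z y /\ E a y /\ ~ E a z) sBa.
  - by move=> x; left.
  - by ddfn.
  - by move=> y z ay az [lz [zy [Ey nEz]]]; exact: nEz (ER_convex DE EE aa az ay lz zy Ey).
  exists th; split=> // y z ty tz lz zy Ey; apply: contrapT => nEz.
  by apply: (hth y z ty tz).
have [l [lB Dl]] := dfn_finite DE.
have [l' [lB' Dl']] := dfn_finite Dth.
pose l2 : seq {classic U} := l ++ l'; pose B2 : set U := [set b | (b : {classic U}) \in l2].
have B2B : B2 `<=` B by move=> b; rewrite /B2 /= mem_cat => /orP[/lB|/lB'].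
have DE2 : dfn2 B2 E by apply: dfn_sub Dl => b /= bl; rewrite /B2 /= mem_cat bl.
have Dth2 : dfn B2 (fun v => th (v 0)) by apply: dfn_sub Dl' => b /= bl; rewrite /B2 /= mem_cat bl orbT.
have B2a : B2 `<=` B2 +: a by move=> b; left.
have Dlt := lt_dfn G (B2 +: a).
have Ea : E a a by exact: Er.
(* Quantifying over all points of [th] between [a] and w makes the set initial outright; the orbit
   over [B2] may be larger than that over B, and the classes of E need not be convex there. *)
have [||x y _ _ hy ax xy z tz ll|E' [DE' EE' hE']] := @go_simple _ _ _ _ G B2 a
    (fun w => forall z, th z -> (a = z \/ lt a z) /\ (z = w \/ lt z w) -> E a z) (smallU_seq (l := l2) mon).
- move: DE2 => /(dfn_sub B2a) DE2; move: Dth2 => /(dfn_sub B2a) Dth2; ddfn.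
- move=> z tz [[<-//|az] [->//|za]]; by case: (go_irr G (go_trans G az za)).
- apply: hy => //; split; first exact: ll.1.
  by right; case: ll.2 => [->//|zx]; exact: (go_trans G zx xy).
exists l2, E'; split=> //.
have EE2 := ER_mono B2B EE'.
have tha' w : eqv B a w -> th w by move=> aw; rewrite -(eqv_dfn aw Dth).
have main w : eqv B a w -> lt a w -> (E a w <-> E' a w).
  move=> aw law; rewrite -hE'//; last exact: eqv_sub aw.
  split=> [Ew z tz [[<-//|az] [->//|zw]]|]; first exact: (hth w z (tha' w aw) tz az zw Ew).
  by apply; [exact: tha'|split; [right|left]].
have DE'B : dfn2 B E' by exact: dfn_sub DE'.
have s1 : sub_on B a E E'.
  apply: contrapT => /(ER_split DE DE'B EE EE2)[z [az lz Ez nEz]].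
  exact: nEz ((main z az lz).1 Ez).
have s2 : sub_on B a E' E.
  apply: contrapT => /(ER_split DE'B DE EE2 EE)[z [az lz Ez nEz]].
  exact: nEz ((main z az lz).2 Ez).
by move=> x y ax ay; split; [exact: s1|exact: s2].
Qed.

End Ordered.

End Orbit_equivalences.

(** * From triviality to condition (R) *)

Section Codes.
Context {L : signature unit} {M : structure L} {kappa : Type}.
Hypothesis mon : monster kappa M.
Local Notation U := (M tt).
Implicit Types (B : set U) (X : (nat -> U) -> Prop) (E : U -> U -> Prop).
Local Notation small := (@smallU L M kappa).
Local Notation dfn2 B E := (dfn B (fun v => E (v 0) (v 1))).
Context (b : nat -> U) (k : nat).
Local Notation B := (initial b k).

(** A sort comes from a 0-definable relation, so the parameters of B are part of the tuple that is
    coded. Only the first k + 1 entries matter. *)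
Definition with_base (y : U) : nat -> U := fun i =>
  if i is j.+1 then if (j < k)%N then b j else y else y.

Definition code_eq (d : eq_def M) (x y : U) :=
  abs (Imag d) (with_base x) = abs (Imag d) (with_base y).

Lemma code_eq_dfn d : dfn2 B (code_eq d).
Proof.
have HD := @dfn_defclass _ M B.
have h := d_abs_eq HD (@dfn0_dfn _ M B) (Imag d) double (fun i => i.*2.+1).
pose t i (v : nat -> U) := if odd i then with_base (v 1) i./2 else with_base (v 0) i./2.
have dt j i : dterm (D := dfn B) (fun v => with_base (v j) i).
  case: i => [|i] /=; first exact: (dterm_var HD).
  case ik : (i < k)%N; last exact: (dterm_var HD).
  by apply: dfn_param; exists i.
apply: d_ext (d_subst HD (t := t) h _) => [v|i]; last by rewrite /t; case: (odd i); exact: dt.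
rewrite /t /code_eq (_ : (fun i => if odd i.*2 then _ else _) = with_base (v 0)); last first.
  by apply: funext => i; rewrite odd_double doubleK.
rewrite (_ : (fun i => if odd i.*2.+1 then _ else _) = with_base (v 1))//.
by apply: funext => i; rewrite /= odd_double /= uphalf_double.
Qed.

Lemma code_eq_ER a d : ER B a (code_eq d).
Proof. by split=> [x|x y|x y z]; rewrite /code_eq// => _ _ _ -> ->. Qed.

Lemma with_base_aut g y : aut B g -> (fun i => g (with_base y i)) = with_base (g y).
Proof.
move=> ag; apply: funext => -[|i] //=; case ik : (i < k)%N => //.
by apply: (aut_fix ag); exists i.
Qed.

Lemma base_formula (R : U -> U -> Prop) : dfn2 B R ->
  exists Phi, [/\ @dfn0 _ M Phi, supp k.+2 Phi & forall x y, R x y <-> Phi (scons x (with_base y))].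
Proof.
move=> [Z [s [DZ sB h]]].
have idx (u : U) : exists j, B u -> (j < k)%N /\ u = b j.
  by have [[j jn ->]|nb] := pselect (B u); [exists j|exists 0].
have [ix hix] := choice idx.
pose sg i := match s i with inl m => if m is 0 then 0 else 1 | inr u => (ix u).+2 end.
exists (fun v => Z (fun i => v (sg i))); split.
- exact: (d_reindex (@dfn0_defclass _ M) sg DZ).
- move=> v w vw; rewrite (_ : (fun i => v (sg i)) = (fun i => w (sg i)))//.
  apply: funext => i; apply: vw; rewrite /sg; case si: (s i) => [[|m]|u] //.
  by rewrite !ltnS; exact: (hix _ (sB i u si)).1.
- move=> x y; rewrite (h (fun i => if i is 0 then x else y)).
  rewrite (_ : (fun i => ev _ (s i)) = (fun i => scons x (with_base y) (sg i)))//.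
  apply: funext => i; rewrite /sg; case si: (s i) => [[|m]|u] //=.
  by have [ik ue] := hix _ (sB i u si); rewrite ik -ue.
Qed.

(* Two tuples are identified when they define the same set by means of [Phi]. *)
Lemma set_code (Phi : (nat -> U) -> Prop) : @dfn0 _ M Phi -> supp k.+2 Phi ->
  exists d : eq_def M, eqd_ar d = k.+1 /\
    forall t t' : nat -> U, abs (Imag d) t = abs (Imag d) t' <->
      forall w, Phi (scons w t) <-> Phi (scons w t').
Proof.
move=> DPhi sPhi; have H0 := @dfn0_defclass _ M.
pose X (v : nat -> U) := forall w, Phi (scons w v) <-> Phi (scons w (shift k.+1 v)).
have ext (v v' : nat -> U) w : (forall i, (i < k.+1)%N -> v i = v' i) ->
    (Phi (scons w v) <-> Phi (scons w v')).
  by move=> vv'; apply: suppE sPhi _ => -[//|i] ik /=; exact: vv'.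
have DX : @dfn0 _ M X.
  apply: (d_all H0 (G := fun w v => Phi (scons w v) <-> Phi (scons w (shift k.+1 v)))).
  apply: (d_iff H0).
    apply: d_ext (d_reindex H0 id DPhi) => v.
    by rewrite (_ : scons (v 0) (shift 1 v) = v)//; apply: funext => -[].
  apply: d_ext (d_reindex H0 (fun i => if i is j.+1 then (k.+2 + j)%N else 0) DPhi) => v.
  rewrite (_ : scons (v 0) (shift k.+1 (shift 1 v)) = (fun i => v (if i is j.+1 then (k.+2 + j)%N else 0)))//.
  by apply: funext => -[|i].
have [||phi [_ iv hphi]] := @fclass_in_vars _ _ M tt _ X (k.+1 + k.+1) _ DX.
- by split.
- move=> v v' vv' hX w; rewrite -(ext v v' w); last by move=> i ik; apply: vv'; lia.
  rewrite (hX w); apply: ext => i ik; rewrite /shift; apply: vv'; lia.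
have fr (p q : 'I_k.+1 -> U) : formula_rel (M := M) phi p q <->
    forall w, Phi (scons w (untuple p)) <-> Phi (scons w (untuple q)).
  pose v : nat -> U := fun i => if (i < k.+1)%N then untuple p i else untuple q (i - k.+1)%N.
  have -> : formula_rel (M := M) phi p q <-> X v.
    have hv := hphi (@mkasg _ _ M tt v).
    rewrite (_ : (fun n => @mkasg _ _ M tt v (tt, n) : U) = v) in hv; last first.
      by apply: funext => n; rewrite mkasgE.
    rewrite hv; apply: holdsE => // i; rewrite mkasgE /v /pair_tuple.
    case: fintype.splitP => j ij; rewrite [val i]ij ?addKn; exact: untupleE.
  have e w : Phi (scons w v) <-> Phi (scons w (untuple p)).
    by apply: ext => i ik; rewrite /v ik.
  have e' w : Phi (scons w (shift k.+1 v)) <-> Phi (scons w (untuple q)).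
    by apply: ext => i ik; rewrite /shift /v addKn ifN// -leqNgt leq_addr.
  by split=> h w; have := h w; have := e w; have := e' w; tauto.
have eqr : equivalence_on setT (@formula_rel _ M k.+1 phi).
  split=> //.
  - by move=> p _; apply/fr.
  - by move=> p q /fr h; apply/fr => w; have := h w; tauto.
  - by move=> p q r /fr h /fr h'; apply/fr => w; have := h w; have := h' w; tauto.
exists (EqDef iv eqr); split=> // t t'.
rewrite /= proj_class_eq fr.
have e (u : nat -> U) w : Phi (scons w (untuple (fun i : 'I_k.+1 => u i))) <-> Phi (scons w u).
  by apply: ext => i ik; exact: (untupleE (fun i : 'I_k.+1 => u i) (Ordinal ik)).
by split=> h w; have := h w; have := e t w; have := e t' w; tauto.
Qed.

(** E is an equivalence on the orbit only, whereas a sort needs one on all tuples. So y is coded by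
    the set of w in [th] with E y w; [th], found by saturation, makes these sets agree for
    equivalent points of the orbit. *)
Lemma code_exists a E : dfn2 B E -> ER B a E ->
  exists d, eqd_ar d = k.+1 /\ forall x y, eqv B a x -> eqv B a y -> (E x y <-> code_eq d x y).
Proof.
move=> DE [Er Es Et].
have sBa := smallU_setU1 mon (a := a) (small_initial (a := b) (n := k) mon).
have [|||th [Dth tha hth]] := @type_pairs _ _ _ mon B (B +: a) a
    (fun v w => E a v /\ ~ (E a w <-> E v w)) sBa.
- by move=> x; left.
- have DEa : dfn2 (B +: a) E by apply: dfn_sub DE; left.
  by ddfn.
- have aa := eqv_refl B a.
  move=> v w av aw [Eav]; apply; split; last exact: (Et a v w).
  by apply: (Et v a w) => //; exact: Es.
have [|Phi [DPhi sPhi hPhi]] := @base_formula (fun w y => th w /\ E y w).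
  by ddfn.
have [d [dk hd]] := set_code DPhi sPhi.
exists d; split=> // x y ax ay; rewrite /code_eq hd.
have thP z : eqv B a z -> th z by move=> az; rewrite -(eqv_dfn az Dth).
split=> [Exy w|h].
  rewrite -!hPhi.
  suff : th w -> (E x w <-> E y w) by tauto.
  move=> tw; have [g [ag gx]] := eqv_sym ax.
  rewrite (ER_aut x w DE ag) (ER_aut y w DE ag) gx; apply: contrapT => nE.
  apply: (hth (g y) (g w)).
  - exact: (aut_dfn1 y ag Dth).1 (thP y ay).
  - exact: (aut_dfn1 w ag Dth).1 tw.
  - by split=> //; rewrite -gx; exact/(ER_aut x y DE ag).
apply: Es => //; have := h x; rewrite -!hPhi => -[+ _].
by case; [split; [exact: thP|exact: Er]|].
Qed.

End Codes.

(** * The core and its far pairs *)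

Section Far_pairs.
Context {L : signature unit} {M : structure L} {kappa : Type}.
Hypothesis mon : monster kappa M.
Local Notation U := (M tt).
Local Notation Meq := (eq_structure M).
Implicit Types (X : (nat -> U) -> Prop) (E D : U -> U -> Prop) (R : U -> Prop).
Local Notation small := (@smallU L M kappa).
Local Notation dfn2 B E := (dfn B (fun v => E (v 0) (v 1))).
Context (b : nat -> U) (k : nat) (a c : U).
Local Notation B := (initial b k).
Context (E : U -> U -> Prop).
Hypothesis DE : dfn2 (B +: c) E.
Hypothesis EE : ER (B +: c) a E.
Hypothesis E_new : forall D, dfn2 B D -> ER B a D ->
  ~ forall x y, eqv (B +: c) a x -> eqv (B +: c) a y -> (E x y <-> D x y).

Let sB : small B. Proof. exact: small_initial. Qed.
Let sBc : small (B +: c). Proof. exact: smallU_setU1. Qed.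
Let BBc : B `<=` B +: c. Proof. by move=> x; left. Qed.

(* [core] is the set of realizations of the type of [a] over [B] and the codes of
   its classes for the relations in [above]: see [core_realizations]. *)
Definition above D := [/\ dfn2 B D, ER B a D & sub_on (B +: c) a E D].
Definition below D := [/\ dfn2 B D, ER B a D & ~ sub_on (B +: c) a E D].
Definition core y := eqv B a y /\ forall D, above D -> D a y.
Definition far y z := forall D, below D -> ~ D y z.

Lemma core_a : core a.
Proof. by split=> [|D [_ [Dr _ _] _]]; [|apply: Dr]; exact: eqv_refl. Qed.

Lemma core_rel D y z : core y -> core z -> above D -> D y z.
Proof.
move=> [ay hy] [az hz] aD; have [_ [_ Ds Dt] _] := aD; have aa := eqv_refl B a.
by apply: (Dt y a z) => //; [apply: Ds => //; exact: hy|exact: hz].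
Qed.

Lemma core_aut g y z : aut B g -> core y -> core (g y) -> core z -> core (g z).
Proof.
move=> ag cy [agy hgy] cz; have [az _] := cz; have agz : eqv B a (g z) by apply: eqv_trans az _; exists g.
split=> // D aD; have [DD [_ _ Dt] _] := aD.
apply: (Dt a (g y) (g z)) => //; first exact: eqv_refl.
  exact: hgy.
exact: (ER_aut y z DD ag).1 (core_rel cy cz aD).
Qed.

Lemma far_aut g y z : aut B g -> far y z -> far (g y) (g z).
Proof. by move=> ag h D bD; have [DD _ _] := bD; rewrite -(ER_aut y z DD ag); exact: h. Qed.

Lemma far_sym y z : core y -> core z -> far y z -> far z y.
Proof. by move=> [ay _] [az _] h D bD zy; apply: (h D bD); have [_ [_ Ds _] _] := bD; exact: Ds. Qed.

Lemma below_eq : below (fun x y => x = y).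
Proof.
have He B0 : ER B0 a (fun x y : U => x = y) by split=> [x|x y|x y z] // _ _ _ ->.
have DD : dfn2 B (fun x y => x = y) by exact: (dc_eq (dfn_defclass B)).
split=> // sub; apply: (E_new DD (He B)) => x y ax ay; split; first exact: sub.
by move=> <-; case: EE => + _ _; exact.
Qed.

Lemma above_True : above (fun x y => True).
Proof. by split=> //; exact: (d_True (dfn_defclass B)). Qed.

Definition class_code (d : eq_def M) : elt Meq :=
  @to_elt _ _ Meq (Imag d) (abs (Imag d) (with_base b k a)).

Definition core_params : set (elt Meq) := (@relt _ M @` B) `|`
  (class_code @` [set d | eqd_ar d = k.+1 /\ above (code_eq b k d)]).

Lemma eq_def_inj : {in [set d : eq_def M | eqd_ar d = k.+1] &, injective (@eqd_formula _ M)}.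
Proof.
move=> [n phi iv er] [n' phi' iv' er'] /set_mem /= e /set_mem /= e' ee.
subst n n' phi'; congr EqDef; exact: Prop_irrelevance.
Qed.

Lemma small_core_params : Defs.small kappa core_params.
Proof.
have [sL _ _] := mon.
have sC : Defs.small kappa (class_code @` [set d | eqd_ar d = k.+1 /\ above (code_eq b k d)]).
  apply: (small_le _ sL); apply: card_le_trans (card_image_le _ _) _.
  apply: (@card_le_of_inj _ _ _ _ (@eqd_formula _ M)) => // d d' [hd _] [hd' _].
  by apply: eq_def_inj; apply/mem_set.
rewrite /core_params; set C := class_code @` _ in sC *; move: C sC => C sC.
rewrite setUC; elim: (k) => [|n IH].
  by rewrite initial0 image_set0 setU0.
rewrite initialS image_setU image_set1 setUA.
exact: small_setU1 sL tt _ _ _ IH.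
Qed.

(** Relations of [above] identify all points of the core, so the code of [a] is also the code of y
    and of g y; hence [g] fixes it. *)
Lemma core_params_aut g y : aut B g -> core y -> core (g y) ->
  forall X, dE core_params X -> forall v, X v <-> X (fun i => g (v i)).
Proof.
move=> ag cy cgy X; apply: (@aut_dE _ M); first by apply: aut_sub ag.
move=> _ [[u Bu <-]|[d [_ ad] <-]] t /=.
  rewrite -{2}(aut_fix ag Bu); split=> [<-//|]; exact: (aut_inj ag).
have e z : core z -> abs (Imag d) (with_base b k a) = abs (Imag d) (with_base b k z).
  by move=> cz; exact: (core_rel core_a cz ad).
suff : abs (Imag d) (with_base b k a) = abs (Imag d) t <->
    abs (Imag d) (with_base b k a) = abs (Imag d) (fun i => g (t i)) by [].
rewrite {1}(e y cy) (e (g y) cgy) -(with_base_aut y ag).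
by apply: abs_aut; apply: aut_sub ag.
Qed.

Lemma core_realizations (z : U) :
  @realizations _ _ Meq (Real M tt) (@tp _ _ Meq (Real M tt) core_params a) z <-> core z.
Proof.
rewrite realizations_tp; split=> [h|cz X DX Xa].
  have az : eqv B a z.
    apply: (type_orbit mon sB) => R DR Ra; apply: (h R _ Ra).
    by apply: dfn_eq DR => u Bu; left; exists u.
  split=> // D [DD ED sD].
  have [d [dk hd]] := code_exists mon DD ED.
  have ad : above (code_eq b k d).
    split; [exact: code_eq_dfn|exact: code_eq_ER|].
    move=> x y ax ay Exy; apply: (hd x y _ _).1; [exact: eqv_sub ax|exact: eqv_sub ay|exact: sD].
  apply/hd => //; first exact: eqv_refl.
  apply: (h (fun x => code_eq b k d a x)) => //.
  have HA := @dE_defclass _ M core_params.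
  have Ac : core_params (class_code d) by right; exists d.
  apply: (d_subst HA (X := fun v => abs (Imag d) (with_base b k a) = abs (Imag d) v)
    (t := fun i v => with_base b k (v 0) i)); first exact: dE_const Ac id.
  case=> [|i] /=; first exact: (dterm_var HA).
  case ik : (i < k)%N; last exact: (dterm_var HA).
  by apply: (@dfc_param _ _ Meq (Real M tt)); left; exists (b i) => //; exists i.
have [g [ag gz]] := cz.1; have cga : core (g a) by rewrite gz.
by rewrite -gz; exact: (core_params_aut ag core_a cga DX (fun=> a)).1.
Qed.

Section Ordered.
Context (lt : U -> U -> Prop) (G : @gorder L M kappa lt).

(** A relation over B separating z from z' as seen from y either belongs to [above], and then
    relates y to z' as well, or to [below], and then cannot relate y to the far point z. *)
Lemma far_eqv y z z' : core y -> core z -> core z' -> lt y z -> lt y z' ->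
  far y z -> far y z' -> eqv (B +: y) z z'.
Proof.
move=> cy.
wlog zz' : z z' / lt z z' => [hw cz cz' yz yz' fz fz'|cz cz' yz yz' fz fz'].
  case: (go_total G z z') => [h|->|h]; [exact: hw|exact: eqv_refl|].
  by apply: eqv_sym; exact: hw.
have [ay _] := cy; have [az _] := cz; have [az' _] := cz'.
have orb w : eqv B a w -> eqv B y w := eqv_trans (eqv_sym ay).
apply: contrapT => nzz'.
have [D [DD ED yDz nD]] := cut_semi mon G sB yz zz' (orb z az) (orb z' az') nzz'.
have [sub|nsub] := pselect (sub_on (B +: c) a E D).
  by apply: nD; apply: (core_rel cy cz'); split=> //; exact: ER_base ED.
by apply: (fz D) => //; split=> //; exact: ER_base ED.
Qed.

(** Two relations of [below] are comparable, so the coarser one witnesses both steps. *)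
Lemma near_trans y u z : eqv B a y -> eqv B a u -> eqv B a z ->
  ~ far y u -> ~ far u z -> ~ far y z.
Proof.
move=> ay au az nyu nuz.
have near v w : ~ far v w -> exists D, below D /\ D v w.
  by move=> n; apply: contrapT => h; apply: n => D bD Dvw; apply: h; exists D.
have [D [bD yu]] := near _ _ nyu; have [D' [bD' uz]] := near _ _ nuz.
have [DD ED _] := bD; have [DD' ED' _] := bD'.
case: (ER_total G DD DD' ED ED') => sub h.
- by apply: (h D' bD'); have [_ _ Dt] := ED'; apply: (Dt y u z) => //; exact: sub.
- by apply: (h D bD); have [_ _ Dt] := ED; apply: (Dt y u z) => //; exact: sub.
Qed.

Lemma far_between x y z : eqv B a x -> eqv B a y -> eqv B a z -> lt x y -> lt y z ->
  far x y -> far x z.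
Proof.
move=> ax ay az xy yz h D bD xz; have [DD ED _] := bD.
exact: (h D bD) (ER_convex G DD ED ax ay az xy yz xz).
Qed.

Let up D : dfn2 B D -> ER B a D -> dfn2 (B +: c) D /\ ER (B +: c) a D.
Proof. by move=> /(dfn_sub BBc) ? /(ER_mono BBc). Qed.

Lemma next_transport y v : core y -> eqv (B +: c) a y ->
  core v -> eqv (B +: c) a v -> lt a v -> far a v ->
  exists z, [/\ core z, eqv (B +: c) a z, lt y z, far y z & (E y z <-> E a v)].
Proof.
move=> cy [g [ag gy]] cv av lv fv; have agB := aut_sub BBc ag.
have cga : core (g a) by rewrite gy.
exists (g v); split.
- exact: core_aut agB core_a cga cv.
- by apply: eqv_trans av _; exists g.
- by rewrite -gy; exact/(aut_lt G a v ag).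
- by rewrite -gy; exact: far_aut.
- by rewrite -gy -(ER_aut a v DE ag).
Qed.

(** No relation of [below] contains E, so [ER_gap] finds a far point in the E-class of [a]; it lies
    in the core because relations of [above] contain E. *)
Lemma next_inside y : core y -> eqv (B +: c) a y ->
  exists z, [/\ core z, eqv (B +: c) a z, lt y z, far y z & E y z].
Proof.
move=> cy ay.
have [||D ->//|D [DD ED _]|D D' -> [_ _ //]|v [av lv Ev fv]] :=
  @ER_gap _ _ _ mon lt G (B +: c) a (fun D => D = E) below sBc.
- by exists E.
- by exists (fun x y => x = y); exact: below_eq.
- exact: up.
have {}Ev : E a v by exact: Ev.
have cv : core v.
  by split=> [|D [_ _]]; [exact: eqv_sub av|apply=> //; exact: eqv_refl].
have [z [cz az yz fz Ez]] := next_transport cy ay cv av lv fv.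
by exists z; split=> //; exact/Ez.
Qed.

(** A relation of [above] inside E would induce E, against [E_new]; so some point of the core is
    outside the class of [a]. It is far, because relations of [below] are finer than E by
    comparability. *)
Lemma next_outside y : core y -> eqv (B +: c) a y ->
  exists z, [/\ core z, eqv (B +: c) a z, lt y z, far y z & ~ E y z].
Proof.
move=> cy ay.
have [||D [DD ED _]|D ->//|D D' [DD ED EsD] -> DsE|v [av lv hv nEv]] :=
  @ER_gap _ _ _ mon lt G (B +: c) a above (fun D => D = E) sBc.
- by exists (fun x y => True); exact: above_True.
- by exists E.
- exact: up.
- by apply: (E_new DD ED) => x z ax az; split; [exact: EsD|exact: DsE].
have {}nEv : ~ E a v by exact: nEv.
have cv : core v by split=> //; exact: eqv_sub av.
have fv : far a v.
  move=> D [DD ED nED] Dv; have [DD' ED'] := up DD ED.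
  case: (ER_total G DE DD' EE ED') => // sub.
  by apply: nEv; apply: sub => //; exact: eqv_refl.
have [z [cz az yz fz Ez]] := next_transport cy ay cv av lv fv.
by exists z; split=> //; rewrite Ez.
Qed.

End Ordered.

(** * Triviality of the core *)

Section Trivial_core.
Local Notation p := (@tp _ _ Meq (Real M tt) core_params a).
Context (lt' : U -> U -> Prop).
Hypothesis wom : @weakly_o_minimal_pair _ _ Meq core_params (Real M tt) p lt'.

Let coreE : @realizations _ _ Meq (Real M tt) p = core.
Proof. by apply/seteqP; split=> z /core_realizations. Qed.

Let lin : linear_order_on (core : set U) lt'.
Proof. by case: wom => _; rewrite coreE. Qed.

Local Notation final := (eventually core lt').

Let final_and R R' : final R -> final R' -> final (fun z => R z /\ R' z).
Proof. by have [_ _ lt_trans lt_total] := lin; exact: eventually_and. Qed.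

Lemma final_or_not C R : dfn C (fun v => R (v 0)) -> final R \/ final (fun z => ~ R z).
Proof.
move=> DR; have [_ _ lt_trans lt_total] := lin; case: wom => _ _ _ cvxP.
have [|n [I [Icvx RI]]] := cvxP (@relt _ M @` C) (fun z => R z /\ core z).
  apply/(@rel_unary_dfc _ _ Meq (Real M tt)); exists R; split.
    by apply: dfn_eq DR => u Cu; exists u.
  by rewrite coreE.
rewrite coreE in Icvx.
apply: (@eventually_or_not U core lt' lt_trans lt_total a n I R core_a) => [i x y z Ix Iz cy xy yz|z cz].
  by apply: (Icvx i).2 Ix Iz cy xy yz.
have := congr1 (fun Q : U -> Prop => Q z) RI => /= e; split=> [Rz|Iz]; first by rewrite -e.
by move: Iz; rewrite -e => -[].
Qed.

Lemma core_lt_aut g x y z : aut B g -> core y -> core (g y) -> core x -> core z ->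
  lt' x z -> lt' (g x) (g z).
Proof.
move=> ag cy cgy cx cz; case: wom => _ _ /(@rel_binary_dfc _ _ Meq (Real M tt))[Y [DY hY]] _.
move=> /hY[Yxz _ _]; apply/hY; rewrite coreE; split; [|exact: core_aut cgy _..].
exact: (core_params_aut ag cy cgy DY (fun i => if i is 0 then x else z)).1.
Qed.

Lemma final_aut g y R R' : aut B g -> core y -> core (g y) ->
  (forall z, core z -> R z -> R' (g z)) -> final R -> final R'.
Proof.
move=> ag cy cgy RR' [u [cu hu]]; have [h [ah gh hg]] := aut_inv ag.
exists (g u); split; first exact: core_aut cgy cu.
have chy : core (h (g y)) by rewrite gh.
move=> z cz uz; have chz : core (h z) by exact: (core_aut ah cgy chy).
rewrite -(hg z); apply: RR' => //; apply: hu => //.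
case: uz => [<-|uz]; [by left; rewrite gh|right].
by rewrite -(gh u); apply: (core_lt_aut ah cgy chy) => //; exact: core_aut cgy cu.
Qed.

Definition to_right y z := forall Y : U -> U -> Prop,
  dE core_params (fun v => Y (v 0) (v 1)) -> final (Y y) -> Y y z.

Lemma to_right_right_of y z : to_right y z -> @right_of _ _ Meq core_params (Real M tt) p lt' y z.
Proof.
move=> yz phi [[iv hF] o].
have [Phi [DPhi _ hPhi]] : exists Phi, [/\ dE core_params Phi, supp 2 Phi &
    forall x : U, @pholds1 _ _ Meq (Real M tt) phi x <-> Phi (scons x (fun=> y))].
  apply: sequence_params; apply: (@pholds1_dfc _ _ Meq (Real M tt)) => //.
  by apply: over_sub o => e [Ae|->]; [left|right; exists y => //; exists 0].
apply/hPhi; apply: (yz (fun y x => Phi (scons x (fun=> y)))).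
  apply: d_ext (d_reindex (dE_defclass _) (fun i => if i is 0 then 1 else 0) DPhi) => v.
  by rewrite (_ : (fun i => v _) = scons (v 1) (fun=> v 0))//; apply: funext => -[].
move: hF; rewrite coreE => /(final_partP (@pholds1 _ _ Meq (Real M tt) phi) lin)[u [cu hu]].
by exists u; split=> // x cx ux; apply/hPhi; exact: hu.
Qed.

Lemma morley_final (s : nat -> U) i R : @morley _ _ Meq core_params (Real M tt) (@right_type _ _ Meq (Real M tt) p lt') s ->
  dE (core_params `|` @relt _ M @` initial s i) (fun v => R (v 0)) -> final R -> R (s i).
Proof.
move=> ms /(@dfc_pholds1 _ _ Meq (Real M tt))[phi [o iv hphi]] fR.
apply/hphi; apply: (ms i phi); split; last first.
  by apply: over_sub o => e [Ae|[u [j ji ->] <-]]; [left|right; exists j].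
split=> //; rewrite coreE; apply/(final_partP (@pholds1 _ _ Meq (Real M tt) phi) lin).
by have [u [cu hu]] := fR; exists u; split=> // z cz uz; apply/hphi; exact: hu.
Qed.

Lemma to_right_aut g y z : aut B g -> core y -> core (g y) -> to_right y z -> to_right (g y) (g z).
Proof.
move=> ag cy cgy yz Y DY fY; have [h [ah gh hg]] := aut_inv ag.
pose pr x w : nat -> U := fun i => if i is 0 then x else w.
apply: (core_params_aut ag cy cgy DY (pr y z)).1; apply: (yz Y DY).
have chy : core (h (g y)) by rewrite gh.
apply: (final_aut ah cgy chy _ fY) => w cw Yw.
have := (core_params_aut ah cgy chy DY (pr (g y) w)).1 Yw; by rewrite /pr gh.
Qed.

(* Otherwise all points far from [y], on both sides, are excluded by formulas
   that hold on a final part, so that the points near [y] contain a final part;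
   the same holds for a conjugate of [y] far from [y]. *)
Lemma to_right_side (lt : U -> U -> Prop) : @gorder L M kappa lt ->
  @gorder L M kappa (fun x y => lt y x) ->
  (forall y z, core y -> core z -> lt y z -> far y z -> to_right y z) \/
  (forall y z, core y -> core z -> lt z y -> far y z -> to_right y z).
Proof.
move=> G G'; apply: contrapT => /not_orP[n1 n2].
have [y [z1 [cy cz1 l1 f1 nr1]]] : exists y z, [/\ core y, core z, lt y z, far y z & ~ to_right y z].
  by apply: contrapT => h; apply: n1 => y z ? ? ? ?; apply: contrapT => nr; apply: h; exists y, z.
have [y2 [z2 [cy2 cz2 l2 f2 nr2]]] : exists y z, [/\ core y, core z, lt z y, far y z & ~ to_right y z].
  by apply: contrapT => h; apply: n2 => u w ? ? ? ?; apply: contrapT => nr; apply: h; exists u, w.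
have conj u w : core u -> core w -> exists g, [/\ aut B g & g u = w].
  by move=> [au _] [aw _]; have [g [ag gu]] := eqv_trans (eqv_sym au) aw; exists g.
have [g [ag gy2]] := conj y2 y cy2 cy.
have cgy2 : core (g y2) by rewrite gy2.
have [Y1 [DY1 fY1 nY1]] : exists Y : U -> U -> Prop,
    [/\ dE core_params (fun v => Y (v 0) (v 1)), final (Y y) & ~ Y y z1].
  by apply: contrapT => h; apply: nr1 => Y DY fY; apply: contrapT => nY; apply: h; exists Y.
have [Y2 [DY2 fY2 nY2]] : exists Y : U -> U -> Prop,
    [/\ dE core_params (fun v => Y (v 0) (v 1)), final (Y y) & ~ Y y (g z2)].
  apply: contrapT => h; apply: nr2.
  have [k' [ak gk kg]] := aut_inv ag.
  have ky : k' y = y2 by rewrite -gy2 gk.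
  rewrite -ky -(gk z2); apply: to_right_aut => //; first by rewrite ky.
  by move=> Y DY fY; apply: contrapT => nY; apply: h; exists Y.
have cz2' := core_aut ag cy2 cgy2 cz2.
have l2' : lt (g z2) y by rewrite -gy2; exact/(aut_lt G z2 y2 ag).
have f2' : far y (g z2) by rewrite -gy2; exact: far_aut.
pose pr x w : nat -> U := fun i => if i is 0 then x else w.
have move_ (Y : U -> U -> Prop) w w' : dE core_params (fun v => Y (v 0) (v 1)) ->
    eqv (B +: y) w w' -> Y y w -> Y y w'.
  move=> DY [h [ah <-]] Yw; have hy : h y = y by apply: (aut_fix ah); right.
  have ahB : aut B h by apply: aut_sub ah => x; left.
  have chy : core (h y) by rewrite hy.
  by have := (core_params_aut ahB cy chy DY (pr y w)).1 Yw; rewrite /pr hy.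
(* By [far_eqv], the points far from y on one side are all conjugate over B y, so a formula that
   fails at one of them fails at all; [z1] and [g z2] settle the two sides. *)
have near_y : final (fun z => ~ far y z).
  apply: (final_aut (aut_id B) cy cy _ (final_and fY1 fY2)) => z cz [Yz1 Yz2] fz.
  case: (go_total G y z) => h.
  - exact: nY1 (move_ Y1 z z1 DY1 (far_eqv G cy cz cz1 h l1 fz f1) Yz1).
  - by apply: (fz _ below_eq).
  - exact: nY2 (move_ Y2 z (g z2) DY2 (far_eqv G' cy cz cz2' h l2' fz f2') Yz2).
have [v [cv _ _ fv _]] := next_inside G core_a (eqv_refl _ _).
have [h [ah ha]] := conj a y core_a cy.
have cha : core (h a) by rewrite ha.
have cy' := core_aut ah core_a cha cv.
have fy' : far y (h v) by rewrite -ha; exact: far_aut.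
have [f [af fy]] := conj y (h v) cy cy'.
have cfy : core (f y) by rewrite fy.
have near_y' : final (fun z => ~ far (h v) z).
  apply: (final_aut af cy cfy _ near_y) => z cz nz; rewrite -fy => fz; apply: nz.
  have [f' [af' ff' f'f]] := aut_inv af.
  by rewrite -(ff' y) -(ff' z); exact: far_aut.
have [z [cz [nz nz']]] := eventually_ex (final_and near_y near_y').
apply: (near_trans G cy.1 cz.1 cy'.1 nz _ fy').
by move=> /(far_sym cz cy').
Qed.

Section Chains.
Hypothesis triv : forall s : nat -> U, (forall i, core (s i)) ->
  (forall i j, (i < j)%N -> @right_of _ _ Meq core_params (Real M tt) p lt' (s i) (s j)) ->
  @morley _ _ Meq core_params (Real M tt) (@right_type _ _ Meq (Real M tt) p lt') s.
Context (lt : U -> U -> Prop) (G : @gorder L M kappa lt).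
Hypothesis side : forall y z, core y -> core z -> lt y z -> far y z -> to_right y z.
Implicit Types s t : nat -> U.

Definition far_chain s := forall i, [/\ core (s i), lt (s i) (s i.+1) & far (s i) (s i.+1)].

Lemma far_chain_pair s i j : far_chain s -> (i < j)%N -> lt (s i) (s j) /\ far (s i) (s j).
Proof.
move=> cs; elim: j => // j IH; rewrite ltnS leq_eqVlt => /orP[/eqP ->|/IH[lij fij]].
  by have [_ ? ?] := cs j.
have [cj lj _] := cs j; have [ci _ _] := cs i; have [cj' _ _] := cs j.+1.
split; first exact: (go_trans G lij lj).
exact: (far_between G ci.1 cj.1 cj'.1 lij lj fij).
Qed.

Lemma far_chain_morley s : far_chain s ->
  @morley _ _ Meq core_params (Real M tt) (@right_type _ _ Meq (Real M tt) p lt') s.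
Proof.
move=> cs; apply: triv => [i|i j ij]; first by have [] := cs i.
have [lij fij] := far_chain_pair cs ij; have [ci _ _] := cs i; have [cj _ _] := cs j.
by apply: to_right_right_of; exact: side.
Qed.

Lemma far_chain_aut g s : aut B g -> core (g (s 0)) -> far_chain s -> far_chain (fun i => g (s i)).
Proof.
move=> ag cg cs i; have [c0 _ _] := cs 0; have [ci li fi] := cs i; split.
- exact: core_aut ag c0 cg ci.
- exact: (aut_lt G (s i) (s i.+1) ag).1 li.
- exact: far_aut.
Qed.

(** A formula over the first terms of t is eventually true or eventually false in the core, and the
    next terms of both [t] and [g \o s] obey this verdict, since both chains are Morley with the
    same first terms. *)
Lemma far_chain_conj s t n : far_chain s -> far_chain t ->
  exists g, aut B g /\ forall i, (i < n)%N -> g (s i) = t i.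
Proof.
move=> cs ct; elim: n => [|n [g [ag gst]]]; first by exists id; split=> //; exact: aut_id.
have cgs : core (g (s 0)) -> far_chain (fun i => g (s i)) by move=> h; exact: far_chain_aut.
case: n g ag gst cgs => [|n] g ag gst cgs.
  have [c0 _ _] := cs 0; have [c0' _ _] := ct 0.
  have [h [ah h0]] := eqv_trans (eqv_sym c0.1) c0'.1.
  by exists h; split=> // -[].
have {}cgs : far_chain (fun i => g (s i)) by apply: cgs; rewrite gst//; have [] := ct 0.
have ini : initial (fun i => g (s i)) n.+1 = initial t n.+1.
  by apply/seteqP; split=> u [j jn ->]; exists j => //; rewrite gst.
have [h [ah hn]] : eqv (B `|` initial t n.+1) (g (s n.+1)) (t n.+1).
  apply: (type_orbit mon (small_setU_initial mon sB)) => R DR Rg; apply: contrapT => nRt.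
  have DRE (R' : U -> Prop) : dfn (B `|` initial t n.+1) (fun v => R' (v 0)) ->
      dE (core_params `|` @relt _ M @` initial t n.+1) (fun v => R' (v 0)).
    by apply: dfn_eq => u [Bu|tu]; [left; left; exists u|right; exists u].
  case: (final_or_not DR) => fR.
    by apply: nRt; exact: (morley_final (far_chain_morley ct) (DRE _ DR) fR).
  have DnR := DRE (fun z => ~ R z) (d_not (dfn_defclass _) DR).
  by rewrite -ini in DnR; exact: (morley_final (far_chain_morley cgs) DnR fR).
exists (h \o g); split; first by apply: aut_comp => //; apply: aut_sub ah => u; left.
move=> i; rewrite ltnS leq_eqVlt => /orP[/eqP ->//|ni] /=.
by rewrite gst//; apply: (aut_fix ah); right; exists i.
Qed.

(** Steps inside and outside the E-class can be taken in any order, because all terms stay in the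
    core and in the orbit of [a] over B c. *)
Lemma chains_with_breaks (brk : nat -> bool) : exists s, far_chain s /\
  forall i, (E (s i) (s i.+1) /\ ~ E (s i) (s i.+2)) <-> ~~ brk i && brk i.+1.
Proof.
have total (Q : U -> U -> Prop) : (forall y, core y -> eqv (B +: c) a y -> exists z, Q y z) ->
    exists f : U -> U, forall y, core y -> eqv (B +: c) a y -> Q y (f y).
  move=> h; suff /choice[f hf] : forall y, exists z, core y -> eqv (B +: c) a y -> Q y z by exists f.
  move=> y; have [[cy ay]|n] := pselect (core y /\ eqv (B +: c) a y); last by exists y => cy ay; case: n.
  by have [z Qz] := h y cy ay; exists z.
have [fi hfi] := total _ (next_inside G); have [fo hfo] := total _ (next_outside G).
pose s n := iteri n (fun m y => if brk m then fo y else fi y) a.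
have sP n : core (s n) /\ eqv (B +: c) a (s n).
  elim: n => [|n [cn an]]; first by split; [exact: core_a|exact: eqv_refl].
  by rewrite /s /= -/(s n); case: (brk n); [have [] := hfo _ cn an|have [] := hfi _ cn an].
have sE n : E (s n) (s n.+1) <-> ~~ brk n.
  have [cn an] := sP n; rewrite /s /= -/(s n); case: (brk n); last by have [] := hfi _ cn an.
  by have [] := hfo _ cn an.
have [_ Es Et] := EE.
exists s; split=> i.
  have [ci ai] := sP i; split=> //; rewrite /s /= -/(s i); case: (brk i).
  - by have [] := hfo _ ci ai.
  - by have [] := hfi _ ci ai.
  - by have [] := hfo _ ci ai.
  - by have [] := hfi _ ci ai.
have [_ a0] := sP i; have [_ a1] := sP i.+1; have [_ a2] := sP i.+2.
split=> [[E01 nE02]|/andP[/sE E01 b1]].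
  apply/andP; split; first exact/sE.
  apply: contrapT => /negP/sE E12; apply: nE02; exact: (Et (s i) (s i.+1) (s i.+2)).
split=> // E02; have : E (s i.+1) (s i.+2) by apply: (Et (s i.+1) (s i) (s i.+2)) => //; exact: Es.
by move=> /sE; rewrite b1.
Qed.

(* Moving [c] so that a chain with prescribed breaks becomes a fixed chain
   yields a grid of conjugates of [c], one for each pair of breaks. *)
Lemma far_chain_absurd : False.
Proof.
have [Gc [DGc hGc]] := decompose2 DE.
have [y [cy _]] := chains_with_breaks xpred0.
pose X z := Gc z (y 0) (y 1) /\ ~ Gc z (y 0) (y 2).
have DX : dfn (B +: y 0 +: y 1 +: y 2) (fun v => X (v 0)).
  have DG : dfn (B +: y 0 +: y 1 +: y 2) (fun v => Gc (v 0) (v 1) (v 2)).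
    by apply: dfn_sub DGc => x Bx; left; left; left.
  by rewrite /X; ddfn.
have [N hN] := count_orbit G B c DX DX.
pose m := N.+1.
(* Rows are recorded by breaks at 1, ..., m and columns by breaks from m + 3 on. Read at i < m the
   pattern sees only the former, read at m + 2 + j only the latter; m + m + 6 terms suffice for
   both. *)
pose brk (ij : 'I_m * 'I_m) n := (n == ij.1.+1) || (n == m + 3 + ij.2)%N.
have [s hs] := choice (fun ij => chains_with_breaks (brk ij)).
have [h hh] := choice (fun ij => far_chain_conj (m + m + 6) (hs ij).1 cy).
pose shifted i n := y (i + n)%N.
have cshift i : far_chain (shifted i) by move=> n; rewrite /shifted addnS; exact: cy.
(* [r i] brings the terms i, i + 1, i + 2 of y back to 0, 1, 2, so the single relation X reads the
   pattern at every place and the bound N serves for all. *)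
have [r hr] := choice (fun i => far_chain_conj 3 (cshift i) cy).
have key i i' j' : (i + 2 < m + m + 6)%N ->
    X (r i (h (i', j') c)) <-> ~~ brk (i', j') i && brk (i', j') i.+1.
  move=> im; have [ar hry] := hr i; have [ah hhs] := hh (i', j').
  rewrite -(hs (i', j')).2 /X -(hry 0)// -(hry 1)// -(hry 2)//.
  have DG0 := DGc.
  have e n : (n < 3)%N -> Gc (r i (h (i', j') c)) (r i (shifted i 0)) (r i (shifted i n)) <->
      E (s (i', j') i) (s (i', j') (i + n)%N).
    move=> n3; rewrite -(aut_dfn3 _ _ _ ar DGc) /shifted addn0.
    rewrite -(hhs i); last by lia.
    rewrite -(hhs (i + n)%N); last by lia.
    by rewrite -(aut_dfn3 _ _ _ ah DGc) -hGc.
  by rewrite (e 1)// (e 2)// addn1 addn2.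
have := hN m (fun i => r i) (fun j => r (m + 2 + j)%N) (fun i j => h (i, j) c).
rewrite ltnn => /(_ _ _ _ _ _ _ _) h'; apply: notF; apply: h'.
- by move=> i; have [] := hr i.
- by move=> j; have [] := hr (m + 2 + j)%N.
- by move=> i j; exists (h (i, j)); have [] := hh (i, j).
- move=> i j; apply/key; first by have := ltn_ord i; lia.
  rewrite /brk /=; have := ltn_ord i; lia.
- move=> i j; apply/key; first by have := ltn_ord j; lia.
  rewrite /brk /=; have := ltn_ord i; have := ltn_ord j; lia.
- move=> i i' j' /key; rewrite /brk /= => hb; apply: val_inj => /=.
  have := hb _; have := ltn_ord i; have := ltn_ord i'; have := ltn_ord j'; lia.
- move=> j i' j' /key; rewrite /brk /= => hb; apply: val_inj => /=.
  have := hb _; have := ltn_ord j; have := ltn_ord i'; have := ltn_ord j'; lia.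
Qed.

End Chains.

End Trivial_core.

End Far_pairs.

Section Triviality_to_R.
Context {L : signature unit} {M : structure L} {kappa : Type}.
Hypothesis mon : monster kappa M.
Local Notation U := (M tt).
Local Notation Meq := (eq_structure M).
Local Notation small := (@smallU L M kappa).
Local Notation dfn2 B E := (dfn B (fun v => E (v 0) (v 1))).
Hypothesis triv : all_real_types_trivial M kappa.
Context (lt : U -> U -> Prop) (G : @gorder L M kappa lt)
  (G' : @gorder L M kappa (fun x y => lt y x)).

Lemma ER_drop_param (b : nat -> U) k a c (E : U -> U -> Prop) :
  dfn2 (initial b k +: c) E -> ER (initial b k +: c) a E ->
  exists D, [/\ dfn2 (initial b k) D, ER (initial b k) a D &
    forall x y, eqv (initial b k +: c) a x -> eqv (initial b k +: c) a y -> (E x y <-> D x y)].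
Proof.
move=> DE EE; apply: contrapT => h.
have new D : dfn2 (initial b k) D -> ER (initial b k) a D ->
    ~ forall x y, eqv (initial b k +: c) a x -> eqv (initial b k +: c) a y -> (E x y <-> D x y).
  by move=> DD ED hD; apply: h; exists D.
have [lt' [wom tr]] := triv (small_core_params (b := b) (k := k) (a := a) (c := c) (E := E) mon) (@tp_complete _ _ Meq (Real M tt) _ a).
have coreP (z : U) : core b k a c E z ->
    @realizations _ _ Meq (Real M tt) (@tp _ _ Meq (Real M tt) (core_params b k a c E) a) z.
  by move=> cz; apply/(core_realizations mon).
have tr' s := fun cs => tr s (fun i => coreP (s i) (cs i)).
case: (to_right_side mon DE EE new wom G G') => side.
- exact: (far_chain_absurd mon DE EE new wom tr' G side).
- exact: (far_chain_absurd mon DE EE new wom tr' G' side).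
Qed.

(** [ER_drop_param] removes one parameter from a finite list, hence the preliminary reduction to
    finitely many parameters. *)
Lemma condR_of_trivial : condR (kappa := kappa) (M := M).
Proof.
move=> B a E sB DE EE.
(* The finite list of parameters is read below as the first terms of the sequence [b]; beyond the
   list [nth] returns the default [a], which [initial b (size l)] does not reach. *)
have [l [E' [lB DE' EE' hE']]] := ER_finite_params mon G sB DE EE.
pose b n : U := nth (a : {classic U}) l n.
have lE : [set x | (x : {classic U}) \in l] = initial b (size l).
  apply/seteqP; split=> x /=; last by move=> [j jl ->]; exact: mem_nth.
  by move=> xl; exists (index (x : {classic U}) l); [rewrite index_mem|rewrite /b nth_index].
rewrite lE in DE' EE'.
have main k D : dfn2 (initial b k) D -> ER (initial b k) a D ->
    exists psi : U -> U -> Prop, dfn2 set0 psi /\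
      forall x y, eqv (initial b k) a x -> eqv (initial b k) a y -> (D x y <-> psi x y).
  elim: k D => [|k IH] D DD ED.
    exists D; split=> //.
    by rewrite -(initial0 b).
  rewrite initialS in DD ED *.
  have [D' [DD' ED' hD']] := ER_drop_param DD ED.
  have [psi [Dpsi hpsi]] := IH D' DD' ED'.
  have sub : initial b k `<=` initial b k +: b k by move=> u; left.
  exists psi; split=> // x y ax ay; rewrite hD'//; apply: hpsi; exact: eqv_sub sub _.
have [psi [Dpsi hpsi]] := main _ _ DE' EE'.
exists psi; split=> // x y ax ay; rewrite hE'//.
have sub : initial b (size l) `<=` B by rewrite -lE => u; exact: lB.
by apply: hpsi; exact: eqv_sub sub _.
Qed.

End Triviality_to_R.

Theorem proposition4p6 (L : signature unit) (T : set (formula L))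
    (kappa : Type) (M : structure L)
    (T_complete : complete_theory T)
    (M_models_T : models M T)
    (M_monster : monster kappa M)
    (T_wqom : weakly_quasi_o_minimal M)
    (T_simple : theory_simple_semiintervals M kappa) :
  (condition_R M kappa <-> all_real_types_trivial M kappa) /\
  (all_real_types_trivial M kappa <-> binary_theory T).
Proof.
have [lt [G G' W]] := exists_gorder M_monster T_wqom T_simple.
have R2 : condition_R M kappa -> all_real_types_trivial M kappa.
  by move=> /(condR_of_condition_R M_monster) HR; exact: trivial_of_R W.
have R1 : all_real_types_trivial M kappa -> condition_R M kappa.
  by move=> triv; exact: (condition_R_of_condR M_monster (condR_of_trivial M_monster triv G G')).
split; split=> //.
  by move=> /R1/(condR_of_condition_R M_monster) HR; exact: binary_of_R G G' _ _ _.
by move=> bT; apply: R2; exact: (condition_R_of_condR M_monster (condR_of_binary M_models_T bT)).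
Qed.
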